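(* Let $\bar u\in\mathcal K$ be the solution to the weak Signorini problem: for all $v\in\mathcal K$, $\int_\Omega \Lambda\nabla\bar u\cdot\nabla(\bar u-v)\,dx\le\int_\Omega f(\bar u-v)\,dx$. If $\mathcal D=(X_{\mathcal D,\Gamma_1},\Pi_{\mathcal D},\mathbb T_{\mathcal D},\nabla_{\mathcal D})$ is a gradient discretisation for the Signorini problem and $\mathcal K_{\mathcal D}$ is non-empty, then there exists a unique solution $u$ to the gradient scheme $$u\in\mathcal K_{\mathcal D}\quad\text{and}\quad\forall v\in\mathcal K_{\mathcal D},\ \int_\Omega\Lambda\nabla_{\mathcal D}u\cdot\nabla_{\mathcal D}(u-v)\,dx\le\int_\Omega f\,\Pi_{\mathcal D}(u-v)\,dx.$$ Furthermore, this solution satisfies, for any $v_{\mathcal D}\in\mathcal K_{\mathcal D}$, $$\|\nabla_{\mathcal D}u-\nabla\bar u\|_{L^2(\Omega)^d}\le\sqrt{\tfrac{2}{\underline\lambda}G_{\mathcal D}(\bar u,v_{\mathcal D})^+}+\tfrac1{\underline\lambda}\big[W_{\mathcal D}(\Lambda\nabla\bar u)+(\overline\lambda+\underline\lambda)S_{\mathcal D}(\bar u,v_{\mathcal D})\big]$$ and $$\|\Pi_{\mathcal D}u-\bar u\|_{L^2(\Omega)}\le C_{\mathcal D}\sqrt{\tfrac{2}{\underline\lambda}G_{\mathcal D}(\bar u,v_{\mathcal D})^+}+\tfrac1{\underline\lambda}\big[C_{\mathcal D}W_{\mathcal D}(\Lambda\nabla\bar u)+(C_{\mathcal D}\overline\lambda+\underline\lambda)S_{\mathcal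 D}(\bar u,v_{\mathcal D})\big],$$ where $G_{\mathcal D}(\bar u,v_{\mathcal D})=\langle\gamma_{\mathbf n}(\Lambda\nabla\bar u),\mathbb T_{\mathcal D}v_{\mathcal D}-\gamma\bar u\rangle$ and $G_{\mathcal D}^+=\max(0,G_{\mathcal D})$.
   Context: Data. $\Omega$ is an open bounded connected subset of $\mathbb R^d$, $d\ge1$, with Lipschitz boundary. $\Lambda$ is a measurable function from $\Omega$ to the $d\times d$ real matrices and there exist $\underline\lambda,\overline\lambda>0$ such that, for a.e. $x\in\Omega$, $\Lambda(x)$ is symmetric with eigenvalues in $[\underline\lambda,\overline\lambda]$. $\Gamma_1,\Gamma_2,\Gamma_3$ are measurable pairwise disjoint subsets of $\partial\Omega$ with $\Gamma_1\cup\Gamma_2\cup\Gamma_3=\partial\Omega$, and $\Gamma_1$ has positive $(d-1)$-dimensional measure. $f\in L^2(\Omega)$, $a\in L^2(\partial\Omega)$. $\gamma:H^1(\Omega)\to H^{1/2}(\partial\Omega)$ is the trace operator. $\mathcal K=\{v\in H^1(\Omega):\gamma(v)=0\text{ on }\Gamma_1,\ \gamma(v)\le a\text{ on }\Gamma_3\}$; it is assumed throughout that $\mathcal K\neq\emptyset$ (the weak problem then has a unique solution). Normal trace. $H_{\rm div}(\Omega)=\{\boldsymbol\psi\in L^2(\Omega)^d:\mathrm{div}\,\boldsymbol\psi\in L^2(\Omega)\}$. For $\boldsymbol\psi\in H_{\rm div}(\Omega)$, $\gamma_{\mathbf n}(\boldsymbol\psi)\in(H^{1/2}(\partial\Omega))'$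 is defined by $\langle\gamma_{\mathbf n}(\boldsymbol\psi),\gamma(w)\rangle=\int_\Omega\boldsymbol\psi\cdot\nabla w\,dx+\int_\Omega \mathrm{div}(\boldsymbol\psi)\,w\,dx$ for all $w\in H^1(\Omega)$, where $\langle\cdot,\cdot\rangle$ is the duality product between $(H^{1/2}(\partial\Omega))'$ and $H^{1/2}(\partial\Omega)$. (The weak problem gives $-\mathrm{div}(\Lambda\nabla\bar u)=f$ in the sense of distributions, so $\Lambda\nabla\bar u\in H_{\rm div}(\Omega)$.) Gradient discretisation for the Signorini problem. $\mathcal D=(X_{\mathcal D,\Gamma_1},\Pi_{\mathcal D},\mathbb T_{\mathcal D},\nabla_{\mathcal D})$ where $X_{\mathcal D,\Gamma_1}$ is a finite dimensional real vector space; $\Pi_{\mathcal D}:X_{\mathcal D,\Gamma_1}\to L^2(\Omega)$, $\mathbb T_{\mathcal D}:X_{\mathcal D,\Gamma_1}\to H^{1/2}_{\Gamma_1}(\partial\Omega):=\{v\in H^{1/2}(\partial\Omega):v=0\text{ on }\Gamma_1\}$ and $\nabla_{\mathcal D}:X_{\mathcal D,\Gamma_1}\to L^2(\Omega)^d$ are linear; and $\|\nabla_{\mathcal D}\cdot\|_{L^2(\Omega)^d}$ is a norm on $X_{\mathcal D,\Gamma_1}$. Set $\mathcal K_{\mathcal D}=\{v\in X_{\mathcal D,\Gamma_1}:\mathbb T_{\mathcal D}v\le a\text{ on }\Gamma_3\}$. Indicators. $$C_{\mathcal D}=\max_{v\in X_{\mathcal D,\Gamma_1}\setminus\{0\}}\Big(\frac{\|\Pi_{\mathcal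 D}v\|_{L^2(\Omega)}}{\|\nabla_{\mathcal D}v\|_{L^2(\Omega)^d}}+\frac{\|\mathbb T_{\mathcal D}v\|_{H^{1/2}(\partial\Omega)}}{\|\nabla_{\mathcal D}v\|_{L^2(\Omega)^d}}\Big);$$ for $(\varphi,v)\in\mathcal K\times\mathcal K_{\mathcal D}$, $S_{\mathcal D}(\varphi,v)=\|\Pi_{\mathcal D}v-\varphi\|_{L^2(\Omega)}+\|\nabla_{\mathcal D}v-\nabla\varphi\|_{L^2(\Omega)^d}$; for $\boldsymbol\psi\in H_{\rm div}(\Omega)$, $$W_{\mathcal D}(\boldsymbol\psi)=\sup_{v\in X_{\mathcal D,\Gamma_1}\setminus\{0\}}\frac1{\|\nabla_{\mathcal D}v\|_{L^2(\Omega)^d}}\Big|\int_\Omega(\nabla_{\mathcal D}v\cdot\boldsymbol\psi+\Pi_{\mathcal D}v\,\mathrm{div}(\boldsymbol\psi))\,dx-\langle\gamma_{\mathbf n}(\boldsymbol\psi),\mathbb T_{\mathcal D}v\rangle\Big|.$$ *)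

(* Defs.v *)
From HB Require Import structures.
From mathcomp Require Import all_boot all_order all_algebra.
From mathcomp Require Import all_classical all_reals all_analysis.

Set Implicit Arguments.
Unset Strict Implicit.
Unset Printing Implicit Defensive.
Import Order.TTheory GRing.Theory Num.Theory.
Import numFieldNormedType.Exports.

Local Open Scope classical_set_scope.
Local Open Scope ring_scope.

(* The library norm on 'rV[R]_d is the sup norm; the Euclidean structure
   needed for L^2(Omega)^d and for Hausdorff measures is introduced here. *)
Definition dotv (R : realType) (d : nat) (u v : 'rV[R]_d) : R :=
  \sum_(i < d) u 0 i * v 0 i.

Definition enorm (R : realType) (d : nat) (u : 'rV[R]_d) : R :=
  Num.sqrt (dotv u u).

(* Outer measures obtained from countable covers, the set B costing w B;
   w B = +oo forbids the use of B. *)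
Definition cover_outer (R : realType) (T : Type) (w : set T -> \bar R)
    (A : set T) : \bar R :=
  ereal_inf [set (\sum_(k <oo) w (B k))%E
            | B in [set B : (set T)^nat | A `<=` \bigcup_k B k]].

Definition allsets_type (T : Type) := T.

Section cover_outer_theory.
Context (R : realType) (T : pointedType).

HB.instance Definition _ := Pointed.on (allsets_type T).
Let as0 : setT (set0 : set (allsets_type T)). Proof. by []. Qed.
Let asC (A : set (allsets_type T)) : setT A -> setT (~` A). Proof. by []. Qed.
Let asU (F : (set (allsets_type T))^nat) :
  (forall i, setT (F i)) -> setT (\bigcup_i F i).
Proof. by []. Qed.
HB.instance Definition _ := @isMeasurable.Build default_measure_display
  (allsets_type T) setT as0 asC asU.

Lemma cover_outerE (w : set T -> \bar R) :
  cover_outer w = @mu_ext _ (allsets_type T) R w.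
Proof.
apply/funext => A; rewrite /cover_outer /mu_ext; congr ereal_inf.
by apply/seteqP; split=> x [B] /= BA <-; exists B => //; case: BA.
Qed.

Context (w : set T -> \bar R).
Hypothesis w0 : (w set0 = 0)%E.
Hypothesis w_ge0 : forall A, (0 <= w A)%E.

Lemma cover_outer0 : cover_outer w set0 = 0%E.
Proof. by rewrite cover_outerE mu_ext0. Qed.

Lemma cover_outer_ge0 A : (0 <= cover_outer w A)%E.
Proof. by rewrite cover_outerE mu_ext_ge0. Qed.

Lemma le_cover_outer : {homo cover_outer w : A B / A `<=` B >-> (A <= B)%E}.
Proof.
move=> A B AB; rewrite cover_outerE.
exact: (@le_mu_ext _ (allsets_type T) R w A B AB).
Qed.

Lemma cover_outer_sigma_subadditive : sigma_subadditive (cover_outer w).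
Proof.
rewrite cover_outerE.
exact: (@mu_ext_sigma_subadditive _ (allsets_type T) R w w_ge0).
Qed.

End cover_outer_theory.

Section euclidean_measures.
Context (R : realType) (d : nat).
Local Notation E := 'rV[R]_d.

Definition box (a b : E) : set E := [set x | forall i, a 0 i <= x 0 i <= b 0 i].

(* +oo on nonempty sets that are not boxes *)
Definition box_cost (B : set E) : \bar R :=
  if `[< B = set0 >] then 0%E else
  ereal_inf [set (\prod_(i < d) (ab.2 0 i - ab.1 0 i))%:E
            | ab in [set ab : E * E |
                (forall i, ab.1 0 i <= ab.2 0 i) /\ B = box ab.1 ab.2]].

Definition lebesgue_outer : set E -> \bar R := cover_outer box_cost.

Lemma box_cost0 : box_cost set0 = 0%E.
Proof. by rewrite /box_cost; case: asboolP. Qed.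

Lemma box_cost_ge0 B : (0 <= box_cost B)%E.
Proof.
rewrite /box_cost; case: asboolP => // _.
apply: le_ereal_inf_tmp => _ [[a b] [/= ab _] <-].
by rewrite lee_fin; apply: prodr_ge0 => i _; rewrite subr_ge0.
Qed.

Definition ediam (A : set E) : \bar R :=
  ereal_sup [set (enorm (xy.1 - xy.2))%:E | xy in A `*` A].

End euclidean_measures.

Section hausdorff.
Context (R : realType) (d s : nat).
Local Notation E := 'rV[R]_d.

(* volume of the unit ball of R^s divided by 2^s: with this factor the
   s-dimensional Hausdorff measure of R^s is the Lebesgue measure *)
Definition hausdorff_factor : R :=
  fine (@lebesgue_outer R s [set x | enorm x <= 1]) / 2 ^+ s.

Definition hausdorff_cost (delta : R) (B : set E) : \bar R :=
  if `[< B = set0 >] then 0%E else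
  if (ediam B <= delta%:E)%E
  then (hausdorff_factor * fine (ediam B) ^+ s)%:E else +oo%E.

Definition hausdorff_outer (A : set E) : \bar R :=
  ereal_sup [set cover_outer (hausdorff_cost delta) A
            | delta in [set delta : R | 0 < delta]].

Lemma hausdorff_cost0 delta : hausdorff_cost delta set0 = 0%E.
Proof. by rewrite /hausdorff_cost; case: asboolP. Qed.

Lemma hausdorff_cost_ge0 delta B : (0 <= hausdorff_cost delta B)%E.
Proof.
rewrite /hausdorff_cost; case: asboolP => // /eqP/set0P[x Bx].
case: ifP => // _; rewrite lee_fin mulr_ge0 ?exprn_ge0 //.
  rewrite divr_ge0 ?exprn_ge0 // fine_ge0 //.
  by apply: cover_outer_ge0; exact: box_cost_ge0.
rewrite fine_ge0 //; apply: le_trans (ereal_sup_ubound _); last first.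
  by exists (x, x).
by rewrite lee_fin sqrtr_ge0.
Qed.

Lemma hausdorff_outer0 : hausdorff_outer set0 = 0%E.
Proof.
rewrite /hausdorff_outer [X in ereal_sup X](_ : _ = [set 0%E]) ?ereal_sup1 //.
have h0 e : cover_outer (hausdorff_cost e) set0 = 0%E.
  by apply: cover_outer0 => [|B]; [exact: hausdorff_cost0
                                  |exact: hausdorff_cost_ge0].
apply/seteqP; split=> [_ [e _ <-]|_ ->] /=; first by rewrite h0.
by exists 1; rewrite /= ?ltr01 // h0.
Qed.

Lemma cover_le_hausdorff_outer e A : 0 < e ->
  (cover_outer (hausdorff_cost e) A <= hausdorff_outer A)%E.
Proof. by move=> e0; apply: ereal_sup_ubound; exists e. Qed.

Lemma hausdorff_outer_ge0 A : (0 <= hausdorff_outer A)%E.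
Proof.
apply: le_trans (cover_le_hausdorff_outer A ltr01).
by apply: cover_outer_ge0 => B; exact: hausdorff_cost_ge0.
Qed.

Lemma le_hausdorff_outer :
  {homo hausdorff_outer : A B / A `<=` B >-> (A <= B)%E}.
Proof.
move=> A B AB; apply: ge_ereal_sup => _ [e /= e0 <-].
apply: le_trans (cover_le_hausdorff_outer B e0).
by apply: le_cover_outer AB.
Qed.

Lemma hausdorff_outer_sigma_subadditive : sigma_subadditive hausdorff_outer.
Proof.
move=> F; apply: ge_ereal_sup => _ [e /= e0 <-].
apply: le_trans (cover_outer_sigma_subadditive _ F) _ => [B|].
  exact: hausdorff_cost_ge0.
apply: lee_nneseries => [i _ _|i _]; last exact: cover_le_hausdorff_outer.
by apply: cover_outer_ge0 => B; exact: hausdorff_cost_ge0.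
Qed.

End hausdorff.

Definition boundary (T : topologicalType) (A : set T) : set T :=
  closure A `\` A°.

Definition cara_measure (R : realType) (T : pointedType)
    (mu : {outer_measure set T -> \bar R}) :
    {measure set (caratheodory_type mu) -> \bar R} :=
  (mu : set (caratheodory_type mu) -> \bar R).

Section measures_on_domain.
Context (R : realType) (d : nat) (Omega : set 'rV[R]_d).
Local Notation E := 'rV[R]_d.

Definition dx_outer (A : set E) : \bar R := lebesgue_outer (A `&` Omega).

Definition dS_outer (A : set E) : \bar R :=
  hausdorff_outer d.-1 (A `&` boundary Omega).

Let dx0 : dx_outer set0 = 0%E.
Proof.
by rewrite /dx_outer set0I; apply: cover_outer0;
  [exact: box_cost0 | exact: box_cost_ge0].
Qed.
Let dx_ge0 A : (0 <= dx_outer A)%E.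
Proof. by apply: cover_outer_ge0; exact: box_cost_ge0. Qed.
Let dx_le : {homo dx_outer : A B / A `<=` B >-> (A <= B)%E}.
Proof. by move=> A B AB; apply: le_cover_outer; exact: setSI. Qed.
Let dx_sub : sigma_subadditive dx_outer.
Proof.
move=> F; rewrite /dx_outer setI_bigcupl.
by apply: cover_outer_sigma_subadditive; exact: box_cost_ge0.
Qed.
HB.instance Definition _ :=
  isOuterMeasure.Build R E dx_outer dx0 dx_ge0 dx_le dx_sub.

Let dS0 : dS_outer set0 = 0%E.
Proof. by rewrite /dS_outer set0I hausdorff_outer0. Qed.
Let dS_ge0 A : (0 <= dS_outer A)%E.
Proof. exact: hausdorff_outer_ge0. Qed.
Let dS_le : {homo dS_outer : A B / A `<=` B >-> (A <= B)%E}.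
Proof. by move=> A B AB; apply: le_hausdorff_outer; exact: setSI. Qed.
Let dS_sub : sigma_subadditive dS_outer.
Proof.
move=> F; rewrite /dS_outer setI_bigcupl.
exact: hausdorff_outer_sigma_subadditive.
Qed.
HB.instance Definition _ :=
  isOuterMeasure.Build R E dS_outer dS0 dS_ge0 dS_le dS_sub.

(* Lebesgue measure restricted to Omega and surface measure of the boundary,
   both as complete measures on the whole space, on the sigma-algebra of their
   Caratheodory-measurable sets: A is measurable iff A `&` Omega
   (resp. A `&` boundary Omega) is. Functions on Omega and on its boundary are
   represented by functions on R^d, considered up to almost everywhere
   equality for these measures. *)
Definition dx : {measure set (caratheodory_type dx_outer) -> \bar R} :=
  cara_measure dx_outer.

Definition dS : {measure set (caratheodory_type dS_outer) -> \bar R} :=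
  cara_measure dS_outer.

End measures_on_domain.

Section L2.
Context (disp : measure_display) (T : measurableType disp) (R : realType).
Context (mu : {measure set T -> \bar R}).

Definition L2 (f : T -> R) : Prop := f \in Lfun mu 2%:E.

Definition L2norm (f : T -> R) : R := fine ('N[mu]_(2%:E)[EFin \o f])%E.

Definition L2v (d : nat) (f : T -> 'rV[R]_d) : Prop :=
  forall i, L2 (fun x => f x 0 i).

Definition L2vnorm (d : nat) (f : T -> 'rV[R]_d) : R :=
  L2norm (fun x => enorm (f x)).

(* convergence in L^2, with the extended-real norm so that an infinite norm
   is not mistaken for 0 *)
Definition L2_cvg (f_ : (T -> R)^nat) (f : T -> R) : Prop :=
  ('N[mu]_(2%:E)[EFin \o (f_ n \- f)%R])%E @[n --> \oo] --> (0 : \bar R)%E.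

End L2.

Section sobolev.
Context (R : realType) (d : nat) (Omega : set 'rV[R]_d).
Local Notation E := 'rV[R]_d.
Local Notation dx := (dx Omega).
Local Notation dS := (dS Omega).

(* Near each boundary point, in suitable orthonormal coordinates y = x Q,
   Omega is the strict epigraph of a Lipschitz function h of the coordinates
   other than y_j. *)
Definition lipschitz_boundary : Prop :=
  forall x0, boundary Omega x0 ->
  exists (Q : 'M[R]_d) (j : 'I_d) (h : 'rV[R]_d.-1 -> R) (k : R),
    [/\ Q *m Q^T = 1%:M, k.-lipschitz h &
      \forall x \near x0, Omega x <-> h (col' j (x *m Q)) < (x *m Q) 0 j].

Definition partial (i : 'I_d) (phi : E -> R) : E -> R :=
  fun x => 'D_(delta_mx 0 i : E) phi x.

Definition grad (phi : E -> R) : E -> E := fun x => \row_i partial i phi x.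

Fixpoint Ck (k : nat) (phi : E -> R) : Prop :=
  continuous phi /\
  if k is k'.+1 then
    forall i, (forall x, derivable phi x (delta_mx 0 i : E)) /\
              Ck k' (partial i phi)
  else True.

Definition smooth (phi : E -> R) : Prop := forall k, Ck k phi.

Definition test_function (phi : E -> R) : Prop :=
  [/\ smooth phi, compact (closure [set x | phi x != 0]) &
      closure [set x | phi x != 0] `<=` Omega].

Definition is_weak_grad (v : E -> R) (g : E -> E) : Prop :=
  L2v dx g /\ forall phi, test_function phi -> forall i,
    \int[dx]_x (v x * partial i phi x) = - \int[dx]_x (g x 0 i * phi x).

Definition H1 (v : E -> R) : Prop := L2 dx v /\ exists g, is_weak_grad v g.

Definition wgrad (v : E -> R) : E -> E := xget (cst 0) (is_weak_grad v).

Definition H1norm (v : E -> R) : R :=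
  Num.sqrt (L2norm dx v ^+ 2 + L2vnorm dx (wgrad v) ^+ 2).

Definition is_weak_div (psi : E -> E) (g : E -> R) : Prop :=
  L2 dx g /\ forall phi, test_function phi ->
    \int[dx]_x dotv (psi x) (grad phi x) = - \int[dx]_x (g x * phi x).

(* The divergence of psi in H_div(Omega), that is of psi in L^2(Omega)^d such
   that is_weak_div psi has an element, which is then unique up to a.e.
   equality; likewise for wgrad on H1. *)
Definition wdiv (psi : E -> E) : E -> R := xget (cst 0) (is_weak_div psi).

(* The graph of the trace operator gamma, which is the extension by continuity
   to H^1(Omega), with values in L^2 of the boundary, of the restriction of
   smooth functions to the boundary. When the boundary is Lipschitz, each v in
   H1 has exactly one trace up to a.e. equality. *)
Definition is_trace (v : E -> R) (g : E -> R) : Prop :=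
  [/\ H1 v, L2 dS g &
    exists phi_ : (E -> R)^nat,
      [/\ forall n, smooth (phi_ n),
          L2_cvg dx phi_ v,
          forall i, L2_cvg dx (fun n => partial i (phi_ n))
                              (fun x => wgrad v x 0 i) &
          L2_cvg dS phi_ g]].

(* H^{1/2} of the boundary is the range of the trace operator, with the
   quotient norm. *)
Definition H12 (g : E -> R) : Prop := exists w, is_trace w g.

Definition H12norm (g : E -> R) : R :=
  inf [set H1norm w | w in [set w | is_trace w g]].

(* L is determined by this identity on H12, where it is linear, and continuous
   for H12norm; its values outside H12 are irrelevant. *)
Definition is_normal_trace (psi : E -> E) (L : (E -> R) -> R) : Prop :=
  forall w g, is_trace w g ->
    L g = \int[dx]_x dotv (psi x) (wgrad w x) + \int[dx]_x (wdiv psi x * w x).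

Definition normal_trace (psi : E -> E) : (E -> R) -> R :=
  xget (cst 0) (is_normal_trace psi).

End sobolev.

Section signorini.
Context (R : realType) (d : nat) (Omega : set 'rV[R]_d).
Local Notation E := 'rV[R]_d.
Local Notation dx := (dx Omega).
Local Notation dS := (dS Omega).

(* M xi, the vector xi of R^d being encoded as a row *)
Definition mulmxv (M : 'M[R]_d) (xi : E) : E := xi *m M^T.

Definition diffusion_tensor (Lam : E -> 'M[R]_d) (lo hi : R) : Prop :=
  (forall i j, measurable_fun setT
     ((fun x => Lam x i j) : caratheodory_type (dx_outer Omega) -> R)) /\
  (\forall x \ae dx, (Lam x)^T = Lam x /\
     forall mu, eigenvalue (Lam x) mu -> lo <= mu <= hi).

Definition boundary_partition (G1 G2 G3 : set E) : Prop :=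
  [/\ [/\ (dS_outer Omega).-cara.-measurable G1,
          (dS_outer Omega).-cara.-measurable G2 &
          (dS_outer Omega).-cara.-measurable G3],
      [/\ G1 `&` G2 = set0, G1 `&` G3 = set0 & G2 `&` G3 = set0] &
      G1 `|` G2 `|` G3 = boundary Omega].

Definition signorini_set (G1 G3 : set E) (a : E -> R) : set (E -> R) :=
  [set v | exists g, [/\ is_trace Omega v g,
     \forall x \ae dS, G1 x -> g x = 0 &
     \forall x \ae dS, G3 x -> g x <= a x]].

Definition signorini_solution (Lam : E -> 'M[R]_d) (f : E -> R)
    (G1 G3 : set E) (a : E -> R) (u : E -> R) : Prop :=
  signorini_set G1 G3 a u /\
  forall v, signorini_set G1 G3 a v ->
    \int[dx]_x dotv (mulmxv (Lam x) (wgrad Omega u x))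
                    (wgrad Omega (u \- v) x)
      <= \int[dx]_x (f x * (u x - v x)).

Definition is_norm (X : lmodType R) (N : X -> R) : Prop :=
  [/\ forall u v, N (u + v) <= N u + N v,
      forall c u, N (c *: u) = `|c| * N u &
      forall u, N u = 0 -> u = 0].

Record gradient_discretisation (G1 : set E) := GradientDiscretisation {
  gdX : vectType R ;
  gdPi : gdX -> E -> R ;
  gdT : gdX -> E -> R ;
  gdGrad : gdX -> E -> E ;
  gdPi_L2 : forall v, L2 dx (gdPi v) ;
  gdT_H12 : forall v, H12 Omega (gdT v) ;
  gdT_eq0 : forall v, \forall x \ae dS, G1 x -> gdT v x = 0 ;
  gdGrad_L2 : forall v, L2v dx (gdGrad v) ;
  gdPi_linear : forall c u v,
    \forall x \ae dx, gdPi (c *: u + v) x = c * gdPi u x + gdPi v x ;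
  gdT_linear : forall c u v,
    \forall x \ae dS, gdT (c *: u + v) x = c * gdT u x + gdT v x ;
  gdGrad_linear : forall c u v,
    \forall x \ae dx, gdGrad (c *: u + v) x = c *: gdGrad u x + gdGrad v x ;
  gdGrad_norm : is_norm (fun v => L2vnorm dx (gdGrad v))
}.

Context (G1 : set E) (D : gradient_discretisation G1).

Definition gdK (G3 : set E) (a : E -> R) : set (gdX D) :=
  [set v | \forall x \ae dS, G3 x -> gdT v x <= a x].

Definition scheme_solution (Lam : E -> 'M[R]_d) (f : E -> R)
    (G3 : set E) (a : E -> R) (u : gdX D) : Prop :=
  gdK G3 a u /\
  forall v, gdK G3 a v ->
    \int[dx]_x dotv (mulmxv (Lam x) (gdGrad u x)) (gdGrad (u - v) x)
      <= \int[dx]_x (f x * gdPi (u - v) x).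

(* The suprema below are over bounded sets, since gdX is finite dimensional;
   they are 0 when the discrete space is trivial. *)
Definition gdC : R :=
  sup [set L2norm dx (gdPi v) / L2vnorm dx (gdGrad v) +
           H12norm Omega (gdT v) / L2vnorm dx (gdGrad v)
      | v in [set v : gdX D | v != 0]].

Definition gdS (phi : E -> R) (v : gdX D) : R :=
  L2norm dx (gdPi v \- phi) + L2vnorm dx (gdGrad v \- wgrad Omega phi).

Definition gdW (psi : E -> E) : R :=
  sup [set (L2vnorm dx (gdGrad v))^-1 *
           `| \int[dx]_x (dotv (gdGrad v x) (psi x)
                          + gdPi v x * wdiv Omega psi x)
              - normal_trace Omega psi (gdT v) |
      | v in [set v : gdX D | v != 0]].

End signorini.

Arguments gdK {R d Omega G1} D G3 a.
Arguments scheme_solution {R d Omega G1} D Lam f G3 a u.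
Arguments gdC {R d Omega G1} D.
Arguments gdS {R d Omega G1 D} phi v.
Arguments gdW {R d Omega G1} D psi.

(* Main.v *)
(* Write [e := u - v], [n] for the norm of its discrete gradient and [psi] for the
   flux [Lam (wgrad ubar)], whose divergence is [-f]. Coercivity and the scheme give
     lo n^2 <= int f (Pi e) - int Lam (G v) . (G e),
   and the definition of [gdW psi] replaces the first integral by
   [int psi . (G e) - <psi_n, T e>] up to [gdW psi * n]. The integrals then differ by
   at most [hi * gdS ubar v * n]. Testing the continuous problem with a lifting of
   [T u], which is admissible because [u] is in [gdK], bounds the boundary term by
   [<psi_n, T v - gamma ubar>]. Solving this quadratic inequality bounds [n].

   Since [wgrad], [wdiv] and traces are defined by choice among almost everywhere
   equal functions, uniqueness of weak derivatives is needed. It rests on the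
   fundamental lemma of the calculus of variations for the Caratheodory extension of
   the Lebesgue outer measure on 'rV[R]_d: half-spaces, hence open sets, are
   measurable, and indicators of open sets are limits of test functions. *)

Require Import Defs.
From mathcomp Require Import all_boot all_order all_algebra.
From mathcomp Require Import all_classical all_reals all_analysis.
From mathcomp Require Import measurable_realfun ring lra.

Set Implicit Arguments.
Unset Strict Implicit.
Unset Printing Implicit Defensive.
Import Order.TTheory GRing.Theory Num.Theory.
Import numFieldNormedType.Exports.

Local Open Scope classical_set_scope.
Local Open Scope ring_scope.

(** * L2 spaces *)

(** Suprema and choices are total here: [sup] of an unbounded set and [xget] of an empty predicate
    return defaults. The numbers [gdC] and [gdW] therefore bound nothing until their defining sets
    are shown bounded. This is where finite dimension enters: the discrete gradient norm controls
    coordinates, and coordinates control every map involved. The operators of the discretisation are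
    linear only almost everywhere, so estimates are made on representatives and then carried across
    null sets. Symmetry of [Lam] makes the scheme the first-order condition of a minimisation, and
    it turns bounds on eigenvalues into bounds on the quadratic form through the Rayleigh quotient,
    without diagonalisation. Linearity of traces also needs smooth functions to be measurable for
    the surface measure; for a Hausdorff measure this comes from additivity on sets at positive
    distance. *)

Section semi_inner_product.
Context (R : realType) (V : lmodType R) (P : V -> Prop) (b : V -> V -> R).
Hypothesis P_lin : forall c u v, P u -> P v -> P (c *: u + v).
Hypothesis b_sym : forall u v, P u -> P v -> b u v = b v u.
Hypothesis b_lin : forall c u v w, P u -> P v -> P w ->
  b (c *: u + v) w = c * b u w + b v w.
Hypothesis b_ge0 : forall u, P u -> 0 <= b u u.

Lemma sip_expand c u v : P u -> P v ->
  b (c *: u + v) (c *: u + v) = c ^+ 2 * b u u + 2 * c * b u v + b v v.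
Proof.
move=> Pu Pv; have Pw := P_lin c Pu Pv.
rewrite b_lin// (b_sym Pu Pw) (b_sym Pv Pw) !b_lin// (b_sym Pv Pu); ring.
Qed.

(** Only semi-definiteness is available, so [b u u] may vanish with [u] nonzero. The form at
    [c *: u + v] is a nonnegative quadratic in [c]: its minimum gives the inequality when [b u u] is
    positive; otherwise it is affine in [c], which forces [b u v = 0]. *)
Lemma sip_cauchy_schwarz_sqr u v : P u -> P v ->
  b u v ^+ 2 <= b u u * b v v.
Proof.
move=> Pu Pv.
have q c : 0 <= c ^+ 2 * b u u + 2 * c * b u v + b v v.
  by rewrite -sip_expand//; exact/b_ge0/P_lin.
have [u0|u0] := eqVneq (b u u) 0; last first.
  have u1 : 0 < b u u by rewrite lt_neqAle eq_sym u0 b_ge0.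
  have := q (- b u v / b u u).
  have -> : (- b u v / b u u) ^+ 2 * b u u + 2 * (- b u v / b u u) * b u v
    + b v v = (b u u * b v v - b u v ^+ 2) / b u u by field.
  by rewrite pmulr_lge0 ?invr_gt0// subr_ge0.
rewrite u0 mul0r; have [->|uv0] := eqVneq (b u v) 0; first by rewrite expr0n.
(* At this [c] the affine function takes the value [-1]. *)
have := q (- (b v v + 1) / (2 * b u v)).
rewrite u0 mulr0 add0r.
have -> : 2 * (- (b v v + 1) / (2 * b u v)) * b u v = - (b v v + 1) by field.
lra.
Qed.

Lemma sip_cauchy_schwarz u v : P u -> P v ->
  b u v <= Num.sqrt (b u u) * Num.sqrt (b v v).
Proof.
move=> Pu Pv; rewrite -sqrtrM ?b_ge0//.
apply: le_trans (ler_norm _) _; rewrite -sqrtr_sqr ler_wsqrtr//.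
exact: sip_cauchy_schwarz_sqr.
Qed.

Lemma sip_triangle u v : P u -> P v ->
  Num.sqrt (b (u + v) (u + v)) <= Num.sqrt (b u u) + Num.sqrt (b v v).
Proof.
move=> Pu Pv.
rewrite -(ler_pXn2r (ltn0Sn 1))// ?nnegrE ?addr_ge0 ?sqrtr_ge0//.
have := @sip_expand 1 _ _ Pu Pv; rewrite scale1r => E.
have Puv : P (u + v) by have := P_lin 1 Pu Pv; rewrite scale1r.
rewrite sqr_sqrtr ?b_ge0// E sqrrD !sqr_sqrtr ?b_ge0//.
have := sip_cauchy_schwarz Pu Pv; lra.
Qed.

End semi_inner_product.

Section dotv_theory.
Context (R : realType) (d : nat).
Implicit Types u v w : 'rV[R]_d.

Lemma dotvC u v : dotv u v = dotv v u.
Proof. by apply: eq_bigr => i _; rewrite mulrC. Qed.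

Lemma dotv_linl c u v w : dotv (c *: u + v) w = c * dotv u w + dotv v w.
Proof.
rewrite /dotv mulr_sumr -big_split /=; apply: eq_bigr => i _.
rewrite !mxE; ring.
Qed.

Lemma dotv_linr c u v w : dotv w (c *: u + v) = c * dotv w u + dotv w v.
Proof. by rewrite dotvC dotv_linl !(dotvC w). Qed.

Lemma dotvDl u v w : dotv (u + v) w = dotv u w + dotv v w.
Proof. by have := dotv_linl 1 u v w; rewrite scale1r mul1r. Qed.

Lemma dotvZl c u w : dotv (c *: u) w = c * dotv u w.
Proof.
have := dotv_linl c u 0 w; rewrite addr0 => ->; rewrite [X in _ + X]big1 ?addr0//.
by move=> i _; rewrite mxE mul0r.
Qed.

Lemma dotvDr u v w : dotv w (u + v) = dotv w u + dotv w v.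
Proof. by rewrite dotvC dotvDl !(dotvC w). Qed.

Lemma dotvZr c u w : dotv w (c *: u) = c * dotv w u.
Proof. by rewrite dotvC dotvZl !(dotvC w). Qed.

Lemma dotvBr u v w : dotv w (u - v) = dotv w u - dotv w v.
Proof. by rewrite dotvDr -scaleN1r dotvZr mulN1r. Qed.

Lemma dotvBl u v w : dotv (u - v) w = dotv u w - dotv v w.
Proof. by rewrite dotvC dotvBr !(dotvC w). Qed.

Lemma dotv_ge0 u : 0 <= dotv u u.
Proof. by apply: sumr_ge0 => i _; rewrite -expr2 sqr_ge0. Qed.

Lemma dotv_eq0 u : (dotv u u == 0) = (u == 0).
Proof.
apply/idP/eqP => [/eqP u0|->]; last first.
  by rewrite /dotv big1// => i _; rewrite mxE mul0r.
apply/rowP => i; rewrite mxE; apply/eqP.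
have : u 0 i * u 0 i == 0.
  have := @psumr_eq0P _ _ predT (fun i => u 0 i * u 0 i) _ u0 i isT.
  by move=> ->// j _; rewrite -expr2 sqr_ge0.
by rewrite -expr2 sqrf_eq0.
Qed.

Lemma enorm_sqr u : enorm u ^+ 2 = dotv u u.
Proof. by rewrite sqr_sqrtr// dotv_ge0. Qed.

Lemma coord_le_enorm u i : `|u 0 i| <= enorm u.
Proof.
rewrite /enorm -sqrtr_sqr ler_wsqrtr// /dotv (bigD1 i)//= -expr2 lerDl.
by apply: sumr_ge0 => j _; rewrite -expr2 sqr_ge0.
Qed.

End dotv_theory.

Section L2_theory.
Context (disp : measure_display) (T : measurableType disp) (R : realType).
Context (mu : {measure set T -> \bar R}).
Implicit Types f g h : T -> R.
Local Notation L1 f := (mu.-integrable setT (EFin \o f)).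

Lemma L1D f g : L1 f -> L1 g -> L1 (f \+ g).
Proof.
move=> f1 g1.
have -> : EFin \o (f \+ g) = ((EFin \o f) \+ (EFin \o g))%E by [].
exact: integrableD.
Qed.

Lemma L1Z c f : L1 f -> L1 (fun x => c * f x).
Proof. by move=> f1; have := integrableZl measurableT c f1. Qed.

Lemma RintD f g : L1 f -> L1 g ->
  \int[mu]_x (f x + g x) = \int[mu]_x f x + \int[mu]_x g x.
Proof. by move=> f1 g1; rewrite RintegralD. Qed.

Lemma RintZ c f : L1 f -> \int[mu]_x (c * f x) = c * \int[mu]_x f x.
Proof. by move=> f1; rewrite RintegralZl. Qed.

Lemma L1_sum (I : Type) (s : seq I) (F : I -> T -> R) :
  (forall i, L1 (F i)) -> L1 (fun x => \sum_(i <- s) F i x).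
Proof.
move=> F1; elim: s => [|i s IH].
  under [X in EFin \o X]funext => x do rewrite big_nil.
  exact: integrable0.
under [X in EFin \o X]funext => x do rewrite big_cons.
exact: L1D.
Qed.

Lemma L1_measurable f : L1 f -> measurable_fun setT f.
Proof. by move=> /measurable_int/measurable_EFinP. Qed.

Lemma ae_eq_Rint f g : measurable_fun setT f -> measurable_fun setT g ->
  (\forall x \ae mu, f x = g x) -> \int[mu]_x f x = \int[mu]_x g x.
Proof.
move=> mf mg fg; congr fine; apply: ae_eq_integral => //.
- exact/measurable_EFinP.
- exact/measurable_EFinP.
- by apply: filterS fg => x /= -> _.
Qed.

Lemma ae_le_L1 f g : measurable_fun setT f -> L1 g ->
  (\forall x \ae mu, `|f x| <= g x) -> L1 f.
Proof.
move=> mf g1 fg; apply/integrableP; split; first exact/measurable_EFinP.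
move/integrableP : (g1) => [_]; apply: le_lt_trans.
apply: ae_ge0_le_integral => //.
- by do 2 apply: measurableT_comp => //.
- by do 2 apply: measurableT_comp => //; exact: L1_measurable.
- apply: filterS fg => x /= fg _; rewrite lee_fin.
  exact: le_trans (ler_norm _).
Qed.

Lemma sqrt_Rint_sqr f : L2norm mu f = Num.sqrt (\int[mu]_x (f x ^+ 2)).
Proof.
rewrite /L2norm unlock.
under eq_integral => x _ do
  rewrite /= powR_mulrn// real_normK ?num_real//.
rewrite /Rintegral; set I := (\int[mu]_x _)%E.
have I0 : (0 <= I)%E by apply: integral_ge0 => x _; rewrite lee_fin sqr_ge0.
move: I0; case: I => [r| |]//= => [r0|_].
- by rewrite powR12_sqrt.
- by rewrite sqrtr0 /poweR ifF//; apply/negbTE; rewrite invr_eq0 pnatr_eq0.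
Qed.

Lemma L2P f : L2 mu f <-> measurable_fun setT f /\ L1 (fun x => f x ^+ 2).
Proof.
split=> [f2|[mf f2]].
  split; last exact: Lfun2_integrable_sqr.
  by have := sub_Lfun_mfun f2; rewrite inE.
rewrite /L2 inE; apply/andP; split; rewrite inE//= /finite_norm unlock.
rewrite poweR_lty//.
under eq_integral => x _ do
  rewrite /= powR_mulrn// real_normK ?num_real//.
exact: integrable_lty f2.
Qed.

Lemma L2_measurable f : L2 mu f -> measurable_fun setT f.
Proof. by move=> /L2P[]. Qed.

Lemma L2_mul f g : L2 mu f -> L2 mu g -> L1 (fun x => f x * g x).
Proof. by move=> f2 g2; apply/Lfun1_integrable; exact: Lfun2_mul_Lfun1. Qed.

Lemma L2_lin c f g : L2 mu f -> L2 mu g -> L2 mu (fun x => c * f x + g x).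
Proof.
move=> f2 g2; have /L2P[mf _] := f2; have /L2P[mg _] := g2.
apply/L2P; split.
  by apply: measurable_funD => //; exact: measurable_funM.
have := L1D (L1Z (c ^+ 2) (L2_mul f2 f2))
  (L1D (L1Z (2 * c) (L2_mul f2 g2)) (L2_mul g2 g2)).
by apply: eq_integrable => // x _ /=; congr EFin; ring.
Qed.

Lemma L2_0 : L2 mu (fun=> 0).
Proof.
apply/L2P; split => //.
by under [X in EFin \o X]funext => x do rewrite expr0n/=; exact: integrable0.
Qed.

Lemma L2_Z c f : L2 mu f -> L2 mu (fun x => c * f x).
Proof.
move=> f2; have := L2_lin c f2 L2_0.
by under [X in L2 mu X]funext => x do rewrite addr0.
Qed.

Let ips f g := \int[mu]_x (f x * g x).

Let ips_lin c f g h : L2 mu f -> L2 mu g -> L2 mu h ->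
  ips (c *: f + g) h = c * ips f h + ips g h.
Proof.
move=> f2 g2 h2; have fh := L2_mul f2 h2; have gh := L2_mul g2 h2.
rewrite /ips -RintZ// -RintD//; last exact: L1Z.
by apply: eq_Rintegral => x _ /=; rewrite !fctE/= /GRing.scale/=; ring.
Qed.

Let ips_sym f g : ips f g = ips g f.
Proof. by apply: eq_Rintegral => x _; rewrite mulrC. Qed.

Let ips_ge0 f : 0 <= ips f f.
Proof. by apply: Rintegral_ge0 => x _; rewrite -expr2 sqr_ge0. Qed.

Let L2normE f : L2norm mu f = Num.sqrt (ips f f).
Proof.
by rewrite sqrt_Rint_sqr; congr Num.sqrt; apply: eq_Rintegral => x _; rewrite expr2.
Qed.

Lemma L2_cauchy_schwarz f g : L2 mu f -> L2 mu g ->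
  \int[mu]_x (f x * g x) <= L2norm mu f * L2norm mu g.
Proof.
move=> f2 g2; rewrite !L2normE.
apply: (@sip_cauchy_schwarz R (T -> R) (L2 mu) ips) => //.
exact: L2_lin.
Qed.

Lemma L2normD f g : L2 mu f -> L2 mu g ->
  L2norm mu (f \+ g) <= L2norm mu f + L2norm mu g.
Proof.
move=> f2 g2; rewrite !L2normE.
apply: (@sip_triangle R (T -> R) (L2 mu) ips) => //.
exact: L2_lin.
Qed.

Lemma L2norm_ge0 f : 0 <= L2norm mu f.
Proof. by rewrite L2normE sqrtr_ge0. Qed.

Lemma L2normZ c f : L2 mu f -> L2norm mu (fun x => c * f x) = `|c| * L2norm mu f.
Proof.
move=> f2; rewrite !sqrt_Rint_sqr -sqrtr_sqr -sqrtrM ?sqr_ge0// -RintZ.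
  by congr Num.sqrt; apply: eq_Rintegral => x _; rewrite exprMn.
by have /L2P[] := f2.
Qed.

Lemma ae_eq_L2norm f g : measurable_fun setT f -> measurable_fun setT g ->
  (\forall x \ae mu, f x = g x) -> L2norm mu f = L2norm mu g.
Proof.
move=> mf mg fg; rewrite !sqrt_Rint_sqr; congr Num.sqrt.
apply: ae_eq_Rint; [exact: measurable_funX|exact: measurable_funX|].
by apply: filterS fg => x ->.
Qed.

Section vector.
Context (d : nat).
Implicit Types F G H : T -> 'rV[R]_d.

Lemma L2v_lin c F G : L2v mu F -> L2v mu G -> L2v mu (fun x => c *: F x + G x).
Proof.
move=> F2 G2 i; rewrite (_ : (fun _ => _) = (fun x => c * F x 0 i + G x 0 i)); first exact: L2_lin.
by apply/funext => x; rewrite !mxE.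
Qed.

Lemma L2v_Z c F : L2v mu F -> L2v mu (fun x => c *: F x).
Proof.
move=> F2 i; rewrite (_ : (fun _ => _) = (fun x => c * F x 0 i)); first exact: L2_Z.
by apply/funext => x; rewrite !mxE.
Qed.

Lemma L2v_D F G : L2v mu F -> L2v mu G -> L2v mu (F \+ G).
Proof.
move=> F2 G2; have := L2v_lin 1 F2 G2.
by under [X in L2v mu X -> _]funext => x do rewrite scale1r.
Qed.

Lemma L2v_B F G : L2v mu F -> L2v mu G -> L2v mu (F \- G).
Proof.
move=> F2 G2; have := L2v_lin (-1) G2 F2.
by under [X in L2v mu X -> _]funext => x do rewrite scaleN1r addrC.
Qed.

Lemma L1_dotv F G : L2v mu F -> L2v mu G -> L1 (fun x => dotv (F x) (G x)).
Proof. by move=> F2 G2; apply: L1_sum => i; exact: L2_mul. Qed.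

Let ip F G := \int[mu]_x dotv (F x) (G x).

Let ip_lin c F G H : L2v mu F -> L2v mu G -> L2v mu H ->
  ip (c *: F + G) H = c * ip F H + ip G H.
Proof.
move=> f2 g2 h2; have fh := L1_dotv f2 h2; have gh := L1_dotv g2 h2.
rewrite /ip -RintZ// -RintD//; last exact: L1Z.
by apply: eq_Rintegral => x _ /=; rewrite !fctE/= dotv_linl.
Qed.

Let ip_sym F G : ip F G = ip G F.
Proof. by apply: eq_Rintegral => x _; rewrite dotvC. Qed.

Let ip_ge0 F : 0 <= ip F F.
Proof. by apply: Rintegral_ge0 => x _; exact: dotv_ge0. Qed.

Lemma L2vnormE F : L2vnorm mu F = Num.sqrt (\int[mu]_x dotv (F x) (F x)).
Proof.
rewrite /L2vnorm sqrt_Rint_sqr; congr Num.sqrt.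
by apply: eq_Rintegral => x _; rewrite enorm_sqr.
Qed.

Lemma L2vnorm_sqr F : L2vnorm mu F ^+ 2 = \int[mu]_x dotv (F x) (F x).
Proof. by rewrite L2vnormE sqr_sqrtr//; exact: ip_ge0. Qed.

Lemma L2v_cauchy_schwarz F G : L2v mu F -> L2v mu G ->
  \int[mu]_x dotv (F x) (G x) <= L2vnorm mu F * L2vnorm mu G.
Proof.
move=> f2 g2; rewrite !L2vnormE.
have := @sip_cauchy_schwarz R (T -> 'rV[R]_d) (L2v mu (d:=d)) ip L2v_lin
  (fun u v _ _ => ip_sym u v) ip_lin (fun u _ => ip_ge0 u) F G f2 g2.
exact.
Qed.

Lemma L2vnormD F G : L2v mu F -> L2v mu G ->
  L2vnorm mu (F \+ G) <= L2vnorm mu F + L2vnorm mu G.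
Proof.
move=> f2 g2; rewrite !L2vnormE.
have := @sip_triangle R (T -> 'rV[R]_d) (L2v mu (d:=d)) ip L2v_lin
  (fun u v _ _ => ip_sym u v) ip_lin (fun u _ => ip_ge0 u) F G f2 g2.
exact.
Qed.

Lemma L2vnorm_ge0 F : 0 <= L2vnorm mu F.
Proof. exact: L2norm_ge0. Qed.

Lemma L2vnormZ c F : L2v mu F -> L2vnorm mu (fun x => c *: F x) = `|c| * L2vnorm mu F.
Proof.
move=> F2; rewrite !L2vnormE -sqrtr_sqr -sqrtrM ?sqr_ge0//.
rewrite -(RintZ _ (L1_dotv F2 F2)); congr Num.sqrt.
by apply: eq_Rintegral => x _; rewrite dotvZl dotvZr; ring.
Qed.

Lemma L2vnormN F : L2vnorm mu (fun x => - F x) = L2vnorm mu F.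
Proof.
rewrite !L2vnormE; congr Num.sqrt; apply: eq_Rintegral => x _.
by rewrite -scaleN1r dotvZl dotvZr; ring.
Qed.

Lemma ae_eq_Rint_dotv F F' G G' : L2v mu F -> L2v mu F' -> L2v mu G -> L2v mu G' ->
  (\forall x \ae mu, F x = F' x) -> (\forall x \ae mu, G x = G' x) ->
  \int[mu]_x dotv (F x) (G x) = \int[mu]_x dotv (F' x) (G' x).
Proof.
move=> F2 F2' G2 G2' FF' GG'; apply: ae_eq_Rint.
- exact/L1_measurable/L1_dotv.
- exact/L1_measurable/L1_dotv.
- by apply: filterS2 FF' GG' => x -> ->.
Qed.

Lemma ae_eq_L2vnorm F F' : L2v mu F -> L2v mu F' ->
  (\forall x \ae mu, F x = F' x) -> L2vnorm mu F = L2vnorm mu F'.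
Proof. by move=> *; rewrite !L2vnormE; congr Num.sqrt; exact: ae_eq_Rint_dotv. Qed.

End vector.

(** Minkowski's inequality is applied to extended-real norms, so the approximating functions need
    only be measurable; this suits smooth functions with no growth condition. *)
Lemma L2_cvg_lin c (f_ : (T -> R)^nat) f (g_ : (T -> R)^nat) g :
  (forall n, measurable_fun setT (f_ n)) ->
  measurable_fun setT f -> (forall n, measurable_fun setT (g_ n)) ->
  measurable_fun setT g -> L2_cvg mu f_ f -> L2_cvg mu g_ g ->
  L2_cvg mu (fun n x => c * f_ n x + g_ n x) (fun x => c * f x + g x).
Proof.
move=> mf_ mf mg_ mg fc gc; rewrite /L2_cvg.
apply: (@squeeze_cvge _ _ _ _ (fun=> 0%E) _
  (fun n => (`|c|%:E * 'N[mu]_2%:E[EFin \o (f_ n \- f)%R]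
            + 'N[mu]_2%:E[EFin \o (g_ n \- g)%R])%E)).
- apply: nearW => n; rewrite Lnorm_ge0/=.
  have m1 : measurable_fun setT (f_ n \- f) by exact: measurable_funB.
  have H : ('N[mu]_2%:E[EFin \o (fun x => c * (f_ n x - f x))%R] <=
       `|c|%:E * 'N[mu]_2%:E[EFin \o (f_ n \- f)%R])%E.
    rewrite unlock.
    under eq_integral => x _ do rewrite /= normrM powRM// EFinM.
    rewrite ge0_integralZl//; last first.
      apply/measurable_EFinP.
      apply/(@measurableT_comp _ _ _ _ _ _ (fun x : R => x `^ 2)%R) => //.
      exact/measurableT_comp.
    rewrite poweRM ?integral_ge0//.
    by rewrite poweR_EFin -powRrM mulfV// powRr1.
  apply: le_trans (leeD H (lexx _)).
  have -> : EFin \o ((fun x => c * f_ n x + g_ n x)%R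
      \- (fun x => c * f x + g x)%R) =
    EFin \o ((fun x => c * (f_ n x - f x))%R \+ (g_ n \- g)%R).
    by apply/funext => x /=; congr EFin; ring.
  apply: minkowski_EFin => //.
  - by apply: measurable_funM => //.
  - exact: measurable_funB.
  - by rewrite ler1n.
- exact: cvg_cst.
- have -> : (0 : \bar R)%E = (`|c|%:E * 0 + 0)%E by rewrite mule0 adde0.
  by apply: cvgeD => //; apply: cvgeZl.
Qed.

End L2_theory.

(** * Variational inequalities in finite dimension *)

Section finite_dimensional.
Context (R : realType).

Section continuity.
Context (T : topologicalType).
Implicit Types f g : T -> R.

Lemma fctD_continuous f g : continuous f -> continuous g ->
  continuous (fun x => f x + g x).
Proof. by move=> fc gc x; apply: cvgD; [exact: fc|exact: gc]. Qed.

Lemma fctM_continuous f g : continuous f -> continuous g ->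
  continuous (fun x => f x * g x).
Proof. by move=> fc gc x; apply: cvgM; [exact: fc|exact: gc]. Qed.

Lemma fctZ_continuous c f : continuous f -> continuous (fun x => c * f x).
Proof. by move=> fc x; apply: cvgMr; exact: fc. Qed.

Lemma fctN_continuous f : continuous f -> continuous (fun x => - f x).
Proof. by move=> fc x; apply: cvgN; exact: fc. Qed.

Lemma fct_sum_continuous (I : Type) (s : seq I) (F : I -> T -> R) :
  (forall i, continuous (F i)) -> continuous (fun x => \sum_(i <- s) F i x).
Proof.
move=> Fc; elim: s => [|i s IH].
  under [X in continuous X]eq_fun do rewrite big_nil.
  exact: cst_continuous.
under [X in continuous X]eq_fun do rewrite big_cons.
exact: fctD_continuous.
Qed.

End continuity.

Section forms.
Context (n : nat).
Local Notation V := 'rV[R]_n.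

Lemma linear_form_expand (l : V -> R)
  (l_lin : forall (c : R) u v, l (c *: u + v) = c * l u + l v) u :
  l u = \sum_i u 0 i * l (delta_mx 0 i).
Proof.
have l0 : l 0 = 0.
  by have := l_lin (-1) 0 0; rewrite scaler0 addr0 mulN1r addNr.
have lS (s : seq 'I_n) :
    l (\sum_(i <- s) u 0 i *: delta_mx 0 i) = \sum_(i <- s) u 0 i * l (delta_mx 0 i).
  elim: s => [|i s IH]; first by rewrite !big_nil.
  by rewrite !big_cons l_lin IH.
by rewrite -lS -row_sum_delta.
Qed.

Lemma coord_le_norm (u : V) i : `|u 0 i| <= `|u|.
Proof.
rewrite [leRHS]/Num.Def.normr /= mx_normrE.
by apply/bigmax_geP; right => /=; exists (0, i).
Qed.

Lemma linear_form_continuous (l : V -> R)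
  (l_lin : forall (c : R) u v, l (c *: u + v) = c * l u + l v) : continuous l.
Proof.
rewrite (_ : l = fun u => \sum_i u 0 i * l (delta_mx 0 i)).
  apply: fct_sum_continuous => i; apply: fctM_continuous.
    exact: coord_continuous.
  exact: cst_continuous.
by apply/funext => u; exact: linear_form_expand.
Qed.

Lemma linear_form_bound (l : V -> R)
  (l_lin : forall (c : R) u v, l (c *: u + v) = c * l u + l v) u :
  `|l u| <= (\sum_i `|l (delta_mx 0 i)|) * `|u|.
Proof.
rewrite (linear_form_expand l_lin) mulr_suml.
apply: le_trans (ler_norm_sum _ _ _) _; apply: ler_sum => i _.
by rewrite normrM mulrC ler_wpM2l// coord_le_norm.
Qed.

(** Expanding over the basis gives a finite sum of coordinates times linear forms, each
    continuous. *)
Lemma quadratic_form_continuous (b : V -> V -> R)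
  (b_sym : forall u v, b u v = b v u)
  (b_lin : forall (c : R) u v w, b (c *: u + v) w = c * b u w + b v w) :
  continuous (fun u => b u u).
Proof.
rewrite (_ : (fun u => b u u) = fun u : V => \sum_i u 0 i * b u (delta_mx 0 i)).
  apply: fct_sum_continuous => i; apply: fctM_continuous.
    exact: coord_continuous.
  by apply: (@linear_form_continuous (b^~ (delta_mx 0 i))).
apply/funext => u; rewrite [LHS](@linear_form_expand (b^~ u))//.
by apply: eq_bigr => i _; rewrite b_sym.
Qed.

(** By compactness the form has a positive minimum on the unit sphere of the sup norm, and
    homogeneity extends the bound to all vectors. *)
Lemma posdef_coercive (b : V -> V -> R)
  (b_sym : forall u v, b u v = b v u)
  (b_lin : forall (c : R) u v w, b (c *: u + v) w = c * b u w + b v w)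
  (b_pos : forall u, u != 0 -> 0 < b u u) :
  exists2 al, 0 < al & forall u, al * `|u| ^+ 2 <= b u u.
Proof.
have bZ c u : b (c *: u) (c *: u) = c ^+ 2 * b u u.
  have b0 w : b 0 w = 0.
    by have := b_lin (-1) 0 0 w; rewrite scaler0 addr0 mulN1r addNr.
  have bZl w v : b (c *: w) v = c * b w v.
    by have := b_lin c w 0 v; rewrite addr0 b0 addr0.
  by rewrite bZl b_sym bZl mulrA.
pose S := [set u : V | `|u| = 1].
(* An empty sphere means that every vector is [0], and any positive constant will do. *)
have [S0|] := pselect (S !=set0); last first.
  move=> S0; exists 1 => // u; have [->|u0] := eqVneq u 0.
    by have := bZ 0 0; rewrite scale0r normr0 !expr0n/= mul0r mulr0 => ->.
  exfalso; apply: S0; exists (`|u|^-1 *: u).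
  by rewrite /S/= normrZ normfV normr_id mulVf// normr_eq0.
have cS : compact S.
  apply: bounded_closed_compact.
    by exists 1; split => // x x1 u /= ->; exact: ltW.
  rewrite (_ : S = (fun u : V => `|u|) @^-1` [set 1])//.
  have nc : continuous (fun u : V => `|u|) by move=> u; exact: norm_continuous.
  exact: preimage_closed.
have [u /set_mem Su umin] : exists2 c, c \in S & forall t, t \in S -> b c c <= b t t.
  apply: (@EVT_min_rV R n (fun u => b u u)) => //.
  exact/continuous_subspaceT/(quadratic_form_continuous b_sym b_lin).
have u0 : u != 0.
  by apply/negP => /eqP u0; move: Su; rewrite /S/= u0 normr0 => /eqP; rewrite eq_sym oner_eq0.
exists (b u u); first exact: b_pos.
move=> v; have [->|v0] := eqVneq v 0.
  by have := bZ 0 0; rewrite scale0r normr0 !expr0n/= mul0r mulr0 => ->.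
have := umin (`|v|^-1 *: v).
have nv : 0 < `|v| by rewrite normr_gt0.
rewrite inE /S/= normrZ normfV normr_id mulVf ?gt_eqF// => /(_ erefl).
by rewrite bZ exprVn ler_pdivlMl ?exprn_gt0// mulrC.
Qed.

End forms.

(* The solution minimises [b u u - 2 l u] over [K]. *)
Lemma variational_inequality_rV (n : nat) (b : 'rV[R]_n -> 'rV[R]_n -> R) (l : 'rV[R]_n -> R)
  (K : set 'rV[R]_n)
  (b_sym : forall u v, b u v = b v u)
  (b_lin : forall (c : R) u v w, b (c *: u + v) w = c * b u w + b v w)
  (b_pos : forall u, u != 0 -> 0 < b u u)
  (l_lin : forall (c : R) u v, l (c *: u + v) = c * l u + l v) :
  closed K -> K !=set0 ->
  (forall t u v, 0 <= t <= 1 -> K u -> K v -> K (t *: (v - u) + u)) ->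
  exists2 u, K u & forall v, K v -> b u (u - v) <= l (u - v).
Proof.
move=> Kcl [w Kw] Kconv.
have [al al0 hal] := posdef_coercive b_sym b_lin b_pos.
pose J u := b u u - 2 * l u.
have Jc : continuous J.
  apply: fctD_continuous; first exact: (quadratic_form_continuous b_sym b_lin).
  apply: fctN_continuous; apply: fctZ_continuous.
  exact: (linear_form_continuous l_lin).
pose A := K `&` [set u | J u <= J w].
have cA : compact A.
  apply: bounded_closed_compact; last first.
    apply: closedI => //.
    rewrite (_ : [set u | _] = J @^-1` [set x | x <= J w])//.
    exact: preimage_closed.
  pose la := \sum_i `|l (delta_mx 0 i)|.
  (* On the sublevel set, [al] times the squared norm of [u] is at most [2 * la] times the norm plus
     the absolute value of [J w]. The added [1] makes the norm at least [1], so the last term can be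
     multiplied by the norm; beyond this radius the bound fails. *)
  exists ((2 * la + `|J w|) / al + 1); split => [|M]; first exact: num_real.
  move=> hM u [_ /= uw].
  rewrite leNgt; apply/negP => Mu.
  have la0 : 0 <= la by apply: sumr_ge0 => i _.
  have lu := linear_form_bound l_lin u; rewrite -/la in lu.
  have := hal u.
  have h1 : (2 * la + `|J w|) / al + 1 < `|u| by exact: lt_trans Mu.
  have h2 : 2 * la + `|J w| < al * (`|u| - 1).
    by rewrite -ltr_pdivrMl// mulrC; lra.
  have h3 : l u <= la * `|u| by exact: le_trans (ler_norm _) _.
  have h0 : J w <= `|J w| by exact: ler_norm.
  have h00 : 0 <= `|J w| by [].
  have h4 : 1 <= `|u|.
    apply: ltW; apply: le_lt_trans h1; rewrite lerDr divr_ge0// ?addr_ge0 ?mulr_ge0//.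
    exact: ltW.
  move: uw; rewrite /J -/(J w) => uw h5.
  have h6 : (2 * la + `|J w|) * `|u| < al * (`|u| - 1) * `|u|.
    by rewrite ltr_pM2r//; lra.
  have h7 : `|J w| <= `|J w| * `|u| by rewrite ler_peMr.
  have h8 : 0 <= al * `|u| by rewrite mulr_ge0 // ltW.
  nra.
have A0 : A !=set0 by exists w; split => /=.
have [u /set_mem[Ku uw] umin] := EVT_min_rV A0 cA (continuous_subspaceT Jc).
have Jmin v : K v -> J u <= J v.
  move=> Kv; have [vw|vw] := leP (J v) (J w); first by apply: umin; rewrite inE; split.
  exact: le_trans uw (ltW vw).
exists u => // v Kv.
have bl w1 w2 w3 c : b w3 (c *: w1 + w2) = c * b w3 w1 + b w3 w2.
  by rewrite b_sym b_lin !(b_sym w3).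
(* Minimality of [J u] along the segment from [u] to [v], divided by [t]. *)
have key t : 0 < t <= 1 -> 0 <= 2 * (b u (v - u) - l (v - u)) + t * b (v - u) (v - u).
  move=> /andP[t0 t1].
  have := Jmin _ (Kconv t u v _ Ku Kv); rewrite (ltW t0) t1 => /(_ isT).
  rewrite /J !l_lin b_lin !bl (b_sym (v - u) u) => h.
  rewrite -(pmulr_rge0 _ t0).
  nra.
have lN x : l (- x) = - l x.
  have l0 : l 0 = 0.
    by have := l_lin (-1) 0 0; rewrite scaler0 addr0 mulN1r addNr.
  by have := l_lin (-1) x 0; rewrite addr0 scaleN1r l0 addr0 mulN1r.
have bN x : b u (- x) = - b u x.
  have b0 : b u 0 = 0.
    by have := bl 0 0 u (-1); rewrite scaler0 addr0 mulN1r addNr.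
  by have := bl x 0 u (-1); rewrite addr0 scaleN1r b0 addr0 mulN1r.
have -> : u - v = - (v - u) by rewrite opprB.
rewrite lN bN lerN2 -subr_ge0 leNgt; apply/negP => neg.
set e := b u (v - u) - l (v - u) in neg key.
set c := b (v - u) (v - u) in key.
have c0 : 0 <= c.
  have [c0|c0] := eqVneq (v - u) 0; last exact/ltW/b_pos.
  by rewrite /c c0; have := bl 0 0 0 (-1); rewrite scaler0 addr0 mulN1r addNr => ->.
have ce : 0 < c - e by lra.
(* For this [t] one has [t * c <= - e], so [2 * e + t * c <= e < 0], against [key]. *)
have te : 0 < - e / (c - e) <= 1.
  by rewrite divr_gt0 ?oppr_gt0//= ler_pdivrMr// mul1r; lra.
have := key _ te.
have h : - e / (c - e) * c <= - e.
  by rewrite mulrAC ler_pdivrMr//; nra.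
lra.
Qed.

Section vectType.
Import VectorInternalTheory.
Context (X : vectType R).

(** Closedness is stated for the coordinate preimage, since the minimisation takes place among row
    vectors and its solution is carried back by [r2v]. *)
Lemma variational_inequality (b : X -> X -> R) (l : X -> R)
  (K : set X)
  (b_sym : forall u v, b u v = b v u)
  (b_lin : forall (c : R) u v w, b (c *: u + v) w = c * b u w + b v w)
  (b_pos : forall u, u != 0 -> 0 < b u u)
  (l_lin : forall (c : R) u v, l (c *: u + v) = c * l u + l v) :
  closed (r2v @^-1` K) -> K !=set0 ->
  (forall t u v, 0 <= t <= 1 -> K u -> K v -> K (t *: (v - u) + u)) ->
  exists! u, K u /\ forall v, K v -> b u (u - v) <= l (u - v).
Proof.
move=> Kcl [w Kw] Kconv.
have [|||||||u Ku hu] := @variational_inequality_rV _ (fun u v => b (r2v u) (r2v v))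
    (fun u => l (r2v u)) (r2v @^-1` K).
- by move=> u v.
- by move=> c u v z; rewrite linearP b_lin.
- move=> u u0; apply: b_pos; apply: contra u0 => /eqP u0; apply/eqP.
  by rewrite -[u]r2vK u0 linear0.
- by move=> c u v; rewrite linearP l_lin.
- exact: Kcl.
- by exists (v2r w); rewrite /= v2rK.
- by move=> t u v t01 Ku Kv; rewrite /= linearP linearB; exact: Kconv.
exists (r2v u); split.
  split => // v Kv; have := hu (v2r v); rewrite /= linearB /= v2rK; exact.
move=> u' [Ku' hu'].
(* Each solution is tested with the other; adding the two inequalities gives [b z z <= 0] for their
   difference [z]. *)
have h1 := hu' _ Ku; have h2 := hu (v2r u'); move: h2; rewrite /= linearB/= v2rK => /(_ Ku') h2.
apply/eqP; rewrite -subr_eq0; apply/negPn/negP => ne.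
have := b_pos _ ne.
have bN x y : b (- x) y = - b x y.
  have b0 : b 0 y = 0.
    by have := b_lin (-1) 0 0 y; rewrite scaler0 addr0 mulN1r addNr.
  by have := b_lin (-1) x 0 y; rewrite addr0 scaleN1r b0 addr0 mulN1r.
have lN x : l (- x) = - l x.
  have l0 : l 0 = 0.
    by have := l_lin (-1) 0 0; rewrite scaler0 addr0 mulN1r addNr.
  by have := l_lin (-1) x 0; rewrite addr0 scaleN1r l0 addr0 mulN1r.
move: h1; rewrite -(opprB (r2v u) u') lN b_sym bN => h1.
have := b_lin (-1) u' (r2v u) (r2v u - u').
rewrite scaleN1r addrC => ->; rewrite (b_sym u'); lra.
Qed.

(** Applied to the Gram form of the discrete gradients, this lets the discrete norm control
    coordinates. *)
Lemma posdef_coord_bound (b : X -> X -> R)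
  (b_sym : forall u v, b u v = b v u)
  (b_lin : forall (c : R) u v w, b (c *: u + v) w = c * b u w + b v w)
  (b_pos : forall u, u != 0 -> 0 < b u u) :
  exists2 C, 0 <= C & forall u i, `|v2r u 0 i| <= C * Num.sqrt (b u u).
Proof.
have [|||al al0 h] := @posdef_coercive _ (fun u v => b (r2v u) (r2v v)).
- by move=> u v.
- by move=> c u v z; rewrite linearP b_lin.
- move=> u u0; apply: b_pos; apply: contra u0 => /eqP u0; apply/eqP.
  by rewrite -[u]r2vK u0 linear0.
exists (Num.sqrt al^-1); first exact: sqrtr_ge0.
move=> u i; apply: le_trans (coord_le_norm _ _) _.
rewrite -sqrtrM ?invr_ge0 ?(ltW al0)// -[leLHS]normr_id -sqrtr_sqr//.
rewrite ler_wsqrtr// ler_pdivlMl//.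
by have := h (v2r u); rewrite v2rK.
Qed.

Lemma vect_expand (u : X) : u = \sum_i v2r u 0 i *: r2v (delta_mx 0 i).
Proof.
rewrite -[LHS]v2rK {1}[v2r u]row_sum_delta linear_sum.
by apply: eq_bigr => i _; rewrite linearZ.
Qed.

End vectType.

End finite_dimensional.

(** * Spectral bounds for symmetric matrices *)

Section symmetric_matrix.
Context (R : realType) (d : nat).
Implicit Types (M : 'M[R]_d) (u v : 'rV[R]_d).

Lemma mulmxv_lin M c u v : mulmxv M (c *: u + v) = c *: mulmxv M u + mulmxv M v.
Proof. by rewrite /mulmxv mulmxDl scalemxAl. Qed.

Lemma mulmxv_sym M u v : M^T = M -> dotv (mulmxv M u) v = dotv u (mulmxv M v).
Proof.
move=> Ms; have E (x y : 'rV[R]_d) : dotv x y = (x *m y^T) 0 0.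
  by rewrite !mxE; apply: eq_bigr => i _; rewrite mxE.
by rewrite !E /mulmxv trmx_mul trmxK Ms mulmxA.
Qed.

(** Let [m] be the minimum of the Rayleigh quotient, reached at a unit vector [w]. The form of [M]
    minus [m] times the dot product is semi-definite and vanishes at [w], so by Cauchy-Schwarz it
    vanishes on [w] paired with any vector; pairing with [mulmxv M w - m *: w] shows that [w] is an
    eigenvector. *)
Lemma symmetric_min_eigenvalue M u : M^T = M -> u != 0 ->
  exists2 m, eigenvalue M m & forall v, m * dotv v v <= dotv (mulmxv M v) v.
Proof.
move=> Ms u0.
pose S := [set v : 'rV[R]_d | dotv v v = 1].
have dotc : continuous (fun v : 'rV[R]_d => dotv v v).
  by apply: quadratic_form_continuous => *; [exact: dotvC|exact: dotv_linl].
have nrm v : v != 0 -> dotv ((enorm v)^-1 *: v) ((enorm v)^-1 *: v) = 1.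
  move=> v0; rewrite dotvZl dotvZr mulrA -expr2 exprVn enorm_sqr mulVf//.
  by rewrite dotv_eq0.
have S0 : S !=set0 by exists ((enorm u)^-1 *: u); exact: nrm.
have cS : compact S.
  apply: bounded_closed_compact.
    exists 1; split => // x x1 v Sv.
    rewrite /= [leLHS]/Num.Def.normr /= mx_normrE; apply: bigmax_le => [|[i j] _]/=.
      by apply: ltW; apply: lt_trans x1.
    rewrite ord1; apply: le_trans (coord_le_enorm _ _) _.
    by rewrite /enorm Sv sqrtr1 ltW.
  rewrite (_ : S = (fun v : 'rV[R]_d => dotv v v) @^-1` [set 1])//.
  exact: preimage_closed.
have qc : continuous (fun v : 'rV[R]_d => dotv (mulmxv M v) v).
  apply: (quadratic_form_continuous (b := fun u v => dotv (mulmxv M u) v)).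
    by move=> v w; rewrite mulmxv_sym// dotvC.
  by move=> c v w z; rewrite mulmxv_lin dotv_linl.
have [w /set_mem Sw wmin] := EVT_min_rV S0 cS (continuous_subspaceT qc).
set m := dotv (mulmxv M w) w in wmin.
have mle v : m * dotv v v <= dotv (mulmxv M v) v.
  have [->|v0] := eqVneq v 0.
    by rewrite /mulmxv mul0mx (_ : dotv 0 0 = 0) ?mulr0//; apply/eqP; rewrite dotv_eq0.
  have := wmin ((enorm v)^-1 *: v); rewrite inE => /(_ (nrm _ v0)).
  have mZ c x : mulmxv M (c *: x) = c *: mulmxv M x by rewrite /mulmxv scalemxAl.
  rewrite mZ dotvZl dotvZr mulrA -expr2 exprVn enorm_sqr.
  by rewrite ler_pdivlMl ?lt_neqAle ?dotv_ge0 1?eq_sym ?dotv_eq0 ?v0// mulrC.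
exists m => //.
pose b x y := dotv (mulmxv M x) y - m * dotv x y.
have b0 y : b w y ^+ 2 <= b w w * b y y.
  apply: (@sip_cauchy_schwarz_sqr R 'rV[R]_d (fun=> True)) => //.
  - by move=> x z _ _; rewrite /b mulmxv_sym// dotvC (dotvC x).
  - move=> c x z t _ _ _; rewrite /b mulmxv_lin !dotv_linl; ring.
  - by move=> x _; rewrite /b subr_ge0.
have bw : b w w = 0 by rewrite /b Sw mulr1 subrr.
have : mulmxv M w - m *: w = 0.
  apply/eqP; rewrite -dotv_eq0.
  have := b0 (mulmxv M w - m *: w); rewrite bw mul0r.
  rewrite {1}/b -dotvZl -dotvBl => h.
  by rewrite -sqrf_eq0 eq_le h sqr_ge0.
move/eqP; rewrite subr_eq0 => /eqP E.
apply/eigenvalueP; exists w; first by rewrite -E /mulmxv Ms.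
apply/negP => /eqP w0; move: Sw; rewrite /S/= w0.
rewrite (_ : dotv 0 0 = 0); last by apply/eqP; rewrite dotv_eq0.
by move=> /eqP; rewrite eq_sym oner_eq0.
Qed.

(** The upper bound is the lower one for [- M], whose least eigenvalue is the opposite of an
    eigenvalue of [M]. *)
Lemma symmetric_quadratic_bounds M lo hi : M^T = M ->
  (forall mu, eigenvalue M mu -> lo <= mu <= hi) ->
  forall v, lo * dotv v v <= dotv (mulmxv M v) v <= hi * dotv v v.
Proof.
move=> Ms ev v; have [->|v0] := eqVneq v 0.
  by rewrite /mulmxv mul0mx (_ : dotv 0 0 = 0) ?mulr0 ?lexx//; apply/eqP; rewrite dotv_eq0.
have [m /ev/andP[lom _] mv] := symmetric_min_eigenvalue Ms v0.
apply/andP; split.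
  by apply: le_trans (mv v); rewrite ler_wpM2r// dotv_ge0.
have NMs : (- M)^T = - M by rewrite linearN/= Ms.
have [m' /eigenvalueP[w wE w0] m'v] := symmetric_min_eigenvalue NMs v0.
have /ev/andP[_ mhi] : eigenvalue M (- m').
  by apply/eigenvalueP; exists w => //; rewrite scaleNr -wE mulmxN opprK.
have := m'v v; rewrite /mulmxv linearN/= mulmxN -scaleN1r dotvZl => h.
have : (- m') * dotv v v <= hi * dotv v v by rewrite ler_wpM2r// dotv_ge0.
rewrite /mulmxv; lra.
Qed.

(** Write [N] for the squared norm of [M v]. Cauchy-Schwarz for the form [<M x, y>] at [v] and [M v]
    bounds [N ^+ 2] by [<M v, v>] times [<M (M v), M v>], hence by [hi * dotv v v] times
    [hi * N]. *)
Lemma symmetric_norm_bound M lo hi : M^T = M -> 0 <= lo ->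
  (forall mu, eigenvalue M mu -> lo <= mu <= hi) ->
  forall v, dotv (mulmxv M v) (mulmxv M v) <= hi ^+ 2 * dotv v v.
Proof.
move=> Ms lo0 ev v; have bnd := symmetric_quadratic_bounds Ms ev.
have cs : dotv (mulmxv M v) (mulmxv M v) ^+ 2 <=
    dotv (mulmxv M v) v * dotv (mulmxv M (mulmxv M v)) (mulmxv M v).
  apply: (@sip_cauchy_schwarz_sqr R 'rV[R]_d (fun=> True)
     (fun x y => dotv (mulmxv M x) y)) => //.
  - by move=> x z _ _; rewrite mulmxv_sym// dotvC.
  - by move=> c x z t _ _ _; rewrite mulmxv_lin !dotv_linl.
  - move=> x _; have /andP[+ _] := bnd x; apply: le_trans.
    by rewrite mulr_ge0// dotv_ge0.
set N := dotv (mulmxv M v) (mulmxv M v) in cs *.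
have N0 : 0 <= N by exact: dotv_ge0.
have [->|N1] := eqVneq N 0; first by rewrite mulr_ge0 ?sqr_ge0 ?dotv_ge0.
have Np : 0 < N by rewrite lt_neqAle eq_sym N1.
have /andP[l1 h1] := bnd v; have /andP[l2 h2] := bnd (mulmxv M v).
have : N ^+ 2 <= (hi * dotv v v) * (hi * N).
  apply: le_trans cs _; apply: ler_pM => //.
  - by apply: le_trans l1; rewrite mulr_ge0// dotv_ge0.
  - by apply: le_trans l2; rewrite mulr_ge0// dotv_ge0.
rewrite expr2 (mulrA _ hi N) ler_pM2r//; move/le_trans; apply.
by rewrite le_eqVlt; apply/orP; left; apply/eqP; ring.
Qed.

End symmetric_matrix.

(** * Measurability of open sets and continuous functions *)

Section cover_outer_split.
Context (R : realType) (T : pointedType) (w : set T -> \bar R).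
Hypothesis w0 : (w set0 = 0)%E.
Hypothesis w_ge0 : forall A, (0 <= w A)%E.

Lemma cover_outer_le A B : A `<=` B -> (cover_outer w A <= w B)%E.
Proof.
move=> AB; pose C n := if n is 0%N then B else set0.
have AC : A `<=` \bigcup_n C n by move=> x /AB Bx; exists 0%N.
apply: (@le_trans _ _ (\sum_(k <oo) w (C k))%E).
  by apply: ereal_inf_lbound; exists C.
rewrite nneseries_recl//= eseries0 ?adde0// => i i1 _.
by case: i i1.
Qed.

(** It is enough to split the covering sets one by one: in any cover of the union, the parts inside
    [A] and inside [B] cover [A] and [B], and the hypothesis sums over the cover. *)
Lemma cover_outer_superadditive A B :
  (forall C, (cover_outer w (C `&` A) + cover_outer w (C `&` B) <= w C)%E) ->
  (cover_outer w A + cover_outer w B <= cover_outer w (A `|` B))%E.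
Proof.
move=> H; apply: le_ereal_inf_tmp => _ [C /= ABC <-].
have sub D : D `<=` A `|` B ->
    (cover_outer w D <= \sum_(k <oo) cover_outer w (C k `&` D))%E.
  move=> DAB; apply: le_trans (cover_outer_sigma_subadditive w_ge0 _).
  by apply: le_cover_outer => x Dx; have [k _ Ckx] := ABC _ (DAB _ Dx); exists k.
apply: (@le_trans _ _ (\sum_(k <oo) (cover_outer w (C k `&` A)
    + cover_outer w (C k `&` B)))%E).
  rewrite nneseriesD; try by move=> *; exact: cover_outer_ge0.
  by apply: leeD; apply: sub => x; [left|right].
by apply: lee_nneseries => // i _ _; rewrite adde_ge0// cover_outer_ge0.
Qed.

End cover_outer_split.

Lemma cover_outer_mono (R : realType) (T : pointedType) (w w' : set T -> \bar R) A :
  (forall B, (0 <= w B)%E) -> (forall B, (w B <= w' B)%E) ->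
  (cover_outer w A <= cover_outer w' A)%E.
Proof.
move=> w0 ww'; apply: le_ereal_inf_tmp => _ [C /= AC <-].
apply: (@le_trans _ _ (\sum_(k <oo) w (C k))%E).
  by apply: ereal_inf_lbound; exists C.
exact: lee_nneseries.
Qed.

Section lebesgue_halfspace.
Context (R : realType) (d : nat).
Local Notation E := 'rV[R]_d.

Lemma box_cost_le (a b : E) : (forall i, a 0 i <= b 0 i) ->
  (box_cost (box a b) <= (\prod_(i < d) (b 0 i - a 0 i))%:E)%E.
Proof.
move=> ab; rewrite /box_cost; case: asboolP => [_|_].
  by rewrite lee_fin prodr_ge0// => i _; rewrite subr_ge0.
by apply: ereal_inf_lbound; exists (a, b).
Qed.

(** A hyperplane orthogonal to an axis cuts a box into two boxes with a common face, and their
    volumes add up. *)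
Lemma box_cost_halfspace (i : 'I_d) (c : R) (B : set E) :
  (cover_outer (@box_cost R d) (B `&` [set x : E | (x 0 i < c)%R])
   + cover_outer (@box_cost R d) (B `&` [set x : E | (c <= x 0 i)%R])
   <= box_cost B)%E.
Proof.
have bc0 := @box_cost0 R d; have bcp := @box_cost_ge0 R d.
rewrite {3}/box_cost; case: asboolP => [->|_].
  by rewrite !set0I cover_outer0// adde0.
apply: le_ereal_inf_tmp => _ [[a b] /= [ab ->] <-].
(* The level [c] is clamped to the side of the box, so that a half-space missing the box leaves a
   degenerate box of volume [0]. *)
pose m := Num.max (a 0 i) (Num.min (b 0 i) c).
have am : a 0 i <= m by rewrite /m le_max lexx.
have mb : m <= b 0 i by rewrite /m ge_max ab ge_min lexx.
pose b' : E := \row_j if j == i then m else b 0 j.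
pose a' : E := \row_j if j == i then m else a 0 j.
have h1 : (cover_outer (@box_cost R d) (box a b `&` [set x : E | (x 0 i < c)%R])
    <= (\prod_(j < d) (b' 0 j - a 0 j))%:E)%E.
  apply: le_trans (box_cost_le _); last by move=> j; rewrite mxE; case: eqP => [->|].
  apply: cover_outer_le => // x [/= bx xc] j; have /andP[-> xb] := bx j.
  rewrite mxE; case: eqP => [ji|//]; rewrite ji in xb *.
  by rewrite /m le_max le_min xb (ltW xc) orbT.
have h2 : (cover_outer (@box_cost R d) (box a b `&` [set x : E | (c <= x 0 i)%R])
    <= (\prod_(j < d) (b 0 j - a' 0 j))%:E)%E.
  apply: le_trans (box_cost_le _); last by move=> j; rewrite mxE; case: eqP => [->|].
  apply: cover_outer_le => // x [/= bx xc] j; have /andP[xa ->] := bx j.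
  rewrite mxE andbT; case: eqP => [ji|//]; rewrite ji in xa *.
  by rewrite /m ge_max xa ge_min xc orbT.
apply: le_trans (leeD h1 h2) _; rewrite -EFinD lee_fin.
rewrite (bigD1 i)//= [in X in _ + X](bigD1 i)//= [leRHS](bigD1 i)//=.
rewrite !mxE eqxx.
rewrite (eq_bigr (fun j => b 0 j - a 0 j)); last first.
  by move=> j ji; rewrite mxE (negbTE ji).
rewrite [in X in _ + X](eq_bigr (fun j => b 0 j - a 0 j)); last first.
  by move=> j ji; rewrite mxE (negbTE ji).
by rewrite -mulrDl le_eqVlt; apply/orP; left; apply/eqP; congr (_ * _); ring.
Qed.

End lebesgue_halfspace.

Section outer_measure_topology.
Context (R : realType) (d : nat).
Local Notation E := 'rV[R]_d.
Implicit Types mu : {outer_measure set E -> \bar R}.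

Definition obox (a b : E) : set E := [set x | forall i, a 0 i < x 0 i < b 0 i].

Lemma obox_sub_box a b : obox a b `<=` box a b.
Proof. by move=> x abx i; have /andP[/ltW-> /ltW->] := abx i. Qed.

Lemma dx_outer_halfspace (Omega : set E) i c :
  (dx_outer Omega).-caratheodory [set x : E | (x 0 i < c)%R].
Proof.
apply: le_caratheodory_measurable => X.
rewrite (_ : ~` _ = [set x : E | (c <= x 0 i)%R]); last first.
  by apply/seteqP; split=> x /=; rewrite leNgt => /negP.
rewrite /= /dx_outer.
have H := @cover_outer_superadditive R E (@box_cost R d) (@box_cost_ge0 R d)
  (X `&` [set x : E | (x 0 i < c)%R] `&` Omega) (X `&` [set x : E | (c <= x 0 i)%R] `&` Omega).
apply: le_trans (H _) _.
  move=> C; apply: le_trans (box_cost_halfspace i c C).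
  apply: leeD; apply: le_cover_outer => x /= [Cx [[_ xc] _]] //.
by apply: le_cover_outer => x /= [[[Xx _] Ox]|[[Xx _] Ox]].
Qed.

(* Caratheodory's criterion: additivity on separated sets makes half-spaces
   measurable. The slices [R_ k] of consecutive parity are separated, so both
   parity classes have finite total measure and their tails vanish. *)
Lemma metric_outer_halfspace mu i c :
  (forall (A B : set E) (r : R), 0 < r ->
    (forall x y, A x -> B y -> r <= enorm (x - y)) ->
    (mu A + mu B <= mu (A `|` B))%E) ->
  mu.-caratheodory [set x : E | (x 0 i < c)%R].
Proof.
move=> sep; apply: le_caratheodory_measurable => Y.
set H := [set x : E | _].
have [->|Yoo] := eqVneq (mu Y) +oo%E; first by rewrite leey.
have Yfin : mu Y \is a fin_num.
  by rewrite fin_numE Yoo andbT gt_eqF// (lt_le_trans _ (outer_measure_ge0 _ _)).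
pose t n : R := c - n.+1%:R^-1.
have tS n m : (n < m)%N -> t n < t m.
  by move=> nm; rewrite ltrD2l ltrN2 ltf_pV2 ?posrE// ltr_nat ltnS.
have tW n m : (n <= m)%N -> t n <= t m.
  by rewrite leq_eqVlt => /predU1P[->//|/tS/ltW].
pose Yn n := Y `&` [set x : E | x 0 i <= t n].
pose Rk k := Y `&` [set x : E | t k < x 0 i <= t k.+1].
have sepi (A B : set E) (a b : R) : a < b -> A `<=` [set x : E | x 0 i <= a] ->
    B `<=` [set x : E | b <= x 0 i] -> (mu A + mu B <= mu (A `|` B))%E.
  move=> ab Aa Bb; apply: (sep _ _ (b - a)); first by rewrite subr_gt0.
  move=> x y /Aa/= xa /Bb/= yb; apply: le_trans (coord_le_enorm _ i).
  rewrite !mxE distrC; apply: le_trans (ler_norm _); lra.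
pose L (r : R) : set E := [set x : E | x 0 i <= r].
(* [e] will be the parity, [0] or [1]. Two slices of equal parity have a whole slice between them,
   so their measures add up and stay below [mu Y]. *)
have step e m : (\sum_(0 <= k < m.+1) mu (Rk (k.*2 + e)%N) <=
    mu (Y `&` L (t (m.*2 + e).+1)))%E.
  elim: m => [|m IH].
    by rewrite big_nat1; apply: le_outer_measure => x [Yx /= /andP[_ xt]].
  rewrite big_nat_recr//=.
  apply: le_trans (leeD IH (lexx _)) _.
  apply: le_trans (sepi _ _ (t (m.*2 + e).+1) (t (m.+1.*2 + e)%N) _ _ _) _.
  - by apply: tS; rewrite doubleS !addSn.
  - by move=> x [].
  - by move=> x [_ /= /andP[/ltW]].
  - apply: le_outer_measure => x [[Yx /= xt]|[Yx /= /andP[_ xt]]]; split => //=.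
    by apply: le_trans xt _; apply: tW; rewrite doubleS !addSn ltnW.
have sumR e m : (\sum_(0 <= k < m) mu (Rk (k.*2 + e)%N) <= mu Y)%E.
  case: m => [|m]; first by rewrite big_geq// outer_measure_ge0.
  by apply: le_trans (step e m) _; apply: le_outer_measure => x [].
have serR e : (\sum_(0 <= k <oo) mu (Rk (k.*2 + e)%N) < +oo)%E.
  apply: (@le_lt_trans _ _ (mu Y)); last by rewrite ltey.
  apply: lime_le; first by apply: is_cvg_nneseries => *; exact: outer_measure_ge0.
  exact: nearW.
pose tl e n := (\sum_(n <= k <oo) mu (Rk (k.*2 + e)%N))%E.
have tl0 e : tl e n @[n --> \oo] --> 0%E.
  by apply: nneseries_tail_cvg => // k _; exact: outer_measure_ge0.
(* A point of [H] above level [t n.*2] lies in the slice that ends at the first level reaching it,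
   hence in one of the two parity tails. *)
have cover n : (mu (Y `&` H) <= mu (Yn n.*2) + (tl 0%N n + tl 1%N n))%E.
  have ser e : (mu (\bigcup_k Rk ((k + n).*2 + e)%N) <= tl e n)%E.
    apply: le_trans (outer_measure_sigma_subadditive _ _) _.
    by rewrite (@nneseries_addn R (fun k => mu (Rk (k.*2 + e)%N)) n)// => k;
      exact: outer_measure_ge0.
  apply: le_trans (leeD (lexx _) (leeD (ser 0%N) (ser 1%N))).
  apply: le_trans (leeD (lexx _) (outer_measureU2 _ _ _)).
  apply: le_trans (outer_measureU2 _ _ _).
  apply: le_outer_measure => x [Yx /= xc].
  have [xt|xt] := leP (x 0 i) (t n.*2); first by left; split.
  right.
  have exm : exists m, x 0 i <= t m.
    have cx : 0 < c - x 0 i by rewrite subr_gt0.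
    have [m mP] : exists m, m.+1%:R^-1 < c - x 0 i.
      have [m _ /(_ _ (leqnn m)) hm] := near_infty_natSinv_lt (PosNum cx).
      by exists m.
    by exists m; rewrite /t lerBrDr -lerBrDl ltW.
  case: (ex_minnP exm) => m xm mmin.
  have nm : (n.*2 < m)%N.
    by rewrite ltnNge; apply/negP => /tW /(le_trans xm); rewrite leNgt xt.
  have m0 : (0 < m)%N by exact: leq_ltn_trans nm.
  have xR : Rk m.-1 x.
    split => //=; rewrite prednK// xm andbT ltNge; apply/negP => /mmin.
    by rewrite leqNgt prednK// leqnn.
  have nm1 : (n.*2 <= m.-1)%N by rewrite -ltnS prednK.
  have dbl := odd_double_half m.-1.
  have nh : (n <= m.-1./2)%N by rewrite -(doubleK n) half_leq.
  case: (boolP (odd m.-1)) => om; rewrite ?om ?(negbTE om) in dbl.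
    right; exists (m.-1./2 - n)%N => //.
    by rewrite subnK// addnC dbl.
  left; exists (m.-1./2 - n)%N => //.
  by rewrite subnK// addn0 -[X in Rk X](add0n) dbl.
have main n : (mu (Y `&` H) + mu (Y `&` ~` H) <= mu Y + (tl 0%N n + tl 1%N n))%E.
  apply: le_trans (leeD (cover n) (lexx _)) _.
  rewrite addeAC; apply: leeD => //.
  apply: le_trans (sepi _ _ (t n.*2) c _ _ _) _.
  - by rewrite /t ltrBlDr ltrDl invr_gt0.
  - by move=> x [].
  - by move=> x [_ /negP]; rewrite -leNgt.
  - by apply: le_outer_measure => x [[]|[]].
have lim0 : (mu Y + (tl 0%N n + tl 1%N n))%E @[n --> \oo] --> mu Y.
  rewrite -[X in _ --> X]adde0 -[X in _ --> (_ + X)%E](adde0 0%E).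
  apply: cvgeD; [by rewrite fin_num_adde_defr// adde0|exact: cvg_cst|].
  exact: cvgeD.
rewrite -[leRHS](cvg_lim _ lim0)//; apply: lime_ge; first by apply/cvg_ex; exists (mu Y).
exact: nearW.
Qed.

Lemma obox_measurable mu :
  (forall i c, mu.-caratheodory [set x : E | (x 0 i < c)%R]) ->
  forall a b, mu.-cara.-measurable (obox a b).
Proof.
move=> hs a b.
have hs2 i c : mu.-cara.-measurable [set x : E | (c < x 0 i)%R].
  rewrite (_ : [set x : E | _] =
    \bigcup_n ~` [set x : E | (x 0 i < c + n.+1%:R^-1)%R]).
    by apply: bigcupT_measurable => n; apply: measurableC; exact: hs.
  apply/seteqP; split=> x /=.
    move=> cx; have cx0 : 0 < x 0 i - c by rewrite subr_gt0.
    have [m _ /(_ _ (leqnn m)) hm] := near_infty_natSinv_lt (PosNum cx0).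
    exists m => //=; apply/negP; rewrite -leNgt -lerBrDl; exact: ltW.
  move=> [n _ /= /negP]; rewrite -leNgt; apply: lt_le_trans.
  by rewrite ltrDl invr_gt0.
rewrite (_ : obox a b = \bigcap_(i in [set: 'I_d])
    ([set x : E | (a 0 i < x 0 i)%R] `&` [set x : E | (x 0 i < b 0 i)%R])).
  apply: fin_bigcap_measurable => [|i _]; first exact: finite_finset.
  by apply: measurableI; [exact: hs2|exact: hs].
apply/seteqP; split=> x /=.
  by move=> abx i _; have /andP[] := abx i.
by move=> h i; have [-> ->] := h i I.
Qed.

(** Boxes with rational corners are enumerated. The closed ones lie in [V], so bumps on them have
    compact support there, while the open ones already exhaust [V]. *)
Lemma open_bigcup_box (V : set E) : (0 < d)%N -> open V ->
  exists a b : nat -> E, (forall n, box (a n) (b n) `<=` V) /\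
    V = \bigcup_n obox (a n) (b n).
Proof.
move=> d0 Vo.
pose q (p : 'rV[rat]_d) : E := map_mx ratr p.
pose ok (p : 'rV[rat]_d * 'rV[rat]_d) := `[< box (q p.1) (q p.2) `<=` V >].
(* Codes that name no box inside [V] receive the box from [1] to [0], which is empty because [d] is
   positive. *)
pose A n : E * E := if (unpickle n : option ('rV[rat]_d * 'rV[rat]_d)) is Some p then
   if ok p then (q p.1, q p.2) else (const_mx 1, const_mx 0)
   else (const_mx 1, const_mx 0).
have empty (x : E) : ~ box (const_mx 1 : E) (const_mx 0 : E) x.
  move=> /(_ (Ordinal d0)); rewrite !mxE => /andP[/le_trans h /h].
  by rewrite ler10.
exists (fun n => (A n).1), (fun n => (A n).2).
have sub n : box (A n).1 (A n).2 `<=` V.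
  rewrite /A; case: unpickle => [p|]; last by move=> x /empty.
  by case: ifPn => [/asboolP//|_]; move=> x /empty.
split => //; apply/seteqP; split=> x; last first.
  by move=> [n _ /obox_sub_box/sub].
move=> Vx.
have /nbhs_ballP[e /= e0 he] : nbhs x V by exact: open_nbhs_nbhs.
have loP i : exists p : rat, x 0 i - e < ratr p < x 0 i.
  have /rat_in_itvoo[p] : x 0 i - e < x 0 i by rewrite ltrBlDr ltrDl.
  by rewrite in_itv/= => ?; exists p.
have hiP i : exists p : rat, x 0 i < ratr p < x 0 i + e.
  have /rat_in_itvoo[p] : x 0 i < x 0 i + e by rewrite ltrDl.
  by rewrite in_itv/= => ?; exists p.
have [lo lop] := choice loP; have [hi hip] := choice hiP.
pose p := (\row_i lo i, \row_i hi i).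
have okp : ok p.
  apply/asboolP => y by_; apply: he; split => // i j; rewrite ord1.
  have /andP[] := by_ j; rewrite !mxE => yl yh.
  have /andP[l1 l2] := lop j; have /andP[h1 h2] := hip j.
  rewrite /ball/= ltr_distlC; apply/andP; split; lra.
exists (pickle p) => //; rewrite /A pickleK okp => i /=; rewrite !mxE.
by have /andP[_ ->] := lop i; have /andP[-> _] := hip i.
Qed.

Lemma open_cara_measurable mu (V : set E) : (0 < d)%N ->
  (forall i c, mu.-caratheodory [set x : E | (x 0 i < c)%R]) ->
  open V -> mu.-cara.-measurable V.
Proof.
move=> d0 hs /(open_bigcup_box d0)[a [b [_ ->]]].
by apply: bigcupT_measurable => n; exact: obox_measurable.
Qed.

Lemma continuous_cara_measurable mu (f : E -> R) : (0 < d)%N ->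
  (forall i c, mu.-caratheodory [set x : E | (x 0 i < c)%R]) ->
  continuous f -> measurable_fun setT (f : caratheodory_type mu -> R).
Proof.
move=> d0 hs /continuousP cf; apply: (measurability _ (RGenOpens.measurableE R)).
move=> _ [_ [a [b ->] <-]]; rewrite setTI; apply: open_cara_measurable => //.
exact/cf/interval_open.
Qed.

End outer_measure_topology.

(** * Additivity of Hausdorff measures on separated sets *)

Section hausdorff_separation.
Context (R : realType) (d s : nat).
Local Notation E := 'rV[R]_d.

Lemma le_hausdorff_cost (e e' : R) (B : set E) : e <= e' ->
  (hausdorff_cost s e' B <= hausdorff_cost s e B)%E.
Proof.
move=> ee'; rewrite /hausdorff_cost; case: asboolP => // _.
case: ifPn => h1; case: ifPn => h2 //; rewrite ?leey//.
by rewrite (le_trans h2) ?lee_fin in h1.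
Qed.

(** A covering set of diameter at most [e < r] cannot meet both [A] and [B], which gives
    superadditivity at every small scale [e]. Finer scales increase the covering values, so the
    inequality passes to the supremum. *)
Lemma hausdorff_outer_separated (A B : set E) (r : R) : 0 < r ->
  (forall x y, A x -> B y -> r <= enorm (x - y)) ->
  (hausdorff_outer s A + hausdorff_outer s B <= hausdorff_outer s (A `|` B))%E.
Proof.
move=> r0 sep.
pose co e (X : set E) := cover_outer (hausdorff_cost s e) X.
have co_ge0 e X : (0 <= co e X)%E.
  by apply: cover_outer_ge0 => C; exact: hausdorff_cost_ge0.
have coS e e' X : e <= e' -> (co e' X <= co e X)%E.
  move=> ee'; apply: cover_outer_mono => C; first exact: hausdorff_cost_ge0.
  exact: le_hausdorff_cost.
have add e : 0 < e -> e < r -> (co e A + co e B <= co e (A `|` B))%E.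
  move=> e0 er; apply: cover_outer_superadditive; first exact: hausdorff_cost_ge0.
  move=> C.
  have c0 := @hausdorff_cost0 R d s e; have cp := @hausdorff_cost_ge0 R d s e.
  have sub (X : set E) : (co e (C `&` X) <= hausdorff_cost s e C)%E.
    by apply: cover_outer_le => // x [].
  have [[x [Cx Ax]]|CA] := pselect (C `&` A !=set0); last first.
    have -> : C `&` A = set0 by apply/eqP/negPn/negP => /set0P.
    by rewrite [X in (X + _)%E]cover_outer0// add0e; exact: sub.
  have [[y [Cy By]]|CB] := pselect (C `&` B !=set0); last first.
    have -> : C `&` B = set0 by apply/eqP/negPn/negP => /set0P.
    by rewrite [X in (_ + X)%E]cover_outer0// adde0; exact: sub.
  rewrite [leRHS]/hausdorff_cost; case: asboolP => [C0|_].
    by exfalso; rewrite C0 in Cx.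
  case: ifPn => [dC|_]; last by rewrite leey.
  exfalso; have : (r%:E <= e%:E)%E.
    apply: le_trans dC; apply: (@le_trans _ _ (enorm (x - y))%:E).
      by rewrite lee_fin; exact: sep.
    by apply: ereal_sup_ubound; exists (x, y).
  by rewrite lee_fin leNgt er.
set M := hausdorff_outer s (A `|` B).
have [->|Moo] := eqVneq M +oo%E; first by rewrite leey.
have Mfin : M \is a fin_num.
  by rewrite fin_numE Moo andbT gt_eqF// (lt_le_trans _ (hausdorff_outer_ge0 _ _)).
(* Independent scales for [A] and [B], both refined to a common one below [r], allow the two suprema
   to be taken one after the other. *)
have add2 e1 e2 : 0 < e1 -> 0 < e2 -> (co e1 A + co e2 B <= M)%E.
  move=> e10 e20; pose e := Num.min (Num.min e1 e2) (r / 2).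
  have e0 : 0 < e by rewrite !lt_min e10 e20 divr_gt0.
  apply: (@le_trans _ _ (co e A + co e B)%E).
    by apply: leeD; apply: coS; rewrite !ge_min lexx ?orbT.
  apply: le_trans (add _ e0 _) _.
    by rewrite gt_min; apply/orP; right; rewrite ltr_pdivrMr// mulr_natr mulr2n ltrDl.
  exact: cover_le_hausdorff_outer.
have coBfin e : 0 < e -> co e B \is a fin_num.
  move=> e0; rewrite ge0_fin_numE//; apply: le_lt_trans (_ : (_ <= M)%E) _.
    by apply: le_trans (add2 _ _ e0 e0); rewrite leeDr.
  by rewrite -ge0_fin_numE// (le_trans _ (add2 _ _ e0 e0))// adde_ge0.
have HA e : 0 < e -> (hausdorff_outer s A <= M - co e B)%E.
  move=> e0; apply: ge_ereal_sup => _ [e1 /= e10 <-].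
  by rewrite leeBrDr ?coBfin//; exact: add2.
have HAfin : hausdorff_outer s A \is a fin_num.
  rewrite ge0_fin_numE ?hausdorff_outer_ge0//.
  apply: le_lt_trans (HA _ ltr01) _.
  by rewrite -ge0_fin_numE ?fin_numB ?Mfin ?coBfin//
    (le_trans _ (HA _ ltr01))// hausdorff_outer_ge0.
rewrite addeC -leeBrDr//; apply: ge_ereal_sup => _ [e /= e0 <-].
by rewrite leeBrDr// addeC -leeBrDr ?coBfin// HA.
Qed.

End hausdorff_separation.

Lemma dS_outer_halfspace (R : realType) (d : nat) (Omega : set 'rV[R]_d) i c :
  (dS_outer Omega).-caratheodory [set x : 'rV[R]_d | (x 0 i < c)%R].
Proof.
apply: (@metric_outer_halfspace R d (dS_outer Omega)) => A B r r0 sep.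
rewrite /= /dS_outer setIUl; apply: hausdorff_outer_separated r0 _.
by move=> x y [Ax _] [By _]; exact: sep.
Qed.

Section boundary_measurability.
Context (R : realType) (d : nat) (Omega : set 'rV[R]_d).
Local Notation E := 'rV[R]_d.

Lemma continuous_dx_measurable (f : E -> R) : (0 < d)%N -> continuous f ->
  measurable_fun setT (f : caratheodory_type (dx_outer Omega) -> R).
Proof. by move=> d0; apply: continuous_cara_measurable => // *; exact: dx_outer_halfspace. Qed.

Lemma continuous_dS_measurable (f : E -> R) : (0 < d)%N -> continuous f ->
  measurable_fun setT (f : caratheodory_type (dS_outer Omega) -> R).
Proof. by move=> d0; apply: continuous_cara_measurable => // *; exact: dS_outer_halfspace. Qed.

End boundary_measurability.

(** * Test functions *)

Section flat_function.
Context (R : realType).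
Implicit Types (p q : {poly R}) (x y : R).

(* Functions [p(1/x) exp(-1/x)] extended by [0] to [x <= 0]: this class is
   stable under derivation, and its members are flat at [0]. *)
Definition flat p (x : R) : R :=
  if 0 < x then p.[x^-1] * expR (- x^-1) else 0.

(** With [y = 1/x], the exponential series gives [y^(i+1) <= (i+1)! exp y], so each monomial
    [y^i exp(-y)] is at most [(i+1)! x]. For [p * 'X] the bound controls the difference quotients of
    [flat p] at [0]. *)
Lemma flat_bound p : exists2 C, 0 <= C & forall x, `|flat p x| <= C * `|x|.
Proof.
exists (\sum_(i < size p) `|p`_i| * i.+1`!%:R).
  by apply: sumr_ge0 => i _; rewrite mulr_ge0.
move=> x; rewrite /flat; case: ifPn => [x0|_]; last first.
  by rewrite normr0 mulr_ge0// sumr_ge0// => i _; rewrite mulr_ge0.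
rewrite horner_coef mulr_suml mulr_suml; apply: le_trans (ler_norm_sum _ _ _) _.
apply: ler_sum => i _; rewrite -!mulrA normrM ler_wpM2l//.
rewrite ger0_norm ?mulr_ge0 ?exprn_ge0 ?invr_ge0 ?(ltW x0) ?expR_ge0// gtr0_norm//.
have y0 : 0 < x^-1 by rewrite invr_gt0.
have h := expR_ge1Dxn i (ltW y0).
rewrite expRN ler_pdivrMr ?expR_gt0//.
have f0 : 0 < i.+1`!%:R :> R by rewrite ltr0n fact_gt0.
have {}h : x^-1 ^+ i.+1 <= i.+1`!%:R * expR x^-1.
  rewrite -ler_pdivrMl// mulrC; apply: le_trans h; rewrite lerDr//.
have -> : x^-1 ^+ i = x * x^-1 ^+ i.+1 by rewrite exprS mulrA divff ?gt_eqF// mul1r.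
by rewrite (mulrC _ x) -mulrA ler_pM2l.
Qed.

(** For [x > 0] the chain rule contributes a factor [1/x^2] and the product rule gives [p - p'] at
    [1/x]. At [0] the quotient [flat p h / h] is [flat (p * 'X) h], which tends to [0]. *)
Lemma flat_is_derive p x : is_derive x 1 (flat p) (flat ('X^2 * (p - p^`())) x).
Proof.
have [x0|x0|->] := ltrgtP x 0.
- apply: (@near_eq_is_derive _ _ _ (cst 0)).
    near=> y; rewrite /flat ifF//; apply/negbTE; rewrite -leNgt ltW//.
    by near: y; exact: lt_nbhsl.
  by rewrite /flat ltNge (ltW x0)/=; exact: is_derive_cst.
- apply: (@near_eq_is_derive _ _ _ (fun y => p.[y^-1] * expR (- y^-1))).
    near=> y; rewrite /flat ifT//.
    by near: y; exact: lt_nbhsr.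
  have xn0 : x != 0 by rewrite gt_eqF.
  have di : is_derive x 1 (fun y : R => y^-1) (- x ^- 2).
    have := @is_deriveV R id x 1 1 xn0 (is_derive_id _ _).
    by rewrite scaler1.
  have dp : is_derive x 1 (fun y : R => p.[y^-1]) ((- x ^- 2) * p^`().[x^-1]).
    have := @is_derive1_comp R (horner p) (fun y => y^-1) x _ _ (is_derive_poly _ _) di.
    by rewrite mulrC.
  have de : is_derive x 1 (fun y : R => expR (- y^-1)) (x ^- 2 * expR (- x^-1)).
    have := @is_derive1_comp R expR (fun y => - y^-1) x _ _ (is_derive_expR _) (is_deriveN di).
    by rewrite opprK mulrC.
  have := @is_deriveM R R _ _ x 1 _ _ dp de.
  rewrite /flat x0 => H; apply: is_derive_eq H _.
  rewrite hornerM hornerXn hornerD hornerN -!exprVn.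
  rewrite -[p.[_] *: _]/(p.[_] * _) -[expR _ *: _]/(expR _ * _); ring.
have -> : flat ('X^2 * (p - p^`())) 0 = 0 by rewrite /flat ltxx.
have [C C0 hC] := flat_bound (p * 'X).
have f0 : flat p 0 = 0 by rewrite /flat ltxx.
have H : (fun h : R => h^-1 *: (flat p (h *: 1 + 0) - flat p 0)) @ 0^' --> (0 : R).
  apply/cvgrPdist_le => /= e e0.
  near=> h.
  rewrite sub0r normrN f0 subr0 addr0 [h *: 1]mulr1.
  have [h0|h0] := ltP 0 h; last by rewrite /flat ltNge h0/= scaler0 normr0 ltW.
  have -> : h^-1 *: flat p h = flat (p * 'X) h.
    by rewrite /flat h0 hornerMX /GRing.scale/=; ring.
  apply: le_trans (hC h) _.
  have : `|h| <= e / (C + 1).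
    by near: h; apply: dnbhs0_le; rewrite divr_gt0// ltr_wpDl.
  rewrite ler_pdivlMr ?ltr_wpDl// mulrDr mulr1 mulrC => h1.
  by apply: le_trans h1; rewrite lerDl.
apply: DeriveDef; first by apply/cvg_ex; exists 0.
exact: cvg_lim.
Unshelve. all: by end_near. Qed.

Lemma flat_continuous p : continuous (flat p).
Proof.
move=> x; apply/differentiable_continuous/derivable1_diffP.
exact: (@ex_derive _ _ _ _ _ _ _ (flat_is_derive p x)).
Qed.

Lemma flat1_ge0 x : 0 <= flat 1 x.
Proof. by rewrite /flat; case: ifP => // _; rewrite hornerC mul1r expR_ge0. Qed.

Lemma flat1_le1 x : flat 1 x <= 1.
Proof.
rewrite /flat; case: ifPn => // x0.
by rewrite hornerC mul1r expR_le1 oppr_le0 invr_ge0 ltW.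
Qed.

Lemma flat1_cvg x : 0 < x -> flat 1 (n.+1%:R * x) @[n --> \oo] --> (1 : R).
Proof.
move=> x0.
have -> : (fun n => flat 1 (n.+1%:R * x)) = (fun n => expR (- (n.+1%:R^-1 * x^-1))).
  by apply/funext => n; rewrite /flat mulr_gt0// hornerC mul1r invfM.
rewrite -[X in _ --> X](@expR0 R).
apply: continuous_cvg; first exact: continuous_expR.
rewrite -oppr0; apply: cvgN; rewrite -(mul0r x^-1); apply: cvgMl.
exact: cvg_harmonic.
Qed.

End flat_function.

Section smooth_functions.
Context (R : realType) (d : nat).
Local Notation E := 'rV[R]_d.
Implicit Types f g : E -> R.

Lemma is_derive_line f (x v : E) (l : R) :
  is_derive (0 : R) 1 (fun h : R => f (h *: v + x)) l -> is_derive x v f l.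
Proof.
move=> [df dl]; apply: DeriveDef; first exact/derivable1P.
rewrite -dl /derive.
have -> // : (fun h : R => h^-1 *: ((f \o shift x) (h *: v) - f x)) =
  (fun h : R => h^-1 *: (((fun h : R => f (h *: v + x)) \o shift 0) (h *: 1)
                        - f (0 *: v + x))).
by apply/funext => h /=; rewrite addr0 scale0r add0r [_%:A]mulr1.
Qed.

Lemma CkS k f : Ck k.+1 f -> Ck k f.
Proof.
elim: k f => [|k IH] f [fc df]; first by split.
by split => // i; have [dfi Cfi] := df i; split => //; exact: IH.
Qed.

Lemma smooth_continuous f : smooth f -> continuous f.
Proof. by move=> /(_ 0%N)[]. Qed.

Lemma smooth_derivable f i x : smooth f -> derivable f x (delta_mx 0 i : E).
Proof. by move=> /(_ 1%N)[_ /(_ i)[]]. Qed.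

Lemma smooth_partial f i : smooth f -> smooth (partial i f).
Proof. by move=> sf k; have [_ /(_ i)[]] := sf k.+1. Qed.

Lemma partialD f g i : (forall x, derivable f x (delta_mx 0 i : E)) ->
  (forall x, derivable g x (delta_mx 0 i : E)) ->
  partial i (fun x => f x + g x) = (fun x => partial i f x + partial i g x).
Proof. by move=> df dg; apply/funext => x; rewrite /partial deriveD. Qed.

Lemma partialM f g i : (forall x, derivable f x (delta_mx 0 i : E)) ->
  (forall x, derivable g x (delta_mx 0 i : E)) ->
  partial i (fun x => f x * g x) =
  (fun x => f x * partial i g x + g x * partial i f x).
Proof. by move=> df dg; apply/funext => x; rewrite /partial deriveM. Qed.

Lemma partial_cst c i : partial i (fun=> c : R) = (fun=> 0 : R) :> (E -> R).
Proof. by apply/funext => x; rewrite /partial derive_cst. Qed.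

Lemma Ck_cst k c : Ck k (fun _ : E => c : R).
Proof.
elim: k c => [|k IH] c; split; try exact: cst_continuous; first by [].
by move=> i; split; [move=> x; exact: derivable_cst|rewrite partial_cst; exact: IH].
Qed.

Lemma CkD k f g : Ck k f -> Ck k g -> Ck k (fun x => f x + g x).
Proof.
elim: k f g => [|k IH] f g [fc df] [gc dg]; split => //; try exact: fctD_continuous.
move=> i; have [dfi Cfi] := df i; have [dgi Cgi] := dg i; split.
  by move=> x; apply: derivableD.
by rewrite partialD//; exact: IH.
Qed.

Lemma CkM k f g : Ck k f -> Ck k g -> Ck k (fun x => f x * g x).
Proof.
elim: k f g => [|k IH] f g Cf Cg.
  by have [fc _] := Cf; have [gc _] := Cg; split => //; exact: fctM_continuous.
have Cf' := CkS Cf; have Cg' := CkS Cg.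
have [fc df] := Cf; have [gc dg] := Cg; split; first exact: fctM_continuous.
move=> i; have [dfi Cfi] := df i; have [dgi Cgi] := dg i; split.
  by move=> x; apply: derivableM.
by rewrite partialM//; apply: CkD; exact: IH.
Qed.

Lemma smooth_cst (c : R) : smooth (fun _ : E => c).
Proof. by move=> k; exact: Ck_cst. Qed.

Lemma smoothD f g : smooth f -> smooth g -> smooth (fun x => f x + g x).
Proof. by move=> sf sg k; exact: CkD. Qed.

Lemma smoothM f g : smooth f -> smooth g -> smooth (fun x => f x * g x).
Proof. by move=> sf sg k; exact: CkM. Qed.

Lemma smoothZ c f : smooth f -> smooth (fun x => c * f x).
Proof. by move=> sf; apply: smoothM => //; exact: smooth_cst. Qed.

Lemma smooth_prod (I : Type) (s : seq I) (F : I -> E -> R) :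
  (forall i, smooth (F i)) -> smooth (fun x => \prod_(i <- s) F i x).
Proof.
move=> sF; elim: s => [|i s IH].
  under [X in smooth X]funext => x do rewrite big_nil.
  exact: smooth_cst.
under [X in smooth X]funext => x do rewrite big_cons.
exact: smoothM.
Qed.

Lemma partial_lin c f g i : smooth f -> smooth g ->
  partial i (fun x => c * f x + g x) = (fun x => c * partial i f x + partial i g x).
Proof.
move=> sf sg; rewrite partialD => [|x|x]; last 2 first.
- exact/smooth_derivable/smoothZ.
- exact: smooth_derivable.
apply/funext => x; congr (_ + _).
rewrite partialM => [|y|y]; last 2 first.
- exact: derivable_cst.
- exact: smooth_derivable.
by rewrite partial_cst mulr0 addr0.
Qed.

(** The induction on [k] keeps [p] general, because each derivative is a constant times the same
    construction on another polynomial. *)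
Lemma smooth_flat_affine (p : {poly R}) (c b : R) (i : 'I_d) :
  smooth (fun x : E => flat p (c * x 0 i + b)).
Proof.
have aff : continuous (fun x : E => c * x 0 i + b).
  apply: fctD_continuous; last exact: cst_continuous.
  apply: fctZ_continuous; exact: coord_continuous.
have der q j (x : E) : is_derive x (delta_mx 0 j : E)
    (fun x : E => flat q (c * x 0 i + b))
    (c * (i == j)%:R * flat ('X^2 * (q - q^`())) (c * x 0 i + b)).
  apply: is_derive_line.
  have -> : (fun h : R => flat q (c * (h *: (delta_mx 0 j : E) + x) 0 i + b)) =
      flat q \o (fun h => (c * (i == j)%:R) * h + (c * x 0 i + b)).
    apply/funext => h /=; congr flat; rewrite !mxE eqxx/=; ring.
  have h0 := flat_is_derive q (c * (i == j)%:R * 0 + (c * x 0 i + b)).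
  have h1 : is_derive (0 : R) 1 (fun h : R => (c * (i == j)%:R) * h) (c * (i == j)%:R).
    have := @is_deriveZ R R _ id (c * (i == j)%:R) 0 1 1 (is_derive_id _ _).
    by rewrite [_ *: 1]mulr1.
  have h2 := is_deriveD h1 (is_derive_cst (c * x 0 i + b) (0 : R) (1 : R)).
  have := @is_derive1_comp R (flat q) 
    (fun h => (c * (i == j)%:R) * h + (c * x 0 i + b)) 0 _ _ h0 h2.
  by move=> H; apply: is_derive_eq H _; rewrite mulr0 add0r addr0 mulrC.
move=> k; elim: k p => [|k IH] p; split => //.
- by move=> x; apply: (continuous_comp (aff x)); exact: flat_continuous.
- by move=> x; apply: (continuous_comp (aff x)); exact: flat_continuous.
move=> j; split=> [x|]; first by have [] := der p j x.
have -> : partial j (fun x : E => flat p (c * x 0 i + b)) =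
    (fun x => c * (i == j)%:R * flat ('X^2 * (p - p^`())) (c * x 0 i + b)).
  by apply/funext => x; have [_] := der p j x.
by apply: CkM; [exact: Ck_cst|exact: IH].
Qed.

Lemma box_closed (a b : E) : closed (box a b).
Proof.
rewrite (_ : box a b = \bigcap_(i in [set: 'I_d])
   [set x : E | a 0 i <= x 0 i <= b 0 i]); last first.
  by apply/seteqP; split=> x /= h i; [move=> _; exact: h|exact: h].
apply: closed_bigI => i _.
rewrite (_ : [set x : E | _] = (fun x : E => x 0 i) @^-1` `[a 0 i, b 0 i]%classic).
  apply: preimage_closed; last exact: interval_closed.
  by move=> x _; exact: coord_continuous.
by apply/seteqP; split=> x /=; rewrite in_itv.
Qed.

Lemma box_compact (a b : E) : compact (box a b).
Proof.
apply: bounded_closed_compact; last exact: box_closed.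
exists (\sum_i (`|a 0 i| + `|b 0 i|)); split; first exact: num_real.
move=> M hM x bx; rewrite /= [leLHS]/Num.Def.normr /= mx_normrE.
have S0 : 0 <= \sum_i (`|a 0 i| + `|b 0 i|).
  by apply: sumr_ge0 => i _; rewrite addr_ge0.
apply: bigmax_le => [|[i j] _]/=; first exact: ltW (le_lt_trans S0 hM).
rewrite ord1; apply: le_trans (ltW hM); rewrite (bigD1 j)//=.
have : `|x 0 j| <= `|a 0 j| + `|b 0 j|.
  have /andP[ax xb] := bx j.
  have ha := ler_norm (- a 0 j); rewrite normrN in ha.
  have hb := ler_norm (b 0 j).
  have ha0 := normr_ge0 (a 0 j); have hb0 := normr_ge0 (b 0 j).
  rewrite ler_norml; apply/andP; split; lra.
move/le_trans; apply; rewrite lerDl; apply: sumr_ge0 => i' _; exact: addr_ge0.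
Qed.

Variable Omega : set E.

Lemma test_functionI f (K : set E) : smooth f -> compact K -> K `<=` Omega ->
  [set x | f x != 0] `<=` K -> test_function Omega f.
Proof.
move=> sf cK KO fK.
have Kcl : closed K by apply: compact_closed => //; exact: norm_hausdorff.
have clK : closure [set x | f x != 0] `<=` K.
  by rewrite closureE; exact: smallest_sub.
split => //; last exact: subset_trans KO.
apply: subclosed_compact cK clK; exact: closed_closure.
Qed.

Lemma test_functionD f g : test_function Omega f -> test_function Omega g ->
  test_function Omega (fun x => f x + g x).
Proof.
move=> [sf cf Of] [sg cg Og].
apply: (@test_functionI _ (closure [set x | f x != 0] `|` closure [set x | g x != 0])).
- exact: smoothD.
- exact: compactU.
- by move=> x [/Of|/Og].
- move=> x /= fg; have [fx|fx] := eqVneq (f x) 0; last by left; exact: subset_closure.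
  by right; apply: subset_closure; rewrite /= fx add0r in fg.
Qed.

Lemma test_functionMl f g : smooth f -> test_function Omega g ->
  test_function Omega (fun x => f x * g x).
Proof.
move=> sf [sg cg Og].
apply: (@test_functionI _ (closure [set x | g x != 0])) => //; first exact: smoothM.
by move=> x /=; rewrite mulf_eq0 negb_or => /andP[_ gx]; exact: subset_closure.
Qed.

Lemma test_functionZ c f : test_function Omega f ->
  test_function Omega (fun x => c * f x).
Proof. by move=> tf; apply: test_functionMl => //; exact: smooth_cst. Qed.

(** Off the closed support [f] vanishes on a neighbourhood, so its derivative vanishes there too. *)
Lemma test_function_partial f i : test_function Omega f ->
  test_function Omega (partial i f).
Proof.
move=> [sf cf Of].
apply: (@test_functionI _ (closure [set x | f x != 0])) => //; first exact: smooth_partial.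
move=> x /= pfx; apply: contrapT => ncl; move/eqP: pfx; apply.
have : nbhs x (~` closure [set x | f x != 0]).
  by apply: open_nbhs_nbhs; split => //; apply: closed_openC; exact: closed_closure.
move=> nx; rewrite /partial (@near_eq_derive _ _ _ f (cst 0)).
  by rewrite derive_cst.
apply: filterS nx => y ncy; apply/eqP/negPn/negP => fy.
by apply: ncy; exact: subset_closure.
Qed.

(** The factors are kept in the affine form that [smooth_flat_affine] treats. The scale [n.+1] sends
    the exponents to [0], so the bumps tend to the indicator function of the open box. *)
Definition bump (a b : E) (n : nat) : E -> R := fun x =>
  \prod_(i < d) (flat 1 (n.+1%:R * x 0 i + - (n.+1%:R * a 0 i))
                 * flat 1 (- n.+1%:R * x 0 i + n.+1%:R * b 0 i)).

Lemma bumpE a b n x : bump a b n x =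
  \prod_(i < d) (flat 1 (n.+1%:R * (x 0 i - a 0 i))
                 * flat 1 (n.+1%:R * (b 0 i - x 0 i))).
Proof. by apply: eq_bigr => i _; congr (flat _ _ * flat _ _); ring. Qed.

Lemma bump_ge0 a b n x : 0 <= bump a b n x.
Proof. by apply: prodr_ge0 => i _; rewrite mulr_ge0// flat1_ge0. Qed.

Lemma bump_le1 a b n x : bump a b n x <= 1.
Proof.
apply: prodr_ile1 => i _; rewrite mulr_ge0 ?flat1_ge0//=.
by rewrite mulr_ile1 ?flat1_ge0 ?flat1_le1.
Qed.

Lemma bump_out a b n x : ~ obox a b x -> bump a b n x = 0.
Proof.
move=> nx; rewrite bumpE; apply/eqP; rewrite prodf_seq_eq0.
apply: contrapT => /negP/hasPn h; apply: nx => i.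
have /h := mem_index_enum i; rewrite /= mulf_eq0 negb_or /flat => /andP[].
have n0 : 0 < n.+1%:R :> R by [].
rewrite !pmulr_rgt0// !subr_gt0.
have [ai|ai] := ltP (a 0 i) (x 0 i); last by rewrite eqxx.
by have [bi|bi] := ltP (x 0 i) (b 0 i); last by rewrite eqxx.
Qed.

Lemma bump_cvg a b x : obox a b x -> bump a b n x @[n --> \oo] --> (1 : R).
Proof.
move=> ox; under eq_fun do rewrite bumpE.
suff : \prod_(i < d) (flat 1 (n.+1%:R * (x 0 i - a 0 i))
    * flat 1 (n.+1%:R * (b 0 i - x 0 i))) @[n --> \oo] --> \prod_(i < d) ((1 : R) * 1).
  by rewrite [X in _ --> X]big1// => i _; rewrite mul1r.
elim: (index_enum _) => [|i s IH].
  by under eq_fun do rewrite big_nil; rewrite big_nil; exact: cvg_cst.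
under eq_fun do rewrite big_cons; rewrite big_cons.
have /andP[ai bi] := ox i.
apply: cvgM => //; apply: cvgM; apply: flat1_cvg; by rewrite subr_gt0.
Qed.

Lemma test_function_bump a b n : box a b `<=` Omega ->
  test_function Omega (bump a b n).
Proof.
move=> abO; apply: (@test_functionI _ (box a b)) => //.
- apply: smooth_prod => i; apply: smoothM; exact: smooth_flat_affine.
- exact: box_compact.
- move=> x /= bx; apply: obox_sub_box; apply: contrapT => nx.
  by move/eqP: bx; apply; exact: bump_out.
Qed.

End smooth_functions.

(** * Integration by parts *)

Lemma translate_comp_continuous (R : realType) (V : normedModType R) (v : V)
  (f : V -> R) : continuous f -> continuous (fun x => f (v + x)).
Proof.
move=> fc x; apply: (@continuous_comp _ _ _ (fun x : V => v + x) f); last exact: fc.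
by apply: cvgD; [exact: cvg_cst|exact: cvg_id].
Qed.

(** * Translation invariance and change of domain *)

Section translation.
Context (R : realType) (d : nat).
Local Notation E := 'rV[R]_d.
Local Notation leb := (dx [set: E]).

Lemma lebesgue_outer_translate_le (v : E) (A : set E) :
  (lebesgue_outer ((+%R v) @^-1` A) <= lebesgue_outer A)%E.
Proof.
apply: le_ereal_inf_tmp => _ [B /= AB <-].
apply: (@le_trans _ _ (\sum_(k <oo) box_cost ((+%R v) @^-1` B k))%E).
  apply: ereal_inf_lbound; exists (fun k => (+%R v) @^-1` B k) => //=.
  by move=> x /= /AB[k _ Bk]; exists k.
apply: lee_nneseries => [i _ _|i _]; first exact: box_cost_ge0.
rewrite {2}/box_cost; case: asboolP => [->|_].
  by rewrite preimage_set0 box_cost0.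
apply: le_ereal_inf_tmp => _ [[a b] /= [ab ->] <-].
have -> : (+%R v) @^-1` box a b = box (a - v) (b - v).
  apply/seteqP; split=> x /= h j; have := h j; rewrite !mxE lerBlDl lerBrDl//.
rewrite (eq_bigr (fun j => (b - v) 0 j - (a - v) 0 j)); last first.
  by move=> j _; rewrite !mxE; ring.
by apply: box_cost_le => j; rewrite !mxE lerD2r.
Qed.

Lemma lebesgue_outer_translate (v : E) (A : set E) :
  lebesgue_outer ((+%R v) @^-1` A) = lebesgue_outer A.
Proof.
apply/eqP; rewrite eq_le lebesgue_outer_translate_le/=.
have := lebesgue_outer_translate_le (- v) ((+%R v) @^-1` A).
congr (lebesgue_outer _ <= _)%E.
by apply/seteqP; split=> x /=; rewrite addNKr ?addKr// addrA subrr add0r.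
Qed.

Lemma dx_setT (A : set E) : leb A = lebesgue_outer A.
Proof. by rewrite /dx/= /cara_measure/= /dx_outer setIT. Qed.

Lemma translate_measurable (v : E) :
  measurable_fun setT ((fun x => v + x) :
    caratheodory_type (dx_outer [set: E]) -> caratheodory_type (dx_outer [set: E])).
Proof.
move=> _ A mA; rewrite setTI.
suff H : (dx_outer [set: E]).-caratheodory ((+%R v) @^-1` A) by exact: H.
move=> X; have := mA ((+%R (- v)) @^-1` X); rewrite /= /dx_outer !setIT.
rewrite lebesgue_outer_translate => ->.
rewrite -(lebesgue_outer_translate v (_ `&` A)) -(lebesgue_outer_translate v (_ `&` ~` A)).
by congr (_ + _)%E; congr lebesgue_outer; apply/seteqP; split=> x /=; rewrite addKr.
Qed.

Lemma ge0_integral_translate (v : E) (f : E -> \bar R) :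
  measurable_fun setT (f : caratheodory_type (dx_outer [set: E]) -> _) ->
  (forall x, 0 <= f x)%E ->
  (\int[leb]_x f (v + x)%R = \int[leb]_x f x)%E.
Proof.
move=> mf f0; have mt := @translate_measurable v.
have := @ge0_integral_pushforward _ _ _ _ R _ mt leb setT f measurableT mf (fun y _ => f0 y).
rewrite preimage_setT => <-.
apply: eq_measure_integral => A mA _.
change (leb ((+%R v) @^-1` A) = leb A).
by rewrite !dx_setT lebesgue_outer_translate.
Qed.

Lemma integral_translate (v : E) (f : E -> \bar R) :
  measurable_fun setT (f : caratheodory_type (dx_outer [set: E]) -> _) ->
  (\int[leb]_x f (v + x)%R = \int[leb]_x f x)%E.
Proof.
move=> mf; rewrite integralE [in RHS]integralE; congr (_ - _)%E.
- rewrite -[RHS](ge0_integral_translate v (measurable_funepos mf) (fun x => funepos_ge0 f x)).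
  by apply: eq_integral => x _; rewrite !funeposE.
- rewrite -[RHS](ge0_integral_translate v (measurable_funeneg mf) (fun x => funeneg_ge0 f x)).
  by apply: eq_integral => x _; rewrite !funenegE.
Qed.

Lemma cara_restr (Omega A : set E) : (dx_outer [set: E]).-caratheodory A ->
  (dx_outer Omega).-caratheodory A.
Proof.
move=> mA X; have := mA (X `&` Omega); rewrite /= /dx_outer !setIT => ->.
by rewrite ![_ `&` _ `&` Omega]setIAC.
Qed.

(** The two measures live on different sigma-algebras. The identity is measurable from the
    restricted one to the full one, and the pushforward agrees with Lebesgue measure on subsets of
    [Omega]. *)
Lemma ge0_integral_dx_full (Omega : set E) (f : E -> \bar R) :
  (dx_outer [set: E]).-caratheodory Omega ->
  measurable_fun setT (f : caratheodory_type (dx_outer [set: E]) -> _) ->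
  (forall x, 0 <= f x)%E -> (forall x, ~ Omega x -> f x = 0%E) ->
  (\int[dx Omega]_x f x = \int[leb]_x f x)%E.
Proof.
move=> mO mf f0 fO.
have mid : measurable_fun setT (id : caratheodory_type (dx_outer Omega) ->
    caratheodory_type (dx_outer [set: E])).
  by move=> _ A mA; rewrite setTI; exact: cara_restr.
have := @ge0_integral_pushforward _ _ _ _ R _ mid (dx Omega) setT f measurableT mf
  (fun y _ => f0 y).
rewrite preimage_setT => <-.
have rs (m : {measure set (caratheodory_type (dx_outer [set: E])) -> \bar R}) :
    (\int[m]_x f x = \int[m]_(x in Omega) f x)%E.
  rewrite [RHS]integral_mkcond; apply: eq_integral => x _.
  by rewrite patchE; case: ifPn => //; rewrite notin_setE => /fO.
rewrite !rs; apply: eq_measure_integral => A mA AO.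
rewrite /pushforward dx_setT /dx/= /cara_measure/= /dx_outer.
by congr lebesgue_outer; apply/seteqP; split=> x /= => [[]//|Ax]; split => //; exact: AO.
Qed.

Lemma integral_dx_full (Omega : set E) (f : E -> \bar R) :
  (dx_outer [set: E]).-caratheodory Omega ->
  measurable_fun setT (f : caratheodory_type (dx_outer [set: E]) -> _) ->
  (forall x, ~ Omega x -> f x = 0%E) ->
  (\int[dx Omega]_x f x = \int[leb]_x f x)%E.
Proof.
move=> mO mf fO; rewrite integralE [in RHS]integralE; congr (_ - _)%E.
- apply: (ge0_integral_dx_full mO (measurable_funepos mf) (fun x => funepos_ge0 f x)).
  by move=> x /fO; rewrite funeposE => ->; rewrite maxxx.
- apply: (ge0_integral_dx_full mO (measurable_funeneg mf) (fun x => funeneg_ge0 f x)).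
  by move=> x /fO; rewrite funenegE => ->; rewrite oppe0 maxxx.
Qed.

Lemma Rintegral_dx_full (Omega : set E) (f : E -> R) : (0 < d)%N ->
  (dx_outer [set: E]).-caratheodory Omega -> continuous f ->
  (forall x, ~ Omega x -> f x = 0) ->
  \int[dx Omega]_x f x = \int[leb]_x f x.
Proof.
move=> d0 mO fc fO; congr fine; apply: (integral_dx_full (f := EFin \o f) mO).
  by apply/measurable_EFinP; exact: continuous_dx_measurable.
by move=> x nO; rewrite /= fO.
Qed.

Lemma Rintegral_translate (v : E) (f : E -> R) : (0 < d)%N -> continuous f ->
  \int[leb]_x f (v + x) = \int[leb]_x f x.
Proof.
move=> d0 fc; congr fine; apply: (integral_translate v (f := EFin \o f)).
by apply/measurable_EFinP; exact: continuous_dx_measurable.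
Qed.

End translation.

Section integration_by_parts.
Context (R : realType) (d : nat).
Local Notation E := 'rV[R]_d.

Lemma bounded_set_box (Omega : set E) : bounded_set Omega ->
  exists2 M, 0 <= M & Omega `<=` box (const_mx (- M)) (const_mx M).
Proof.
move=> [M [_ hM]]; exists (`|M| + 1); first by rewrite addr_ge0.
move=> x Ox i; rewrite !mxE -ler_norml; apply: le_trans (coord_le_norm _ _) _.
by apply: hM Ox; apply: (le_lt_trans (ler_norm M)); rewrite ltrDl.
Qed.

Lemma dx_finite (Omega : set E) : bounded_set Omega -> (dx Omega setT < +oo)%E.
Proof.
move=> /bounded_set_box[M M0 OM].
rewrite /dx/= /cara_measure/= /dx_outer setTI.
apply: (@le_lt_trans _ _ (box_cost (box (const_mx (- M)) (const_mx M)))).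
  exact: (cover_outer_le (@box_cost0 R d) (@box_cost_ge0 R d)).
apply: le_lt_trans (box_cost_le _) _; last exact: ltry.
by move=> i; rewrite !mxE; lra.
Qed.

Section finite_measure.
Context (disp : measure_display) (T : measurableType disp).
Context (mu : {measure set T -> \bar R}).

Lemma dominated_Rint_cvg (f_ : nat -> T -> R) (f g : T -> R) :
  (forall n, measurable_fun setT (f_ n)) -> measurable_fun setT f ->
  mu.-integrable setT (EFin \o g) -> (forall n x, `|f_ n x| <= g x) ->
  (forall x, f_ ^~ x n @[n --> \oo] --> f x) ->
  \int[mu]_x f_ n x @[n --> \oo] --> \int[mu]_x f x.
Proof.
move=> mf_ mf ig f_g f_f.
have [] := @dominated_convergence _ _ _ mu setT measurableT
  (fun n x => (f_ n x)%:E) (fun x => (f x)%:E) (fun x => (g x)%:E).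
- by move=> n; apply/measurable_EFinP.
- exact/measurable_EFinP.
- by apply: aeW => x _; apply: cvg_EFin; [exact: nearW|exact: f_f].
- exact: ig.
- by apply: aeW => x n _; rewrite lee_fin.
move=> fi _ lim; apply: fine_cvg; rewrite /Rintegral fineK//.
exact: integrable_fin_num.
Qed.

Hypothesis mu_fin : (mu setT < +oo)%E.

Lemma bounded_L1 (f : T -> R) M : measurable_fun setT f ->
  (forall x, `|f x| <= M) -> mu.-integrable setT (EFin \o f).
Proof.
move=> mf fM; apply: (@ae_le_L1 _ _ _ _ _ (fun=> M)) => //; last exact: aeW.
apply/integrableP; split; first exact/measurable_EFinP.
rewrite /= integral_cst// lte_mul_pinfty//; exact: abse_ge0.
Qed.

Lemma bounded_L2 (f : T -> R) M : measurable_fun setT f ->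
  (forall x, `|f x| <= M) -> L2 mu f.
Proof.
move=> mf fM; apply/L2P; split => //.
apply: (@bounded_L1 _ (M ^+ 2)); first exact: measurable_funX.
move=> x; rewrite normrX lerXn2r// nnegrE//.
exact: le_trans (fM x).
Qed.

End finite_measure.

Lemma test_function_bounded (Omega : set E) f : test_function Omega f ->
  exists2 M, 0 <= M & forall x, `|f x| <= M.
Proof.
move=> [sf cK _]; set K := closure _ in cK.
have out x : ~ K x -> f x = 0.
  by move=> nK; apply/eqP/negPn/negP => fx; apply: nK; exact: subset_closure.
have [K0|K0] := pselect (K !=set0); last first.
  exists 0 => // x; rewrite out ?normr0// => Kx; apply: K0; by exists x.
have fc := smooth_continuous sf.
have nc : continuous (fun x => `|f x|).
  by move=> x; apply: (continuous_comp (fc x)); exact: norm_continuous.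
have [c _ hc] := EVT_max_rV K0 cK (continuous_subspaceT nc).
exists `|f c| => // x; have [Kx|/out->] := pselect (K x); last by rewrite normr0.
by apply: hc; rewrite inE.
Qed.

Variables (Omega : set E).
Hypotheses (d0 : (0 < d)%N) (Omega_open : open Omega) (Omega_bd : bounded_set Omega).

(* The integral of [f] over the whole space is invariant under translation, and
   the difference quotients of [f] converge dominatedly to the derivative. *)
Lemma integral_partial_test f i : test_function Omega f ->
  \int[dx Omega]_x partial i f x = 0.
Proof.
move=> tf; have tf' := test_function_partial i tf.
have [sf cK KO] := tf; have [sf' _ _] := tf'.
have [M M0 OM] := bounded_set_box Omega_bd.
(* [Omega] has coordinates bounded by [M], and translates by steps of length at most [1] stay inside
   this open box. Its finite measure makes bounded functions integrable. *)
pose O' : set E := obox (const_mx (- (M + 2))) (const_mx (M + 2)).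
have hs := @dx_outer_halfspace R d.
have mO' : (dx_outer [set: E]).-caratheodory O' := obox_measurable (hs setT) _ _.
have mO : (dx_outer [set: E]).-caratheodory Omega := open_cara_measurable d0 (hs setT) Omega_open.
have O'bd : bounded_set O'.
  exists (M + 2); split; first exact: num_real.
  move=> x xM y Oy; rewrite /= [leLHS]/Num.Def.normr /= mx_normrE.
  apply: bigmax_le => [|[j k] _]/=; first lra.
  have := obox_sub_box Oy k; rewrite !mxE -ler_norml ord1 => h.
  exact: le_trans h (ltW xM).
have fin' := dx_finite O'bd.
have fO x : ~ Omega x -> f x = 0.
  move=> nO; apply/eqP/negPn/negP => fx; apply: nO; apply: KO; exact: subset_closure.
have f'O x : ~ Omega x -> partial i f x = 0.
  have [_ _ KO'] := tf'.
  move=> nO; apply/eqP/negPn/negP => fx; apply: nO; apply: KO'; exact: subset_closure.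
have OO' : Omega `<=` O'.
  move=> x /OM h j; have := h j; rewrite !mxE => /andP[h1 h2]; apply/andP; split; lra.
have fc := smooth_continuous sf; have f'c := smooth_continuous sf'.
have -> : \int[dx Omega]_x partial i f x = \int[dx O']_x partial i f x.
  rewrite (Rintegral_dx_full d0 mO f'c f'O) (Rintegral_dx_full d0 mO' f'c)//.
  by move=> x nO'; apply: f'O => /OO'.
have [C C0 hC] := test_function_bounded tf'.
have [C1 C10 hC1] := test_function_bounded tf.
pose e : E := delta_mx 0 i.
pose q n (x : E) : R := n.+1%:R * (f (n.+1%:R^-1 *: e + x) - f x).
have line (x : E) (s : R) : is_derive s 1 (fun h : R => f (h *: e + x)) (partial i f (s *: e + x)).
  have D := @smooth_derivable _ _ f i (s *: e + x) sf.
  have := derivableP D; rewrite -/(partial i f (s *: e + x)) => D1.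
  apply: DeriveDef.
    apply/derivable1P; move/derivable1P : D.
    by under eq_fun do rewrite addrA -scalerDl -[X in (X + _) *: _]mulr1.
  rewrite /partial /derive; congr (lim _).
  have -> // : (fun h : R => h^-1 *: (((fun h0 : R => f (h0 *: e + x)) \o shift s) (h *: 1)
      - f (s *: e + x))) =
    (fun h : R => h^-1 *: ((f \o shift (s *: e + x)) (h *: delta_mx 0 i) - f (s *: e + x))).
  by apply/funext => h /=; rewrite [_%:A]mulr1 scalerDl addrA.
(* The mean value theorem bounds difference quotients by the supremum of the derivative, which is
   the domination needed. *)
have qbd n x : `|q n x| <= C.
  have t0 : 0 < n.+1%:R^-1 :> R by [].
  have lc : {within `[0, n.+1%:R^-1], continuous (fun h : R => f (h *: e + x))}.
    apply: continuous_subspaceT => s; apply/differentiable_continuous/derivable1_diffP.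
    exact: (@ex_derive _ _ _ _ _ _ _ (line x s)).
  have [c _] := MVT t0 (fun s _ => line x s) lc.
  rewrite scale0r add0r subr0 /q => ->.
  by rewrite mulrCA mulfV ?mulr1.
have qcvg x : q ^~ x n @[n --> \oo] --> partial i f x.
  have [D _] := line x 0; have := derivableP D.
  have [_ dv] := line x 0; rewrite dv scale0r add0r => _.
  have := D; rewrite /derivable => /cvg_ex[l hl].
  have El : l = partial i f x.
    have <- := cvg_lim (@norm_hausdorff _ _) hl.
    by rewrite -[LHS]/('D_1 (fun h : R => f (h *: e + x)) 0) dv scale0r add0r.
  rewrite -El.
  (* The steps never vanish, so they converge within the punctured neighbourhoods that define the
     derivative. *)
  have inv0 : n.+1%:R^-1 @[n --> \oo] --> (0 : R)^'.
    move=> A /= hA.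
    have hB : \forall n \near \oo, n.+1%:R^-1 != 0 :> R -> A n.+1%:R^-1.
      exact: (@cvg_harmonic R _ hA).
    by apply: (@filterS _ \oo _ _ _ _ hB) => n; apply; rewrite invr_neq0.
  have := cvg_comp _ _ inv0 hl.
  apply: cvg_trans; apply: near_eq_cvg; apply: nearW => n /=.
  by rewrite /q invrK addr0 scale0r add0r [_%:A]mulr1.
have qint n : \int[dx O']_x q n x = 0.
  have tc : continuous (fun x => f (n.+1%:R^-1 *: e + x)).
    exact: translate_comp_continuous.
  have Li (g : E -> R) : continuous g -> (forall x, `|g x| <= C1) ->
      (dx O').-integrable setT (EFin \o g).
    move=> gc gb; apply: (bounded_L1 fin') gb; exact: continuous_dx_measurable.
  have L1a := Li _ tc (fun x => hC1 _); have L1b := Li _ fc hC1.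
  have Lb' := L1Z (-1) L1b.
  (* Both functions vanish outside [O'], so the integrals may be taken over the whole space, where
     translation changes nothing. *)
  have EQ : \int[dx O']_x f (n.+1%:R^-1 *: e + x) = \int[dx O']_x f x.
    have fO' x : ~ O' x -> f x = 0 by move=> nO'; apply: fO => /OO'.
    rewrite (Rintegral_dx_full d0 mO' fc fO') (Rintegral_dx_full d0 mO' tc).
      exact: Rintegral_translate.
    move=> x nO'; apply: fO => /OM h; apply: nO' => j.
    have := h j; rewrite !mxE eqxx/=.
    have t0 : 0 <= n.+1%:R^-1 :> R by [].
    have t1 : n.+1%:R^-1 <= 1 :> R by rewrite invf_le1// ler1n.
    have b0 : 0 <= (j == i)%:R :> R by [].
    have b1 : (j == i)%:R <= 1 :> R by case: eqP.
    have p0 := mulr_ge0 t0 b0; have p1 := mulr_ile1 t0 b0 t1 b1.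
    move: (_ * _) p0 p1 => p p0 p1.
    move=> /andP[h1 h2]; apply/andP; split; lra.
  rewrite /q RintZ; last first.
    have := L1D L1a Lb'; apply: eq_integrable => // x _ /=; congr EFin; ring.
  have -> : \int[dx O']_x (f (n.+1%:R^-1 *: e + x) - f x) =
      \int[dx O']_x (f (n.+1%:R^-1 *: e + x) + -1 * f x).
    by apply: eq_Rintegral => x _; ring.
  by rewrite RintD// RintZ// EQ; ring.
have mq n : measurable_fun setT (q n : caratheodory_type (dx_outer O') -> R).
  apply: continuous_dx_measurable => //; apply: fctZ_continuous.
  apply: fctD_continuous; last exact: fctN_continuous.
  exact: translate_comp_continuous.
have mpf : measurable_fun setT (partial i f : caratheodory_type (dx_outer O') -> R).
  exact: continuous_dx_measurable.
have iC : (dx O').-integrable setT (EFin \o (fun=> C)).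
  by apply: (@bounded_L1 _ _ _ fin' (fun=> C) C) => // _; rewrite ger0_norm.
have := dominated_Rint_cvg mq mpf iC qbd qcvg.
under eq_fun do rewrite qint.
by move=> h; apply: (cvg_unique _ h); [exact: norm_hausdorff|exact: cvg_cst].
Qed.

Lemma test_function_L2 f : test_function Omega f -> L2 (dx Omega) f.
Proof.
move=> tf; have [M _ hM] := test_function_bounded tf; have [sf _ _] := tf.
apply: (bounded_L2 (dx_finite Omega_bd)) hM.
exact/continuous_dx_measurable/smooth_continuous.
Qed.

(** The product with another test function is again a test function, so its partial derivatives
    integrate to [0]; the product rule does the rest. *)
Lemma test_function_weak_grad f : test_function Omega f ->
  is_weak_grad Omega f (grad f).
Proof.
move=> tf; split=> [i|phi tphi i].
  under [X in L2 _ X]funext => x do rewrite mxE.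
  exact/test_function_L2/test_function_partial.
have [sf _ _] := tf; have [sphi _ _] := tphi.
have := @integral_partial_test (fun x => f x * phi x) i (test_functionMl sf tphi).
rewrite partialM => [|x|x]; try exact: smooth_derivable.
have h1 := L2_mul (test_function_L2 tf) (test_function_L2 (test_function_partial i tphi)).
have h2 := L2_mul (test_function_L2 tphi) (test_function_L2 (test_function_partial i tf)).
rewrite RintD// => /eqP; rewrite addr_eq0 => /eqP ->; congr (- _).
by apply: eq_Rintegral => x _; rewrite mxE mulrC.
Qed.

End integration_by_parts.

(** * The fundamental lemma of the calculus of variations *)

Section outer_regularity.
Context (R : realType) (d : nat).
Local Notation E := 'rV[R]_d.

Lemma obox_open (a b : E) : open (obox a b).
Proof.
rewrite openE => x ox; exists (fun _ j => `]a 0 j, b 0 j[%classic) => [i j|y h j].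
  apply: open_nbhs_nbhs; split; first exact: interval_open.
  by rewrite /= in_itv/= ord1 ox.
by have := h 0 j; rewrite /= in_itv.
Qed.

Lemma fct_prod_continuous (T : topologicalType) (I : Type) (s : seq I)
  (F : I -> T -> R) : (forall i, continuous (F i)) ->
  continuous (fun x => \prod_(i <- s) F i x).
Proof.
move=> Fc; elim: s => [|i s IH].
  under [X in continuous X]eq_fun do rewrite big_nil.
  exact: cst_continuous.
under [X in continuous X]eq_fun do rewrite big_cons.
exact: fctM_continuous.
Qed.

(** A nonempty set of finite cost is a box. Corners of nearly optimal volume use one half of [e],
    and enlarging the box uses the other. *)
Lemma box_cost_open (B : set E) (e : R) : 0 < e -> (box_cost B < +oo)%E ->
  exists O : set E, [/\ open O, B `<=` O & (lebesgue_outer O <= box_cost B + e%:E)%E].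
Proof.
move=> e0 Boo.
have Bfin : box_cost B \is a fin_num by rewrite ge0_fin_numE// box_cost_ge0.
have [B0|B0] := pselect (B = set0).
  exists set0; split; [exact: open0|by rewrite B0|].
  rewrite /lebesgue_outer cover_outer0; first by rewrite adde_ge0 ?box_cost_ge0// lee_fin ltW.
  - exact: box_cost0.
  - exact: box_cost_ge0.
have cE : box_cost B = ereal_inf [set (\prod_(i < d) (ab.2 0 i - ab.1 0 i))%:E
            | ab in [set ab : E * E |
                (forall i, ab.1 0 i <= ab.2 0 i) /\ B = box ab.1 ab.2]].
  by rewrite /box_cost; case: asboolP.
have e20 : 0 < e / 2 by rewrite divr_gt0.
have := Bfin; rewrite {1}cE => /(lb_ereal_inf_adherent e20)[_ [[a b] /= [ab BE] <-]].
rewrite -cE => hab.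
(* The volume after every face has moved outwards by [t]. *)
pose P (t : R) := \prod_(i < d) (b 0 i - a 0 i + 2 * t).
have Pc : continuous P.
  apply: fct_prod_continuous => i; apply: fctD_continuous; first exact: cst_continuous.
  by apply: fctZ_continuous => x; exact: cvg_id.
have P0 : P 0 = \prod_(i < d) (b 0 i - a 0 i).
  by apply: eq_bigr => i _; rewrite mulr0 addr0.
have [t [t0 Pt]] : exists t, 0 < t /\ P t <= P 0 + e / 2.
  have /cvgrPdist_le/(_ _ e20) Pn := Pc 0.
  have : \forall t \near 0^'+, `|P 0 - P t| <= e / 2.
    exact: cvg_at_right_filter Pn.
  move=> near0; have [t [t0 ht]] := @filter_ex _ _ _ _
    (filterI (nbhs_right_gt (0 : R)) near0).
  exists t; split => //; move: ht; rewrite distrC => /(le_trans (ler_norm _)); lra.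
pose a' : E := a - const_mx t; pose b' : E := b + const_mx t.
exists (obox a' b'); split; first exact: obox_open.
  rewrite {1}BE => x bx i; have := bx i; rewrite !mxE => /andP[h1 h2].
  by apply/andP; split; lra.
apply: (@le_trans _ _ (box_cost (box a' b'))).
  exact: (cover_outer_le (@box_cost0 R d) (@box_cost_ge0 R d) (@obox_sub_box _ _ _ _)).
apply: le_trans (box_cost_le _) _.
  by move=> i; rewrite !mxE; have := ab i; lra.
rewrite (eq_bigr (fun i => b 0 i - a 0 i + 2 * t)); last first.
  by move=> i _; rewrite !mxE; ring.
move: hab; rewrite -P0 -(fineK Bfin) -!EFinD lte_fin lee_fin -/(P t); lra.
Qed.

Lemma lebesgue_outer_open (A : set E) (e : R) : 0 < e -> (lebesgue_outer A < +oo)%E ->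
  exists O : set E, [/\ open O, A `<=` O & (lebesgue_outer O <= lebesgue_outer A + e%:E)%E].
Proof.
move=> e0 Aoo.
have Afin : lebesgue_outer A \is a fin_num.
  by rewrite ge0_fin_numE// cover_outer_ge0// => B; exact: box_cost_ge0.
have e20 : 0 < e / 2 by rewrite divr_gt0.
have [_ [B /= AB <-] hB] := lb_ereal_inf_adherent e20 Afin.
have bcp := @box_cost_ge0 R d.
have Bk k : (box_cost (B k) < +oo)%E.
  rewrite ltey; apply/eqP => Bkoo; move: hB.
  rewrite (eseries_pinfty _ _ Bkoo)//; last by move=> n _; rewrite -ltNye (lt_le_trans _ (bcp _)).
  by rewrite ltNge leey.
(* One half of [e] pays for a nearly optimal cover; the other is shared out geometrically among its
   members. *)
have ex k : exists O : set E, [/\ open O, B k `<=` O &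
    (lebesgue_outer O <= box_cost (B k) + ((e / 2) / (2 ^ k.+1)%:R)%:E)%E].
  by apply: box_cost_open => //; rewrite divr_gt0// ltr0n expn_gt0.
have [W hW] := choice ex.
exists (\bigcup_k W k); split.
- by apply: bigcup_open => k _; have [] := hW k.
- by move=> x /AB[k _ Bx]; exists k => //; have [_ + _] := hW k; apply.
apply: le_trans (cover_outer_sigma_subadditive bcp _) _.
apply: (@le_trans _ _ (\sum_(k <oo) (box_cost (B k) + ((e / 2) / (2 ^ k.+1)%:R)%:E))%E).
  apply: lee_nneseries => [k _ _|k _]; first exact: cover_outer_ge0.
  by have [] := hW k.
apply: le_trans (epsilon_trick _ _ (ltW e20)) _; first by move=> k; exact: bcp.
rewrite [in leRHS](splitr e) EFinD addeA; apply: leeD => //; exact: ltW.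
Qed.

End outer_regularity.

Section small_sets.
Context (disp : measure_display) (T : measurableType disp) (R : realType).
Context (mu : {measure set T -> \bar R}).
Hypothesis mu_fin : (mu setT < +oo)%E.

Lemma indic_L2 (A : set T) : measurable A -> L2 mu (\1_A : T -> R).
Proof.
move=> mA; apply: (@bounded_L2 _ _ _ _ mu_fin _ 1); first exact: measurable_indic.
by move=> x; rewrite indicE; case: (_ \in _); rewrite ?normr0 ?normr1.
Qed.

Lemma Rint_indic (A : set T) : measurable A -> \int[mu]_x (\1_A x : R) = fine (mu A).
Proof.
by move=> mA; rewrite /Rintegral integral_indic// setIT.
Qed.

(** Cauchy-Schwarz against the indicator function, for [g] and for its opposite. It makes integrals
    over sets of small measure small. *)
Lemma Rint_mul_indic_le (g : T -> R) (A : set T) : L2 mu g -> measurable A ->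
  `|\int[mu]_x (g x * \1_A x)| <= L2norm mu g * Num.sqrt (fine (mu A)).
Proof.
move=> g2 mA; have A2 := indic_L2 mA.
have nA : L2norm mu \1_A = Num.sqrt (fine (mu A)).
  rewrite sqrt_Rint_sqr -Rint_indic//; congr Num.sqrt.
  apply: eq_Rintegral => x _; rewrite indicE.
  by case: (_ \in _); rewrite ?expr0n// expr1n.
have h1 := L2_cauchy_schwarz g2 A2.
have h2 := L2_cauchy_schwarz (L2_Z (-1) g2) A2.
rewrite L2normZ// normrN1 mul1r in h2.
have h3 : \int[mu]_x (-1 * g x * \1_A x) = - \int[mu]_x (g x * \1_A x).
  transitivity (-1 * \int[mu]_x (g x * \1_A x)); last by rewrite mulN1r.
  rewrite -(RintZ _ (L2_mul g2 A2)).
  by apply: eq_Rintegral => x _; rewrite mulrA.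
rewrite h3 in h2; rewrite -nA ler_norml; apply/andP; split => //.
by rewrite lerNl.
Qed.

Lemma Rint_norm_eq0 (g : T -> R) : mu.-integrable setT (EFin \o g) ->
  \int[mu]_x `|g x| = 0 -> \forall x \ae mu, g x = 0.
Proof.
move=> g1 g0; have mg := L1_measurable g1.
have /ae_eq_integral_abs H : measurable_fun setT (EFin \o g) by exact/measurable_EFinP.
have I0 : (\int[mu]_x `|(EFin \o g) x|)%E = 0%E.
  have gf := integrable_fin_num measurableT (integrable_abse g1).
  by rewrite -[LHS]fineK//; congr EFin.
have /(_ measurableT)[+ _] := H mu.
move=> /(_ I0); apply: filterS => x /(_ I) /= /eqP.
by rewrite eqe => /eqP.
Qed.

(** The hypothesis on the sets where [g] is positive and where it is negative gives a zero integral
    for the absolute value of [g] on [Om]. *)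
Lemma Rint_sets_eq0 (Om : set T) (g : T -> R) : measurable Om -> mu (~` Om) = 0%E ->
  L2 mu g -> (forall A, measurable A -> A `<=` Om -> \int[mu]_x (g x * \1_A x) = 0) ->
  \forall x \ae mu, g x = 0.
Proof.
move=> mO O0 g2 gA.
have mg := L2_measurable g2.
pose P := Om `&` [set x | 0 < g x]; pose N := Om `&` [set x | g x < 0].
have mP : measurable P.
  apply: measurableI => //; rewrite -[X in measurable X]setTI.
  rewrite (_ : [set x | _] = g @^-1` `]0, +oo[%classic); first exact: mg.
  by apply/seteqP; split=> x /=; rewrite in_itv/= andbT.
have mN : measurable N.
  apply: measurableI => //; rewrite -[X in measurable X]setTI.
  rewrite (_ : [set x | _] = g @^-1` `]-oo, 0[%classic); first exact: mg.
  by apply/seteqP; split=> x /=; rewrite in_itv/=.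
have gO1 : mu.-integrable setT (EFin \o (fun x => g x * \1_Om x)).
  by apply: L2_mul => //; exact: indic_L2.
have E1 : \int[mu]_x `|g x * \1_Om x| = 0.
  transitivity (\int[mu]_x (g x * \1_P x + -1 * (g x * \1_N x))).
    apply: eq_Rintegral => x _; rewrite !indicE.
    have [xO|xO] := boolP (x \in Om); last first.
      have -> : x \in P = false by apply/negP => /set_mem[/mem_set]; rewrite (negbTE xO).
      have -> : x \in N = false by apply/negP => /set_mem[/mem_set]; rewrite (negbTE xO).
      by rewrite !mulr0 normr0 addr0.
    have [gx|gx|gx] := ltrgtP (g x) 0.
    - have -> : x \in P = false by apply/negP => /set_mem[_ /=]; rewrite ltNge ltW.
      have -> : x \in N by apply: mem_set; split => //; exact: set_mem.
      by rewrite !mulr1 mulr0 add0r mulN1r ltr0_norm.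
    - have -> : x \in N = false by apply/negP => /set_mem[_ /=]; rewrite ltNge ltW.
      have -> : x \in P by apply: mem_set; split => //; exact: set_mem.
      by rewrite !mulr1 !mulr0 addr0 gtr0_norm.
    - by rewrite gx !mul0r normr0 mulr0 addr0.
  have iP := L2_mul g2 (indic_L2 mP); have iN := L2_mul g2 (indic_L2 mN).
  by rewrite RintD//; [rewrite RintZ// !gA ?mulr0 ?addr0//; by move=> x []|exact: L1Z].
have ae1 := Rint_norm_eq0 gO1 E1.
have ae2 : \forall x \ae mu, Om x.
  by exists (~` Om); split => //; exact: measurableC.
apply: filterS2 ae1 ae2 => x + Ox.
by rewrite indicE mem_set// mulr1.
Qed.

End small_sets.

Section fundamental_lemma.
Context (R : realType) (d : nat) (Omega : set 'rV[R]_d).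
Local Notation E := 'rV[R]_d.
Hypotheses (d0 : (0 < d)%N) (Omega_open : open Omega) (Omega_bd : bounded_set Omega).

(* As [n] grows with [k = n], this converges to the indicator function of the
   union of the open boxes with corners [a j] and [b j]. *)
Let union_bump (a b : nat -> E) k n (x : E) : R :=
  1 - \prod_(j < k) (1 - bump (a j) (b j) n x).

Let factor01 (a b : E) n x : 0 <= 1 - bump a b n x <= 1.
Proof. by rewrite subr_ge0 bump_le1 lerBlDr lerDl bump_ge0. Qed.

Lemma test_function_union_bump (a b : nat -> E) k n :
  (forall j, box (a j) (b j) `<=` Omega) -> test_function Omega (union_bump a b k n).
Proof.
move=> abO; elim: k => [|k IH].
  apply: (@test_functionI _ _ _ _ set0) => //; last 2 first.
  - exact: compact0.
  - by move=> x /=; rewrite /union_bump big_ord0 subrr eqxx.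
  rewrite (_ : union_bump a b 0 n = fun=> 0); first exact: smooth_cst.
  by apply/funext => x; rewrite /union_bump big_ord0 subrr.
(* Splitting off the last factor shows each stage to be a test function plus a smooth multiple of a
   bump. *)
rewrite (_ : union_bump a b k.+1 n = fun x => union_bump a b k n x +
   (1 + -1 * union_bump a b k n x) * bump (a k) (b k) n x).
  have [sU _ _] := IH.
  apply: test_functionD => //; apply: test_functionMl; last exact: test_function_bump.
  by apply: smoothD; [exact: smooth_cst|exact: smoothZ].
by apply/funext => x; rewrite /union_bump big_ord_recr/=; ring.
Qed.

(** Outside [V] all bumps vanish. At a point of the open box [j], the function [union_bump a b n n]
    lies between bump [j] and [1] as soon as [n > j]. So these test functions tend to the indicator
    of [V], and [g] dominates. *)
Lemma Rint_open_eq0 (g : E -> R) (V : set E) : L2 (dx Omega) g ->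
  (forall phi, test_function Omega phi -> \int[dx Omega]_x (g x * phi x) = 0) ->
  open V -> V `<=` Omega -> \int[dx Omega]_x (g x * \1_V x) = 0.
Proof.
move=> g2 gphi Vo VO.
have [a [b [abV VE]]] := open_bigcup_box d0 Vo.
have abO j : box (a j) (b j) `<=` Omega by apply: subset_trans VO; exact: abV.
have fin := dx_finite Omega_bd.
have mg := L2_measurable g2.
have mV : (dx_outer Omega).-cara.-measurable V.
  by apply: open_cara_measurable => // i c; exact: dx_outer_halfspace.
have mU n : measurable_fun setT
    (union_bump a b n n : caratheodory_type (dx_outer Omega) -> R).
  apply: continuous_dx_measurable => //; apply: smooth_continuous.
  by have [] := @test_function_union_bump a b n n abO.
have U01 n x : 0 <= union_bump a b n n x <= 1.
  have p0 : 0 <= \prod_(j < n) (1 - bump (a j) (b j) n x).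
    by apply: prodr_ge0 => j _; have /andP[] := factor01 (a j) (b j) n x.
  have p1 : \prod_(j < n) (1 - bump (a j) (b j) n x) <= 1.
    by apply: prodr_ile1 => j _; exact: factor01.
  by rewrite /union_bump subr_ge0 p1 lerBlDr lerDl p0.
have Ucvg x : union_bump a b n n x @[n --> \oo] --> (\1_V x : R).
  rewrite indicE; have [xV|xV] := boolP (x \in V); last first.
    rewrite (_ : (fun n => _) = fun=> 0); first exact: cvg_cst.
    apply/funext => n; rewrite /union_bump big1 ?subrr// => j _.
    rewrite bump_out ?subr0// => ox; move/negP: xV; apply.
    by apply: mem_set; rewrite VE; exists j.
  have := set_mem xV; rewrite VE => -[j _ ox].
  apply: (@squeeze_cvgr _ _ _ _ (bump (a j) (b j) ^~ x) (fun=> 1)).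
  - exists j.+1 => // n /= jn; have /andP[_ ->] := U01 n x; rewrite andbT.
    rewrite /union_bump (bigD1 (Ordinal jn))//=.
    have := @prodr_ile1 R 'I_n (index_enum _) (fun i => i != Ordinal jn)
      (fun i => 1 - bump (a i) (b i) n x) (fun i _ => factor01 _ _ _ _).
    have := @prodr_ge0 R 'I_n (index_enum _) (fun i => i != Ordinal jn)
      (fun i => 1 - bump (a i) (b i) n x) (fun i _ => (andP (factor01 _ _ _ _)).1).
    have := bump_le1 (a j) (b j) n x.
    move: (\prod_(_ < _ | _) _) => p; nra.
  - exact: bump_cvg.
  - exact: cvg_cst.
have iV : measurable_fun setT (\1_V : caratheodory_type (dx_outer Omega) -> R).
  exact: measurable_indic.
have g1 : (dx Omega).-integrable setT (EFin \o g).
  have := L2_mul g2 (@indic_L2 _ _ _ _ fin setT measurableT).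
  by apply: eq_integrable => // x _ /=; rewrite indicT/= mulr1.
have h : \int[dx Omega]_x (g x * union_bump a b n n x) @[n --> \oo] -->
    \int[dx Omega]_x (g x * \1_V x).
  apply: (@dominated_Rint_cvg _ _ _ (dx Omega) (fun n x => g x * union_bump a b n n x)
     (fun x => g x * \1_V x) (fun x => `|g x|)).
  - by move=> n; exact: measurable_funM.
  - exact: measurable_funM.
  - exact: integrable_norm.
  - move=> n x; rewrite normrM ler_piMr//.
    by have /andP[u0 u1] := U01 n x; rewrite ger0_norm.
  - by move=> x; apply: cvgMr; exact: Ucvg.
have E0 n : \int[dx Omega]_x (g x * union_bump a b n n x) = 0.
  by apply: gphi; exact: test_function_union_bump.
move: h; under eq_fun do rewrite E0.
by move=> h; apply: (cvg_unique _ h); [exact: norm_hausdorff|exact: cvg_cst].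
Qed.

(** Outer regularity puts a measurable [A] inside an open [V] of nearly the same measure. The
    integral of [g] over [V] is [0], so that over [A] is the opposite of the one over the small set
    left. *)
Lemma fundamental_lemma (g : E -> R) : L2 (dx Omega) g ->
  (forall phi, test_function Omega phi -> \int[dx Omega]_x (g x * phi x) = 0) ->
  \forall x \ae dx Omega, g x = 0.
Proof.
move=> g2 gphi.
have fin := dx_finite Omega_bd.
have hs := @dx_outer_halfspace R d Omega.
have mO : (dx_outer Omega).-cara.-measurable Omega := open_cara_measurable d0 hs Omega_open.
apply: (@Rint_sets_eq0 _ _ _ _ fin Omega) => //.
  by rewrite /dx/= /cara_measure/= /dx_outer setICl; apply: cover_outer0;
     [exact: box_cost0|exact: box_cost_ge0].
move=> A mA AO.
have dxE (X : set E) : X `<=` Omega -> dx Omega X = lebesgue_outer X.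
  by move=> XO; rewrite /dx/= /cara_measure/= /dx_outer setIidl.
have Afin : (lebesgue_outer A < +oo)%E.
  rewrite -dxE//; apply: le_lt_trans fin.
  exact: (@le_measure _ _ _ (dx Omega) A setT (mem_set mA) (mem_set measurableT)).
apply/eqP; rewrite -normr_eq0 eq_le normr_ge0 andbT.
pose N := L2norm (dx Omega) g.
have N0 : 0 <= N by exact: L2norm_ge0.
apply/ler_addgt0Pr => e e0; rewrite add0r.
(* The square offsets the square root in [Rint_mul_indic_le], and the added [1] covers the case
   [N = 0]. *)
pose eta := (e / (N + 1)) ^+ 2.
have N1 : 0 < N + 1 by rewrite ltr_wpDl.
have eta0 : 0 < eta by rewrite exprn_gt0// divr_gt0.
have [W [Wo AsW leW]] := lebesgue_outer_open eta0 Afin.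
pose V := W `&` Omega.
have Vo : open V by exact: openI.
have VO : V `<=` Omega by move=> x [].
have AV : A `<=` V by move=> x Ax; split; [exact: AsW|exact: AO].
have mV : (dx_outer Omega).-cara.-measurable V := open_cara_measurable d0 hs Vo.
have mVA : (dx_outer Omega).-cara.-measurable (V `\` A) by exact: measurableD.
have V0 := Rint_open_eq0 g2 gphi Vo VO.
have iA := L2_mul g2 (indic_L2 fin mA); have iVA := L2_mul g2 (indic_L2 fin mVA).
have split1 : \int[dx Omega]_x (g x * \1_V x) =
    \int[dx Omega]_x (g x * \1_A x) + \int[dx Omega]_x (g x * \1_(V `\` A) x).
  rewrite -(RintD iA iVA); apply: eq_Rintegral => x _.
  rewrite -mulrDr !indicE; congr (_ * _).
  have [xA|xA] := boolP (x \in A).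
    have -> : x \in V by apply/mem_set/AV/set_mem.
    have -> : x \in V `\` A = false by apply/negP => /set_mem[_]; apply; exact: set_mem.
    by rewrite addr0.
  have -> : (x \in V `\` A) = (x \in V).
    apply/idP/idP => [/set_mem[/mem_set]//|/set_mem xV]; apply: mem_set; split => //.
    by move=> /mem_set; apply/negP.
  by rewrite add0r.
have -> : \int[dx Omega]_x (g x * \1_A x) = - \int[dx Omega]_x (g x * \1_(V `\` A) x).
  by apply/eqP; rewrite -addr_eq0 -split1 V0.
rewrite normrN; apply: le_trans (Rint_mul_indic_le fin g2 mVA) _.
have muVA : (dx Omega (V `\` A) <= eta%:E)%E.
  have AE : dx Omega A = lebesgue_outer A by exact: dxE.
  have Afn : dx Omega A \is a fin_num by rewrite ge0_fin_numE; [rewrite AE|exact: measure_ge0].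
  have addVA : dx Omega V = (dx Omega A + dx Omega (V `\` A))%E.
    rewrite -measureU//; [by rewrite setDUK|by rewrite setDIK].
  rewrite -(@leeD2lE _ _ _ _ Afn) -addVA AE dxE//; apply: le_trans leW.
  by apply: le_cover_outer => x [].
have s1 : Num.sqrt (fine (dx Omega (V `\` A))) <= e / (N + 1).
  have -> : e / (N + 1) = Num.sqrt eta.
    by rewrite sqrtr_sqr ger0_norm// divr_ge0// ltW.
  rewrite ler_wsqrtr// -lee_fin fineK//.
  rewrite ge0_fin_numE ?measure_ge0//; exact: le_lt_trans muVA (ltry _).
apply: (@le_trans _ _ (N * (e / (N + 1)))); first by rewrite ler_wpM2l.
rewrite mulrA ler_pdivrMr// mulrC ler_wpM2l// ?ltW//; lra.
Qed.

End fundamental_lemma.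

(** * Weak derivatives and traces *)

Lemma lin_rearr (R : comNzRingType) (c a b a' b' : R) :
  c * a + b + (c * a' + b') = c * (a + a') + (b + b').
Proof. by rewrite mulrDr addrACA. Qed.

Section almost_everywhere.
Context (disp : measure_display) (T : measurableType disp) (R : realType).
Context (mu : {measure set T -> \bar R}).

Lemma ae_imp (P Q : T -> Prop) : (forall x, P x -> Q x) ->
  (\forall x \ae mu, P x) -> (\forall x \ae mu, Q x).
Proof. by move=> PQ; apply: filterS. Qed.

Lemma ae_imp2 (P1 P2 Q : T -> Prop) : (forall x, P1 x -> P2 x -> Q x) ->
  (\forall x \ae mu, P1 x) -> (\forall x \ae mu, P2 x) -> (\forall x \ae mu, Q x).
Proof. by move=> PQ; apply: filterS2. Qed.

Lemma ae_forall_ord n (P : 'I_n -> T -> Prop) : (forall i, \forall x \ae mu, P i x) ->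
  \forall x \ae mu, forall i, P i x.
Proof. by move=> H; apply: filter_forall. Qed.

Lemma ae_forall_nat (P : nat -> T -> Prop) : (forall i, \forall x \ae mu, P i x) ->
  \forall x \ae mu, forall i, P i x.
Proof. by move=> H; apply/ae_foralln. Qed.

Lemma ae_all (P : T -> Prop) : (forall x, P x) -> \forall x \ae mu, P x.
Proof. exact: aeW. Qed.

Lemma ae_subr_eq0 (g h : T -> R) :
  (\forall x \ae mu, -1 * h x + g x = 0) -> \forall x \ae mu, g x = h x.
Proof.
apply: ae_imp => x; rewrite mulN1r addrC => /eqP.
by rewrite subr_eq0 => /eqP.
Qed.

Lemma Rint_mul_eq (g h phi : T -> R) : L2 mu g -> L2 mu h -> L2 mu phi ->
  \int[mu]_x (g x * phi x) = \int[mu]_x (h x * phi x) ->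
  \int[mu]_x ((-1 * h x + g x) * phi x) = 0.
Proof.
move=> g2 h2 phi2 E.
have ig := L2_mul g2 phi2; have ih := L2_mul h2 phi2.
transitivity (\int[mu]_x (-1 * (h x * phi x) + g x * phi x)).
  by apply: eq_Rintegral => x _; ring.
by rewrite (RintD (L1Z (-1) ih) ig) (RintZ (-1) ih) E mulN1r addNr.
Qed.

Lemma Rint_mull_lin c (f g h : T -> R) : L2 mu f -> L2 mu g -> L2 mu h ->
  \int[mu]_x ((c * f x + g x) * h x) =
  c * \int[mu]_x (f x * h x) + \int[mu]_x (g x * h x).
Proof.
move=> f2 g2 h2; have i1 := L2_mul f2 h2; have i2 := L2_mul g2 h2.
rewrite -(RintZ c i1) -(RintD (L1Z c i1) i2).
by apply: eq_Rintegral => x _; ring.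
Qed.

Lemma Rint_mulr_lin c (f g h : T -> R) : L2 mu f -> L2 mu g -> L2 mu h ->
  \int[mu]_x (h x * (c * f x + g x)) =
  c * \int[mu]_x (h x * f x) + \int[mu]_x (h x * g x).
Proof.
move=> f2 g2 h2; have i1 := L2_mul h2 f2; have i2 := L2_mul h2 g2.
rewrite -(RintZ c i1) -(RintD (L1Z c i1) i2).
by apply: eq_Rintegral => x _; ring.
Qed.

Lemma Rint_dotv_linr n c (F G H : T -> 'rV[R]_n) : L2v mu F -> L2v mu G -> L2v mu H ->
  \int[mu]_x dotv (H x) (c *: F x + G x) =
  c * \int[mu]_x dotv (H x) (F x) + \int[mu]_x dotv (H x) (G x).
Proof.
move=> f2 g2 h2; have i1 := L1_dotv h2 f2; have i2 := L1_dotv h2 g2.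
rewrite -(RintZ c i1) -(RintD (L1Z c i1) i2).
by apply: eq_Rintegral => x _; rewrite dotv_linr.
Qed.

Lemma L2norm_lin_le c (f g : T -> R) : L2 mu f -> L2 mu g ->
  L2norm mu (fun x => c * f x + g x) <= `|c| * L2norm mu f + L2norm mu g.
Proof. by move=> f2 g2; rewrite -L2normZ//; exact: (L2normD (L2_Z c f2) g2). Qed.

Lemma L2vnorm_lin_le n c (F G : T -> 'rV[R]_n) : L2v mu F -> L2v mu G ->
  L2vnorm mu (fun x => c *: F x + G x) <= `|c| * L2vnorm mu F + L2vnorm mu G.
Proof. by move=> f2 g2; rewrite -L2vnormZ//; exact: (L2vnormD (L2v_Z c f2) g2). Qed.

(** Chosen weak gradients are linear only off a null set, so limits must be replaceable almost
    everywhere. *)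
Lemma L2_cvg_ae (f_ : (T -> R)^nat) (f f' : T -> R) :
  (forall n, measurable_fun setT (f_ n)) -> measurable_fun setT f ->
  measurable_fun setT f' -> (\forall x \ae mu, f x = f' x) ->
  L2_cvg mu f_ f -> L2_cvg mu f_ f'.
Proof.
move=> mf_ mf mf' ff'; rewrite /L2_cvg.
suff E n : ('N[mu]_2%:E[EFin \o (f_ n \- f)%R] = 'N[mu]_2%:E[EFin \o (f_ n \- f')%R])%E.
  by under eq_fun do rewrite E.
have m1 (h : T -> R) : measurable_fun setT h ->
    measurable_fun setT (fun x => (`|(EFin \o (f_ n \- h)%R) x| `^ 2)%E).
  move=> mh; apply: (measurableT_comp (measurable_poweR 2)).
  by apply: measurableT_comp => //; apply/measurable_EFinP; exact: measurable_funB.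
suff H : (\int[mu]_x (`|(EFin \o (f_ n \- f)%R) x| `^ 2) =
    \int[mu]_x (`|(EFin \o (f_ n \- f')%R) x| `^ 2))%E by rewrite !Lnorm.unlock H.
apply: ge0_ae_eq_integral => //.
- exact: m1.
- exact: m1.
- by move=> x _; exact: poweR_ge0.
- by move=> x _; exact: poweR_ge0.
- by apply: filterS ff' => x /= -> _.
Qed.

Lemma L2_cvg_cst (f f' : T -> R) : measurable_fun setT f -> measurable_fun setT f' ->
  (\forall x \ae mu, f x = f' x) -> L2_cvg mu (fun=> f) f'.
Proof.
move=> mf mf' ff'; apply: (@L2_cvg_ae _ f) => //; rewrite /L2_cvg.
rewrite (_ : (fun _ => _) = fun=> 0%E); first exact: cvg_cst.
apply/funext => n; rewrite (_ : EFin \o _ = cst 0%E); first exact: Lnorm0.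
by apply/funext => x /=; rewrite subrr.
Qed.

End almost_everywhere.

Lemma ae_dS_boundary (R : realType) (d : nat) (Omega : set 'rV[R]_d) :
  (0 < d)%N -> \forall x \ae dS Omega, boundary Omega x.
Proof.
move=> d0.
exists (~` boundary Omega); split => //.
  have hs := @dS_outer_halfspace R d Omega.
  rewrite /boundary setDE setCI setCK; apply: measurableU.
    by apply: open_cara_measurable => //; apply: closed_openC; exact: closed_closure.
  by apply: open_cara_measurable => //; exact: open_interior.
by rewrite /dS/= /cara_measure/= /dS_outer setICl hausdorff_outer0.
Qed.

#[local] Opaque dx dS dx_outer dS_outer.

Section weak_derivatives.
Context (R : realType) (d : nat) (Omega : set 'rV[R]_d).
Local Notation E := 'rV[R]_d.
Local Notation dx := (dx Omega).
Local Notation dS := (dS Omega).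
Hypotheses (d0 : (0 < d)%N) (Omega_open : open Omega) (Omega_bd : bounded_set Omega).

Let tL2 f (tf : test_function Omega f) : L2 dx f := test_function_L2 d0 Omega_bd tf.

Let tpL2 f i (tf : test_function Omega f) : L2 dx (partial i f) :=
  tL2 (test_function_partial i tf).

(** In each coordinate the difference integrates to [0] against every test function. *)
Lemma weak_grad_unique (v : E -> R) (g h : E -> E) :
  is_weak_grad Omega v g -> is_weak_grad Omega v h -> \forall x \ae dx, g x = h x.
Proof.
move=> [g2 gv] [h2 hv].
have gh i : \forall x \ae dx, g x 0 i = h x 0 i.
  apply: ae_subr_eq0; apply: (fundamental_lemma d0 Omega_open Omega_bd (L2_lin (-1) (h2 i) (g2 i))).
  move=> phi tphi; apply: (Rint_mul_eq (g2 i) (h2 i) (tL2 tphi)).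
  by apply: oppr_inj; rewrite -(gv _ tphi) -(hv _ tphi).
apply: (ae_imp _ (ae_forall_ord gh)) => x e.
by apply/rowP => i.
Qed.

Lemma wgradP v : H1 Omega v -> is_weak_grad Omega v (wgrad Omega v).
Proof. by move=> [_ [g gv]]; exact: (xgetPex (cst 0) (ex_intro _ g gv)). Qed.

Lemma wgrad_L2 v : H1 Omega v -> L2v dx (wgrad Omega v).
Proof. by move=> /wgradP[]. Qed.

Lemma weak_grad_lin c v w g h : L2 dx v -> L2 dx w ->
  is_weak_grad Omega v g -> is_weak_grad Omega w h ->
  is_weak_grad Omega (fun x => c * v x + w x) (fun x => c *: g x + h x).
Proof.
move=> v2 w2 [g2 gv] [h2 hw]; split; first exact: L2v_lin.
move=> phi tphi i.
rewrite (Rint_mull_lin c v2 w2 (tpL2 i tphi)) (gv _ tphi) (hw _ tphi) mulrN -opprD; congr (- _).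
rewrite -(Rint_mull_lin c (g2 i) (h2 i) (tL2 tphi)).
by apply: eq_Rintegral => x _; rewrite !mxE.
Qed.

Lemma H1_lin c v w : H1 Omega v -> H1 Omega w -> H1 Omega (fun x => c * v x + w x).
Proof.
move=> Hv Hw; have [v2 _] := Hv; have [w2 _] := Hw; split; first exact: L2_lin.
by eexists; apply: weak_grad_lin => //; exact: wgradP.
Qed.

Lemma wgrad_lin c v w : H1 Omega v -> H1 Omega w ->
  \forall x \ae dx, wgrad Omega (fun x => c * v x + w x) x =
    c *: wgrad Omega v x + wgrad Omega w x.
Proof.
move=> Hv Hw; have [v2 _] := Hv; have [w2 _] := Hw.
apply: (@weak_grad_unique (fun x => c * v x + w x)); first exact/wgradP/H1_lin.
by apply: weak_grad_lin => //; exact: wgradP.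
Qed.

Lemma H1_test phi : test_function Omega phi -> H1 Omega phi.
Proof.
move=> tphi; split; first exact: tL2.
by exists (grad phi); exact: test_function_weak_grad.
Qed.

Lemma wgrad_test phi : test_function Omega phi ->
  \forall x \ae dx, wgrad Omega phi x = grad phi x.
Proof.
move=> tphi; apply: (@weak_grad_unique phi); first exact/wgradP/H1_test.
exact: test_function_weak_grad.
Qed.

Lemma weak_div_unique (psi : E -> E) (g h : E -> R) :
  is_weak_div Omega psi g -> is_weak_div Omega psi h -> \forall x \ae dx, g x = h x.
Proof.
move=> [g2 gv] [h2 hv].
apply: ae_subr_eq0; apply: (fundamental_lemma d0 Omega_open Omega_bd (L2_lin (-1) h2 g2)).
move=> phi tphi; apply: (Rint_mul_eq g2 h2 (tL2 tphi)).
by apply: oppr_inj; rewrite -(gv _ tphi) -(hv _ tphi).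
Qed.

Lemma wdiv_ae (psi : E -> E) (g : E -> R) : is_weak_div Omega psi g ->
  L2 dx (wdiv Omega psi) /\ \forall x \ae dx, wdiv Omega psi x = g x.
Proof.
move=> pg; have : is_weak_div Omega psi (wdiv Omega psi).
  exact: (xgetPex (cst 0) (ex_intro _ g pg)).
by move=> pw; have [] := pw; split => //; exact: weak_div_unique pw pg.
Qed.

Let mdx (f : E -> R) (sf : smooth f) :
    measurable_fun setT (f : caratheodory_type (dx_outer Omega) -> R) :=
  continuous_dx_measurable d0 (smooth_continuous sf).
Let mdS (f : E -> R) (sf : smooth f) :
    measurable_fun setT (f : caratheodory_type (dS_outer Omega) -> R) :=
  continuous_dS_measurable d0 (smooth_continuous sf).

Lemma is_trace_lin c v w g h : is_trace Omega v g -> is_trace Omega w h ->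
  is_trace Omega (fun x => c * v x + w x) (fun x => c * g x + h x).
Proof.
move=> [Hv g2 [p [sp pv pgv pg]]] [Hw h2 [q [sq qw qgw qh]]].
have [v2 _] := Hv; have [w2 _] := Hw.
split; [exact: H1_lin|exact: L2_lin|].
exists (fun n x => c * p n x + q n x); split.
- by move=> n; apply: smoothD => //; exact: smoothZ.
- exact: (L2_cvg_lin c (fun n => mdx (sp n)) (L2_measurable v2)
    (fun n => mdx (sq n)) (L2_measurable w2) pv qw).
- move=> i; have mp n := mdx (smooth_partial i (sp n)).
  have mq n := mdx (smooth_partial i (sq n)).
  have Hg := wgrad_L2 Hv; have Hh := wgrad_L2 Hw; have Hgh := wgrad_L2 (H1_lin c Hv Hw).
  rewrite (_ : (fun n => _) = fun n x => c * partial i (p n) x + partial i (q n) x); last first.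
    by apply/funext => n; rewrite partial_lin.
  have mpq n : measurable_fun setT ((fun x => c * partial i (p n) x + partial i (q n) x)
      : caratheodory_type (dx_outer Omega) -> R).
    apply: measurable_funD; last exact: mq.
    exact: (measurable_funM (measurable_cst c) (mp n)).
  have aeE : \forall x \ae dx, c * wgrad Omega v x 0 i + wgrad Omega w x 0 i =
      wgrad Omega (fun x => c * v x + w x) x 0 i.
    by apply: (ae_imp _ (wgrad_lin c Hv Hw)) => x ->; rewrite !mxE.
  apply: (L2_cvg_ae mpq (L2_measurable (L2_lin c (Hg i) (Hh i))) (L2_measurable (Hgh i)) aeE).
  exact: (L2_cvg_lin c mp (L2_measurable (Hg i)) mq (L2_measurable (Hh i)) (pgv i) (qgw i)).
- exact: (L2_cvg_lin c (fun n => mdS (sp n)) (L2_measurable g2)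
    (fun n => mdS (sq n)) (L2_measurable h2) pg qh).
Qed.

Lemma is_trace_ae v g g' : L2 dS g' -> (\forall x \ae dS, g x = g' x) ->
  is_trace Omega v g -> is_trace Omega v g'.
Proof.
move=> g'2 gg' [Hv g2 [p [sp pv pgv pg]]]; split => //; exists p; split => //.
exact: (L2_cvg_ae (fun n => mdS (sp n)) (L2_measurable g2) (L2_measurable g'2) gg' pg).
Qed.

(** The constant sequence [phi] approximates itself. Since [Omega] is open it misses its boundary,
    so [phi] vanishes there. *)
Lemma is_trace_test phi : test_function Omega phi -> is_trace Omega phi (fun=> 0).
Proof.
move=> tphi; have [sphi _ KO] := tphi.
have m0 : L2 dS (fun=> 0) by exact: L2_0.
split; [exact: H1_test|exact: m0|].
exists (fun=> phi); split => //.
- exact: (L2_cvg_cst (mdx sphi) (mdx sphi) (ae_all _ (fun=> erefl))).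
- move=> i; apply: (L2_cvg_cst (mdx (smooth_partial i sphi))
    (L2_measurable (wgrad_L2 (H1_test tphi) i))).
  by apply: (ae_imp _ (wgrad_test tphi)) => x ->; rewrite mxE.
- apply: (L2_cvg_cst (mdS sphi) (L2_measurable m0)).
  apply: (ae_imp _ (ae_dS_boundary Omega d0)) => x [_ bx].
  apply/eqP/negPn/negP => px; apply: bx.
  move: Omega_open; rewrite openE; apply; apply: KO; exact: subset_closure.
Qed.

Lemma is_trace0 : is_trace Omega (fun=> 0) (fun=> 0).
Proof.
apply: is_trace_test; apply: (@test_functionI _ _ _ _ set0) => //.
- exact: smooth_cst.
- exact: compact0.
- by move=> x /=; rewrite eqxx.
Qed.

(** The sum of the two norms dominates the Euclidean combination in [H1norm] and is easier to follow
    through linear combinations of liftings. *)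
Lemma H12norm_le w g : is_trace Omega w g ->
  H12norm Omega g <= L2norm dx w + L2vnorm dx (wgrad Omega w).
Proof.
move=> tw; apply: (@le_trans _ _ (H1norm Omega w)).
  apply: ge_inf; last by exists w.
  by exists 0 => _ [w' _ <-]; exact: sqrtr_ge0.
rewrite /H1norm; have a0 := L2norm_ge0 dx w; have b0 := L2vnorm_ge0 dx (wgrad Omega w).
rewrite -[leRHS]ger0_norm ?addr_ge0// -sqrtr_sqr ler_wsqrtr//.
rewrite sqrrD addrAC lerDl mulrn_wge0// mulr_ge0//.
Qed.

Lemma H12norm_ge0 g : 0 <= H12norm Omega g.
Proof.
rewrite /H12norm; set S := (X in inf X).
have [S0|S0] := pselect (S !=set0).
  by apply: lb_le_inf => // _ [w' _ <-]; exact: sqrtr_ge0.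
have -> : S = set0 by apply/eqP/negPn/negP => /set0P.
by rewrite inf0.
Qed.

Lemma trace_norm_lin c v w g h : is_trace Omega v g -> is_trace Omega w h ->
  L2norm dx (fun x => c * v x + w x)
    + L2vnorm dx (wgrad Omega (fun x => c * v x + w x))
  <= `|c| * (L2norm dx v + L2vnorm dx (wgrad Omega v))
     + (L2norm dx w + L2vnorm dx (wgrad Omega w)).
Proof.
move=> [Hv _ _] [Hw _ _]; have [v2 _] := Hv; have [w2 _] := Hw.
have Hg := wgrad_L2 Hv; have Hh := wgrad_L2 Hw; have Hgh := wgrad_L2 (H1_lin c Hv Hw).
rewrite (ae_eq_L2vnorm Hgh (L2v_lin c Hg Hh) (wgrad_lin c Hv Hw)).
rewrite -lin_rearr.
exact: lerD (L2norm_lin_le c v2 w2) (L2vnorm_lin_le c Hg Hh).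
Qed.

Lemma normal_trace_functional_lin psi c v w g h : L2v dx psi -> L2 dx (wdiv Omega psi) ->
  is_trace Omega v g -> is_trace Omega w h ->
  \int[dx]_x dotv (psi x) (wgrad Omega (fun x => c * v x + w x) x)
    + \int[dx]_x (wdiv Omega psi x * (c * v x + w x)) =
  c * (\int[dx]_x dotv (psi x) (wgrad Omega v x) + \int[dx]_x (wdiv Omega psi x * v x))
  + (\int[dx]_x dotv (psi x) (wgrad Omega w x) + \int[dx]_x (wdiv Omega psi x * w x)).
Proof.
move=> p2 dp2 [Hv _ _] [Hw _ _]; have [v2 _] := Hv; have [w2 _] := Hw.
have Hg := wgrad_L2 Hv; have Hh := wgrad_L2 Hw; have Hgh := wgrad_L2 (H1_lin c Hv Hw).
rewrite (ae_eq_Rint_dotv p2 p2 Hgh (L2v_lin c Hg Hh) (ae_all _ (fun=> erefl)) (wgrad_lin c Hv Hw)).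
rewrite -lin_rearr; exact: (congr2 _ (Rint_dotv_linr c Hg Hh p2) (Rint_mulr_lin c v2 w2 dp2)).
Qed.

End weak_derivatives.

(** * The diffusion operator *)

Section diffusion_operator.
Context (disp : measure_display) (T : measurableType disp) (R : realType).
Context (mu : {measure set T -> \bar R}) (d : nat).
Context (Lam : T -> 'M[R]_d) (lo hi : R).
Hypotheses (lo_gt0 : 0 < lo) (hi_gt0 : 0 < hi).
Hypothesis Lam_measurable : forall i j, measurable_fun setT (fun x => Lam x i j).
Hypothesis Lam_ae : \forall x \ae mu, (Lam x)^T = Lam x /\
  forall m, eigenvalue (Lam x) m -> lo <= m <= hi.
Implicit Types F G : T -> 'rV[R]_d.

Let LF F := fun x => mulmxv (Lam x) (F x).

Lemma measurable_sum_fun (I : Type) (s : seq I) (h : I -> T -> R) :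
  (forall i, measurable_fun setT (h i)) -> measurable_fun setT (fun x => \sum_(i <- s) h i x).
Proof.
move=> mh; elim: s => [|i s IH].
  by under eq_fun do rewrite big_nil; exact: measurable_cst.
by under eq_fun do rewrite big_cons; exact: measurable_funD.
Qed.

(** The difference [g - f] agrees almost everywhere with its absolute value, whose integral is
    nonnegative. *)
Lemma ae_le_Rint (f g : T -> R) : mu.-integrable setT (EFin \o f) ->
  mu.-integrable setT (EFin \o g) -> (\forall x \ae mu, f x <= g x) ->
  \int[mu]_x f x <= \int[mu]_x g x.
Proof.
move=> f1 g1 fg; have gf1 := L1D (L1Z (-1) f1) g1.
have E : \int[mu]_x (-1 * f x + g x) = \int[mu]_x `|-1 * f x + g x|.
  have m1 := L1_measurable gf1.
  apply: ae_eq_Rint => //; first exact: measurableT_comp.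
  by apply: filterS fg => x fg; rewrite ger0_norm// mulN1r addrC subr_ge0.
have : 0 <= \int[mu]_x (-1 * f x + g x) by rewrite E; exact: Rintegral_ge0.
by rewrite (RintD (L1Z (-1) f1) g1) (RintZ (-1) f1) mulN1r addrC subr_ge0.
Qed.

Lemma diffusion_L2 F : L2v mu F -> L2v mu (LF F).
Proof.
move=> F2 i.
have m1 : measurable_fun setT (fun x => LF F x 0 i).
  rewrite (_ : (fun x => _) = fun x => \sum_j F x 0 j * Lam x i j).
    by apply: measurable_sum_fun => j; apply: measurable_funM => //; exact: L2_measurable.
  by apply/funext => x; rewrite /LF /mulmxv mxE; apply: eq_bigr => j _; rewrite mxE.
apply/L2P; split => //.
apply: (ae_le_L1 (measurable_funX 2 m1) (L1Z (hi ^+ 2) (L1_dotv F2 F2))).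
apply: filterS Lam_ae => x [sx ex]; rewrite ger0_norm ?sqr_ge0//.
apply: le_trans (symmetric_norm_bound sx (ltW lo_gt0) ex (F x)).
rewrite -enorm_sqr -real_normK ?num_real// lerXn2r ?nnegrE ?sqrtr_ge0//.
exact: coord_le_enorm.
Qed.

Lemma diffusion_norm F : L2v mu F -> L2vnorm mu (LF F) <= hi * L2vnorm mu F.
Proof.
move=> F2; have LF2 := diffusion_L2 F2.
have -> : hi = Num.sqrt (hi ^+ 2) by rewrite sqrtr_sqr gtr0_norm.
rewrite !L2vnormE -sqrtrM ?sqr_ge0// ler_wsqrtr//.
rewrite -(RintZ _ (L1_dotv F2 F2)).
apply: ae_le_Rint; [exact: L1_dotv|exact/L1Z/L1_dotv|].
apply: filterS Lam_ae => x [sx ex].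
exact: symmetric_norm_bound sx (ltW lo_gt0) ex (F x).
Qed.

Lemma diffusion_coercive F : L2v mu F ->
  lo * L2vnorm mu F ^+ 2 <= \int[mu]_x dotv (LF F x) (F x).
Proof.
move=> F2; have LF2 := diffusion_L2 F2.
rewrite L2vnorm_sqr -(RintZ _ (L1_dotv F2 F2)).
apply: ae_le_Rint; [exact/L1Z/L1_dotv|exact: L1_dotv|].
apply: filterS Lam_ae => x [sx ex].
by have /andP[] := symmetric_quadratic_bounds sx ex (F x).
Qed.

Lemma diffusion_sym F G : L2v mu F -> L2v mu G ->
  \int[mu]_x dotv (LF F x) (G x) = \int[mu]_x dotv (LF G x) (F x).
Proof.
move=> F2 G2; apply: ae_eq_Rint.
- exact: L1_measurable (L1_dotv (diffusion_L2 F2) G2).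
- exact: L1_measurable (L1_dotv (diffusion_L2 G2) F2).
- by apply: filterS Lam_ae => x [sx _]; rewrite /LF mulmxv_sym// dotvC.
Qed.

(** The left side is the diffusion form at [F - G] and [H]. It will compare the continuous flux with
    the discrete one, [H] being the discrete gradient of the error [u - v]. *)
Lemma diffusion_Rint_bound F G H : L2v mu F -> L2v mu G -> L2v mu H ->
  \int[mu]_x dotv (H x) (LF F x) - \int[mu]_x dotv (LF G x) (H x)
  <= hi * L2vnorm mu (G \- F) * L2vnorm mu H.
Proof.
move=> F2 G2 H2.
have LF2 := diffusion_L2 F2; have LG2 := diffusion_L2 G2.
have FG2 := L2v_lin (-1) G2 F2; have LFG2 := diffusion_L2 FG2.
have -> : \int[mu]_x dotv (H x) (LF F x) - \int[mu]_x dotv (LF G x) (H x) =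
    \int[mu]_x dotv (LF (fun x => -1 *: G x + F x) x) (H x).
  transitivity (-1 * \int[mu]_x dotv (H x) (LF G x) + \int[mu]_x dotv (H x) (LF F x)).
    rewrite mulN1r addrC; congr (- _ + _).
    by apply: eq_Rintegral => x _; rewrite dotvC.
  rewrite -Rint_dotv_linr//; apply: eq_Rintegral => x _.
  by rewrite /LF mulmxv_lin dotvC.
apply: le_trans (L2v_cauchy_schwarz LFG2 H2) _.
rewrite ler_wpM2r ?L2vnorm_ge0//; apply: le_trans (diffusion_norm FG2) _.
rewrite (_ : L2vnorm mu _ = L2vnorm mu (G \- F))//.
rewrite -L2vnormN; congr (L2vnorm mu _); apply/funext => x /=.
by rewrite scaleN1r opprD opprK.
Qed.

End diffusion_operator.

Section real_inequalities.
Context (R : realType).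

(** With [q = p / lo] and [s] the square root, the hypothesis reads [n ^+ 2 <= q * n + s ^+ 2 / 2].
    If [n > q + s], then [n * (n - q) > s * n >= s ^+ 2], a contradiction; the factor [2] under the
    root leaves room to spare. *)
Lemma quadratic_inequality (lo n p g : R) : 0 < lo -> 0 <= n -> 0 <= p -> 0 <= g ->
  lo * n ^+ 2 <= p * n + g -> n <= Num.sqrt (2 / lo * g) + lo^-1 * p.
Proof.
move=> lo0 n0 p0 g0 h.
have a0 : 0 <= 2 / lo * g by rewrite mulr_ge0// divr_ge0// ltW.
set s := Num.sqrt _; have s0 : 0 <= s by exact: sqrtr_ge0.
have s2 : s ^+ 2 = 2 / lo * g by rewrite sqr_sqrtr.
have lon : lo != 0 by rewrite gt_eqF.
have q0 : 0 <= lo^-1 * p by rewrite mulr_ge0// invr_ge0 ltW.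
set q := lo^-1 * p in q0 *.
have {}h : n ^+ 2 <= q * n + s ^+ 2 / 2.
  have -> : q * n + s ^+ 2 / 2 = lo^-1 * (p * n + g) by rewrite s2 /q; field.
  by rewrite ler_pdivlMl.
rewrite leNgt; apply/negP => ns.
have h1 : s < n - q by lra.
have h2 : s < n by lra.
have h3 : 0 < (n - q - s) * n by rewrite mulr_gt0//; lra.
have h4 : s * s <= s * n by rewrite ler_wpM2l// ltW.
nra.
Qed.

Lemma le_harmonic (x y S : R) : 0 <= S -> (forall n, x <= y + n.+1%:R^-1 * S) -> x <= y.
Proof.
move=> S0 h; apply/ler_addgt0Pr => e e0.
have e1 : 0 < e / (S + 1) by rewrite divr_gt0// ltr_wpDl.
have [m _ /(_ _ (leqnn m)) hm] := near_infty_natSinv_lt (PosNum e1).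
apply: le_trans (h m) _; rewrite lerD2l.
have : m.+1%:R^-1 * S <= e / (S + 1) * S by rewrite ler_wpM2r// ltW.
move/le_trans; apply; rewrite mulrAC ler_pdivrMr ?ltr_wpDl// mulrDr mulr1 lerDl; exact: ltW.
Qed.

Lemma le_sup_image (I : Type) (P : I -> Prop) (F : I -> R) (C : R) i : P i ->
  (forall j, P j -> F j <= C) -> F i <= sup [set F j | j in [set j | P j]].
Proof.
move=> Pi FC; apply: ub_le_sup; last by exists i.
by exists C => _ [j Pj <-]; exact: FC.
Qed.

(** On a trivial space the index set is empty and the supremum is the default [0], so no index can
    be assumed. *)
Lemma sup_image_ge0 (I : Type) (P : I -> Prop) (F : I -> R) (C : R) :
  (forall j, P j -> F j <= C) -> (forall j, P j -> 0 <= F j) ->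
  0 <= sup [set F j | j in [set j | P j]].
Proof.
move=> FC F0; have [[i Pi]|nP] := pselect (exists i, P i).
  exact: le_trans (F0 _ Pi) (le_sup_image Pi FC).
rewrite (_ : [set F j | j in _] = set0) ?sup0//.
by apply/seteqP; split=> [x [j Pj _]|x []]; apply: nP; exists j.
Qed.

End real_inequalities.

(** * Bounds on finite-dimensional spaces *)

Section vect_bounds.
Import VectorInternalTheory.
Context (R : realType) (X : vectType R) (N : X -> R) (Cc : R).
Hypothesis Cc_ge0 : 0 <= Cc.
Hypothesis coord_N : forall u i, `|v2r u 0 i| <= Cc * N u.
Hypothesis N_ge0 : forall u, 0 <= N u.

(** [Q u M] reads: [M] is a certified bound for [u]. A relation suits norms defined by an infimum
    over liftings, since liftings of the basis vectors combine linearly and no nearly optimal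
    lifting is needed. *)
Lemma vect_relation_bound (Q : X -> R -> Prop) : Q 0 0 ->
  (forall c u v M M', Q u M -> Q v M' -> Q (c *: u + v) (`|c| * M + M')) ->
  (forall u, exists M, Q u M) ->
  exists C, forall u, exists2 M, M <= C * N u & Q u M.
Proof.
move=> Q0 Qlin Qex.
have [m mP] := choice (fun i : 'I_(dim X) => Qex (r2v (delta_mx 0 i))).
exists (Cc * \sum_i `|m i|) => u.
exists (\sum_i `|v2r u 0 i| * m i).
  rewrite mulrAC mulr_sumr; apply: ler_sum => i _.
  apply: (@le_trans _ _ (`|v2r u 0 i| * `|m i|)); first by rewrite ler_wpM2l// ler_norm.
  exact: ler_wpM2r.
rewrite [X in Q X](vect_expand u).
elim: (index_enum _) => [|i s IH]; first by rewrite !big_nil.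
by rewrite !big_cons; exact: Qlin.
Qed.

Lemma vect_subadditive_bound (p : X -> R) : p 0 <= 0 ->
  (forall c u v, p (c *: u + v) <= `|c| * p u + p v) ->
  exists C, forall u, p u <= C * N u.
Proof.
move=> p0 plin; have [|||C hC] := @vect_relation_bound (fun u M => p u <= M).
- exact: p0.
- move=> c u v M M' h h'; apply: le_trans (plin _ _ _) _.
  by apply: lerD => //; rewrite ler_wpM2l.
- by move=> u; exists (p u).
by exists C => u; have [M h h'] := hC u; exact: le_trans h' h.
Qed.

Lemma vect_linear_bound (l : X -> R) :
  (forall (c : R) u v, l (c *: u + v) = c * l u + l v) ->
  exists C, forall u, `|l u| <= C * N u.
Proof.
move=> llin; apply: vect_subadditive_bound => [|c u v].
  by have := llin (-1) 0 0; rewrite scaler0 addr0 mulN1r addNr => ->; rewrite normr0.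
by rewrite llin; apply: le_trans (ler_normD _ _) _; rewrite normrM.
Qed.

End vect_bounds.

Section linear_ae.
Context (disp : measure_display) (T : measurableType disp) (R : realType).
Context (mu : {measure set T -> \bar R}) (X : vectType R).

Lemma L2norm0 : L2norm mu (fun=> 0) = 0.
Proof.
rewrite sqrt_Rint_sqr (_ : (fun x => _) = fun=> 0); last by apply/funext => x; rewrite expr0n.
by rewrite Rintegral_cst// mul0r sqrtr0.
Qed.

Section scalar.
Context (t : X -> T -> R).
Hypothesis t_lin : forall (c : R) u v, \forall x \ae mu, t (c *: u + v) x = c * t u x + t v x.

Lemma ae_linear0 : \forall x \ae mu, t 0 x = 0.
Proof.
have := t_lin (-1) 0 0; rewrite scaler0 addr0.
by apply: ae_imp => x; lra.
Qed.

Lemma ae_linearB u v : \forall x \ae mu, t (u - v) x = t u x - t v x.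
Proof.
rewrite addrC -scaleN1r.
by apply: (ae_imp _ (t_lin (-1) v u)) => x ->; rewrite mulN1r addrC.
Qed.

Lemma ae_linear_sum (I : Type) (s : seq I) (c : I -> R) (e : I -> X) :
  \forall x \ae mu, t (\sum_(i <- s) c i *: e i) x = \sum_(i <- s) c i * t (e i) x.
Proof.
elim: s => [|i s IH].
  by rewrite big_nil; apply: (ae_imp _ ae_linear0) => x ->; rewrite big_nil.
rewrite big_cons; apply: (ae_imp2 _ (t_lin (c i) (e i) (\sum_(j <- s) c j *: e j)) IH) => x -> ->.
by rewrite big_cons.
Qed.

Import VectorInternalTheory.

Lemma ae_linear_expand (c : 'rV[R]_(dim X)) :
  \forall x \ae mu, t (r2v c) x = \sum_i c 0 i * t (r2v (delta_mx 0 i)) x.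
Proof.
rewrite [r2v c](vect_expand (r2v c)) r2vK; exact: ae_linear_sum.
Qed.

Variables (Q : T -> Prop) (a : T -> R).
Let K : set X := [set v | \forall x \ae mu, Q x -> t v x <= a x].

Lemma ae_constraint_convex (s : R) u v : 0 <= s <= 1 -> K u -> K v -> K (s *: (v - u) + u).
Proof.
move=> /andP[s0 s1] Ku Kv; have Kuv := ae_imp2 (fun x => @conj _ _) Ku Kv.
have h := ae_imp2 (fun x => @conj _ _) (t_lin s (v - u) u) (ae_linearB v u).
apply: (ae_imp2 _ Kuv h) => x [hu hv] [-> ->] Qx.
have {}hu := hu Qx; have {}hv := hv Qx; nra.
Qed.

(** A limit [c] is approached by a sequence from [K], so only countably many null sets are
    discarded. At any other point the constraint at [c] holds up to [1/(n+1)] times a sum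
    independent of [n]. *)
Lemma ae_constraint_closed : closed (r2v @^-1` K : set 'rV[R]_(dim X)).
Proof.
move=> c Kc.
have /choice[p hp] : forall n, exists p : 'rV[R]_(dim X), K (r2v p) /\ `|c - p| < n.+1%:R^-1.
  move=> n; have n0 : (0 : R) < n.+1%:R^-1 by rewrite invr_gt0.
  have [p [Kp cp]] := Kc _ (nbhsx_ballx c _ n0).
  by exists p; split => //; move: cp; rewrite -ball_normE.
have h1 := ae_imp2 (fun x => @conj _ _) (ae_linear_expand c)
  (ae_forall_nat (fun n => ae_linear_expand (p n))).
apply: (ae_imp2 _ h1 (ae_forall_nat (fun n => (hp n).1))) => x [e1 e2] h Qx.
apply: (@le_harmonic _ _ _ (\sum_i `|t (r2v (delta_mx 0 i)) x|)) => [|n].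
  by apply: sumr_ge0 => i _; exact: normr_ge0.
rewrite -lerBlDl; apply: le_trans (_ : t (r2v c) x - t (r2v (p n)) x <= _).
  by rewrite lerD2l lerN2; exact: h.
rewrite e1 e2 -sumrB mulr_sumr; apply: ler_sum => i _.
rewrite -mulrBl; apply: le_trans (ler_norm _) _; rewrite normrM ler_wpM2r//.
apply: le_trans (ltW (hp n).2).
by have := coord_le_norm (c - p n) i; rewrite !mxE.
Qed.

Hypothesis t_L2 : forall v, L2 mu (t v).

Lemma Rint_linear_L2 f (c : R) u v : L2 mu f ->
  \int[mu]_x (f x * t (c *: u + v) x) =
  c * \int[mu]_x (f x * t u x) + \int[mu]_x (f x * t v x).
Proof.
move=> f2; rewrite -Rint_mulr_lin//; apply: ae_eq_Rint.
- exact: L1_measurable (L2_mul f2 (t_L2 _)).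
- exact: L1_measurable (L2_mul f2 (L2_lin c (t_L2 _) (t_L2 _))).
- by apply: (ae_imp _ (t_lin c u v)) => x ->.
Qed.

Lemma L2norm_linear_lin (c : R) u v :
  L2norm mu (t (c *: u + v)) <= `|c| * L2norm mu (t u) + L2norm mu (t v).
Proof.
rewrite (ae_eq_L2norm (L2_measurable (t_L2 _))
  (L2_measurable (L2_lin c (t_L2 u) (t_L2 v))) (t_lin c u v)).
exact: L2norm_lin_le.
Qed.

Lemma L2norm_linear0 : L2norm mu (t 0) = 0.
Proof.
rewrite (ae_eq_L2norm (L2_measurable (t_L2 0)) (L2_measurable (L2_0 mu)) ae_linear0).
exact: L2norm0.
Qed.

Lemma L2norm_linear_triangle u v h : L2 mu h ->
  L2norm mu (t u \- h) <= L2norm mu (t (u - v)) + L2norm mu (t v \- h).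
Proof.
move=> h2.
have B2 w : L2 mu (t w \- h).
  by rewrite (_ : _ \- _ = fun x => -1 * h x + t w x); [exact: L2_lin|
    apply/funext => x; rewrite mulN1r addrC].
have S2 : L2 mu (t (u - v) \+ (t v \- h)).
  by rewrite (_ : _ \+ _ = fun x => 1 * t (u - v) x + (t v \- h) x); [exact: L2_lin|
    apply/funext => x; rewrite mul1r].
rewrite (ae_eq_L2norm (L2_measurable (B2 u)) (L2_measurable S2)); first exact: L2normD.
by apply: (ae_imp _ (ae_linearB u v)) => x /= ->; rewrite addrA subrK.
Qed.

End scalar.

Section vector.
Context (d : nat) (G : X -> T -> 'rV[R]_d).
Hypothesis G_L2 : forall v, L2v mu (G v).
Hypothesis G_lin : forall (c : R) u v, \forall x \ae mu, G (c *: u + v) x = c *: G u x + G v x.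
Hypothesis G_norm : is_norm (fun v => L2vnorm mu (G v)).
Local Notation N := (fun v => L2vnorm mu (G v)).

Lemma Rint_linear_L2v H (c : R) u v : L2v mu H ->
  \int[mu]_x dotv (H x) (G (c *: u + v) x) =
  c * \int[mu]_x dotv (H x) (G u x) + \int[mu]_x dotv (H x) (G v x).
Proof.
move=> H2; rewrite -Rint_dotv_linr//.
by apply: ae_eq_Rint_dotv => //; [exact: L2v_lin|exact: ae_all].
Qed.

Lemma ae_linearvB u v : \forall x \ae mu, G (u - v) x = G u x - G v x.
Proof.
rewrite addrC -scaleN1r.
by apply: (ae_imp _ (G_lin (-1) v u)) => x ->; rewrite scaleN1r addrC.
Qed.

Lemma L2vnorm_linear0 : N 0 = 0.
Proof. by have [_ NZ _] := G_norm; have := NZ 0 0; rewrite scale0r normr0 mul0r. Qed.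

Lemma L2vnorm_linear_gt0 u : u != 0 -> 0 < N u.
Proof.
move=> u0; rewrite lt_neqAle L2vnorm_ge0 andbT eq_sym.
by apply: contra u0 => /eqP; have [_ _ N0] := G_norm; move=> /N0 ->.
Qed.

Import VectorInternalTheory.

(** The Gram form of the discrete gradients is positive definite because its square root is a
    norm. *)
Lemma L2vnorm_linear_coord :
  exists2 C, 0 <= C & forall u i, `|v2r u 0 i| <= C * N u.
Proof.
pose b u v := \int[mu]_x dotv (G u x) (G v x).
have b_sym u v : b u v = b v u by apply: eq_Rintegral => x _; rewrite dotvC.
have [|||C C0 h] := @posdef_coord_bound R X b.
- exact: b_sym.
- by move=> c u v w; rewrite b_sym /b (Rint_linear_L2v c u v (G_L2 w)) -!/(b w _) !(b_sym w).
- by move=> u u0; rewrite /b -L2vnorm_sqr exprn_gt0// L2vnorm_linear_gt0.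
by exists C => // u i; rewrite L2vnormE; exact: h.
Qed.

Lemma L2vnorm_linear_triangle u v H : L2v mu H ->
  L2vnorm mu (G u \- H) <= L2vnorm mu (G (u - v)) + L2vnorm mu (G v \- H).
Proof.
move=> H2; have S2 := L2v_D (G_L2 (u - v)) (L2v_B (G_L2 v) H2).
rewrite (ae_eq_L2vnorm (L2v_B (G_L2 u) H2) S2).
  exact: L2vnormD (G_L2 _) (L2v_B (G_L2 v) H2).
by apply: (ae_imp _ (ae_linearvB u v)) => x /= ->; rewrite addrA subrK.
Qed.

End vector.
End linear_ae.

Section abstract_scheme.
Context (disp disp' : measure_display) (T : measurableType disp) (S : measurableType disp').
Context (R : realType) (mu : {measure set T -> \bar R}) (nu : {measure set S -> \bar R}).
Context (d : nat) (X : vectType R) (p : X -> T -> R) (t : X -> S -> R) (G : X -> T -> 'rV[R]_d).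
Hypothesis p_L2 : forall v, L2 mu (p v).
Hypothesis G_L2 : forall v, L2v mu (G v).
Hypothesis p_lin : forall (c : R) u v, \forall x \ae mu, p (c *: u + v) x = c * p u x + p v x.
Hypothesis t_lin : forall (c : R) u v, \forall x \ae nu, t (c *: u + v) x = c * t u x + t v x.
Hypothesis G_lin : forall (c : R) u v, \forall x \ae mu, G (c *: u + v) x = c *: G u x + G v x.
Hypothesis G_norm : is_norm (fun v => L2vnorm mu (G v)).
Context (Lam : T -> 'M[R]_d) (lo hi : R) (f : T -> R) (Q : S -> Prop) (a : S -> R).
Hypotheses (lo_gt0 : 0 < lo) (f_L2 : L2 mu f).
Hypothesis Lam_measurable : forall i j, measurable_fun setT (fun x => Lam x i j).
Hypothesis Lam_ae : \forall x \ae mu, (Lam x)^T = Lam x /\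
  forall m, eigenvalue (Lam x) m -> lo <= m <= hi.

(** Symmetry of [Lam] makes the diffusion form symmetric, as the minimisation argument requires, and
    its lower bound makes the form positive definite. *)
Lemma abstract_scheme_exists_unique (K := [set v | \forall x \ae nu, Q x -> t v x <= a x]) :
  K !=set0 ->
  exists! u, K u /\ forall v, K v ->
    \int[mu]_x dotv (mulmxv (Lam x) (G u x)) (G (u - v) x) <= \int[mu]_x (f x * p (u - v) x).
Proof.
move=> K0.
have bs u v := diffusion_sym lo_gt0 Lam_measurable Lam_ae (G_L2 u) (G_L2 v).
have LG2 u := diffusion_L2 lo_gt0 Lam_measurable Lam_ae (G_L2 u).
apply: (@variational_inequality R X
  (fun u v => \int[mu]_x dotv (mulmxv (Lam x) (G u x)) (G v x))
  (fun v => \int[mu]_x (f x * p v x)) K bs) => //.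
- move=> c u v w; rewrite bs (Rint_linear_L2v G_L2 G_lin c u v (LG2 w)).
  by rewrite (bs u) (bs v).
- move=> u u0; apply: lt_le_trans (diffusion_coercive lo_gt0 Lam_measurable Lam_ae (G_L2 u)).
  by rewrite mulr_gt0// exprn_gt0//; exact: L2vnorm_linear_gt0.
- by move=> c u v; exact: Rint_linear_L2.
- exact: ae_constraint_closed.
- by move=> s u v; exact: ae_constraint_convex.
Qed.

Lemma diffusion_linearB u v H : L2v mu H ->
  \int[mu]_x dotv (mulmxv (Lam x) (G (u - v) x)) (H x) =
  \int[mu]_x dotv (mulmxv (Lam x) (G u x)) (H x)
    - \int[mu]_x dotv (mulmxv (Lam x) (G v x)) (H x).
Proof.
move=> H2.
have bs w := diffusion_sym lo_gt0 Lam_measurable Lam_ae (G_L2 w) H2.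
have LH2 := diffusion_L2 lo_gt0 Lam_measurable Lam_ae H2.
rewrite !bs -(scaleN1r v) addrC (Rint_linear_L2v G_L2 G_lin (-1) v u LH2).
by rewrite mulN1r addrC.
Qed.

End abstract_scheme.

(** * The continuous problem *)

Lemma gradZ (R : realType) (d : nat) (c : R) (phi : 'rV[R]_d -> R) x : smooth phi ->
  grad (fun y => c * phi y) x = c *: grad phi x.
Proof.
move=> sphi; apply/rowP => i; rewrite !mxE.
have <- : (fun y => c * phi y + 0) = fun y => c * phi y by apply/funext => y; rewrite addr0.
by rewrite partial_lin ?partial_cst ?addr0//; exact: smooth_cst.
Qed.

Section continuous_problem.
Context (R : realType) (d : nat) (Omega : set 'rV[R]_d).
Local Notation E := 'rV[R]_d.
Local Notation dx := (dx Omega).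
Local Notation dS := (dS Omega).
Hypotheses (d0 : (0 < d)%N) (Omega_open : open Omega) (Omega_bd : bounded_set Omega).

(** Since [0 = 1 * 0 + 0], linearity shows the chosen gradient to equal twice itself almost
    everywhere. *)
Lemma wgrad0_ae : \forall x \ae dx, wgrad Omega (fun=> 0) x = 0.
Proof.
have [H0 _ _] := is_trace0 d0 Omega_open Omega_bd.
have := wgrad_lin d0 Omega_open Omega_bd 1 H0 H0.
have -> : (fun x : E => 1 * 0 + 0) = (fun=> 0 : R) by apply/funext => x; rewrite mulr0 addr0.
apply: ae_imp => x; rewrite scale1r => /eqP.
by rewrite -[X in X == _ -> _]addr0 (inj_eq (addrI _)) => /eqP.
Qed.

Lemma trace_norm0 :
  L2norm dx (fun=> 0 : R) + L2vnorm dx (wgrad Omega (fun=> 0)) = 0.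
Proof.
have [H0 _ _] := is_trace0 d0 Omega_open Omega_bd; have g2 := wgrad_L2 H0.
have e : \forall x \ae dx, wgrad Omega (fun=> 0) x = 0 *: wgrad Omega (fun=> 0) x.
  by apply: (ae_imp _ wgrad0_ae) => x ->; rewrite scaler0.
rewrite (ae_eq_L2vnorm g2 (L2v_Z 0 g2) e) (L2vnormZ 0 g2).
by rewrite normr0 mul0r addr0 L2norm0.
Qed.

Context (Lam : E -> 'M[R]_d) (lo hi : R) (G1 G3 : set E) (f a : E -> R) (ubar : E -> R).
Hypotheses (lo_gt0 : 0 < lo) (HLam : diffusion_tensor Omega Lam lo hi) (f2 : L2 dx f).
Hypothesis Hubar : signorini_solution Omega Lam f G1 G3 a ubar.
Let psi := fun x => mulmxv (Lam x) (wgrad Omega ubar x).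

Lemma ubar_H1 : H1 Omega ubar.
Proof. by have [[g [[]]]] := Hubar. Qed.

Lemma flux_L2v : L2v dx psi.
Proof. exact: (diffusion_L2 lo_gt0 HLam.1 HLam.2 (wgrad_L2 ubar_H1)). Qed.

Lemma signorini_le w : signorini_set Omega G1 G3 a w ->
  \int[dx]_x dotv (psi x) (wgrad Omega (fun x => -1 * w x + ubar x) x)
  <= \int[dx]_x (f x * (-1 * w x + ubar x)).
Proof.
move=> /Hubar.2.
have -> : (fun x => -1 * w x + ubar x) = ubar \- w.
  by apply/funext => x; rewrite mulN1r addrC.
move=> /le_trans; apply; rewrite le_eqVlt; apply/orP; left; apply/eqP.
by apply: eq_Rintegral => x _; rewrite mulN1r [- _ + _]addrC.
Qed.

(** The competitor [ubar - phi] is admissible, as [phi] has zero trace. *)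
Lemma signorini_test_le phi : test_function Omega phi ->
  \int[dx]_x dotv (psi x) (grad phi x) <= \int[dx]_x (f x * phi x).
Proof.
move=> tphi; have [[g [tg g1 g3]] _] := Hubar.
have tm := is_trace_lin d0 Omega_open Omega_bd (-1) (is_trace_test d0 Omega_open Omega_bd tphi) tg.
have := @signorini_le (fun x => -1 * phi x + ubar x) _.
have -> : (fun x => -1 * (-1 * phi x + ubar x) + ubar x) = phi.
  by apply/funext => x; ring.
have [g2 _] := test_function_weak_grad d0 Omega_open Omega_bd tphi.
rewrite (ae_eq_Rint_dotv flux_L2v flux_L2v (wgrad_L2 (H1_test d0 Omega_open Omega_bd tphi)) g2
  (ae_all _ (fun=> erefl)) (wgrad_test d0 Omega_open Omega_bd tphi)) => h.
apply: le_trans (h _) _.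
  exists (fun x => -1 * 0 + g x); split; [exact: tm| |].
    by apply: (ae_imp _ g1) => x gx /gx ->; rewrite mulr0 addr0.
  by apply: (ae_imp _ g3) => x gx /gx; rewrite mulr0 add0r.
rewrite le_eqVlt; apply/orP; left; apply/eqP.
by apply: eq_Rintegral => x _; congr (_ * _); ring.
Qed.

(** The preceding inequality for [phi] and for its opposite is an equality. *)
Lemma flux_weak_div : is_weak_div Omega psi (fun x => -1 * f x).
Proof.
split; first exact: L2_Z.
move=> phi tphi; have [g2 _] := test_function_weak_grad d0 Omega_open Omega_bd tphi.
have phi2 := test_function_L2 d0 Omega_bd tphi.
have -> : \int[dx]_x (-1 * f x * phi x) = - \int[dx]_x (f x * phi x).
  rewrite -[RHS]mulN1r -(RintZ _ (L2_mul f2 phi2)).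
  by apply: eq_Rintegral => x _; rewrite mulrA.
rewrite opprK; apply/eqP; rewrite eq_le signorini_test_le//=.
have := signorini_test_le (test_functionZ (-1) tphi).
have [sphi _ _] := tphi.
rewrite (_ : \int[dx]_x dotv _ _ = -1 * \int[dx]_x dotv (psi x) (grad phi x)); last first.
  rewrite -(RintZ _ (L1_dotv flux_L2v g2)).
  by apply: eq_Rintegral => x _; rewrite gradZ// dotvZr.
rewrite (_ : \int[dx]_x (f x * _) = -1 * \int[dx]_x (f x * phi x)); last first.
  rewrite -(RintZ _ (L2_mul f2 phi2)).
  by apply: eq_Rintegral => x _; rewrite mulrCA.
by rewrite !mulN1r lerN2.
Qed.

Lemma Rint_flux_div w : L2 dx w ->
  \int[dx]_x (wdiv Omega psi x * w x) = - \int[dx]_x (f x * w x).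
Proof.
move=> w2; have [dv2 dvE] := wdiv_ae d0 Omega_open Omega_bd flux_weak_div.
rewrite -mulN1r -(RintZ _ (L2_mul f2 w2)); apply: ae_eq_Rint.
- exact: L1_measurable (L2_mul dv2 w2).
- exact: L1_measurable (L1Z (-1) (L2_mul f2 w2)).
- by apply: (ae_imp _ dvE) => x ->; rewrite mulrA.
Qed.

Local Notation L := (normal_trace Omega psi).

(* If no functional satisfied the Green formula, [normal_trace] would be the
   default value [cst 0], for which the properties used below are trivial; so
   the uniqueness of traces is never needed. *)
Lemma normal_trace_cases : is_normal_trace Omega psi L \/ L = cst 0.
Proof.
rewrite /normal_trace; case: xgetP => [y _|_]; first by left.
by right.
Qed.

Lemma normal_trace_lin c v w g h : is_trace Omega v g -> is_trace Omega w h ->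
  L (fun x => c * g x + h x) = c * L g + L h.
Proof.
move=> tv tw; have [NT|->] := normal_trace_cases; last by rewrite /cst mulr0 addr0.
have [dv2 _] := wdiv_ae d0 Omega_open Omega_bd flux_weak_div.
rewrite (NT _ _ (is_trace_lin d0 Omega_open Omega_bd c tv tw)) (NT _ _ tv) (NT _ _ tw).
exact: (normal_trace_functional_lin d0 Omega_open Omega_bd c flux_L2v dv2 tv tw).
Qed.

(** Here [h] stands for the trace part of the discrete solution. Its lifting [w] is admissible; by
    Green's formula the continuous inequality says [L gubar <= L h], hence
    [L g - L h <= L g - L gubar]. The maximum with [0] also covers the default functional. *)
Lemma normal_trace_signorini_le v w g h gubar : is_trace Omega ubar gubar ->
  is_trace Omega v g -> is_trace Omega w h ->
  (\forall x \ae dS, G1 x -> h x = 0) -> (\forall x \ae dS, G3 x -> h x <= a x) ->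
  L g - L h <= Num.max 0 (L (g \- gubar)).
Proof.
move=> tu tv tw h1 h3.
have -> : g \- gubar = (fun x => -1 * gubar x + g x).
  by apply/funext => x; rewrite mulN1r addrC.
rewrite (normal_trace_lin (-1) tu tv) le_max; apply/orP.
have [NT|->] := normal_trace_cases; last by left; rewrite /cst subrr.
right; have := NT _ _ (is_trace_lin d0 Omega_open Omega_bd (-1) tw tu).
rewrite (normal_trace_lin (-1) tw tu) !mulN1r.
have wS : signorini_set Omega G1 G3 a w by exists h.
have [[Hu _ _] [Hw _ _]] := (tu, tw).
rewrite (Rint_flux_div (L2_lin (-1) Hw.1 Hu.1)) => E.
by have := signorini_le wS; rewrite -subr_le0 -E; lra.
Qed.

End continuous_problem.

(** * The discrete problem *)

Section discrete_problem.
Context (R : realType) (d : nat) (Omega : set 'rV[R]_d).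
Local Notation E := 'rV[R]_d.
Local Notation dx := (dx Omega).
Local Notation dS := (dS Omega).
Hypotheses (d0 : (0 < d)%N) (Omega_open : open Omega) (Omega_bd : bounded_set Omega).
Context (G1 : set E) (D : gradient_discretisation Omega G1).
Local Notation N := (fun v : gdX D => L2vnorm dx (gdGrad v)).

Let N_ge0 (v : gdX D) : 0 <= N v := L2vnorm_ge0 dx (gdGrad v).

Let N_gt0 (v : gdX D) (v0 : v != 0) : 0 < N v := L2vnorm_linear_gt0 (gdGrad_norm D) v0.

Let coord := L2vnorm_linear_coord (@gdGrad_L2 _ _ _ _ D) (@gdGrad_linear _ _ _ _ D)
  (gdGrad_norm D).

Lemma gdPi_bound : exists C, forall v : gdX D, L2norm dx (gdPi v) <= C * N v.
Proof.
have [Cc Cc0 hC] := coord.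
apply: (vect_subadditive_bound hC) => [|c u v].
  by rewrite (L2norm_linear0 (@gdPi_linear _ _ _ _ D) (@gdPi_L2 _ _ _ _ D)).
exact: (L2norm_linear_lin (@gdPi_linear _ _ _ _ D) (@gdPi_L2 _ _ _ _ D)).
Qed.

(** The certified bounds are norms of actual liftings, which dominate the quotient norm. *)
Lemma gdT_bound : exists C, forall v : gdX D, H12norm Omega (gdT v) <= C * N v.
Proof.
have [Cc Cc0 hC] := coord.
have T2 (v : gdX D) : L2 dS (gdT v) by have [w [_ ? _]] := gdT_H12 v.
have T0 : \forall x \ae dS, 0 = gdT (0 : gdX D) x.
  by apply: (ae_imp _ (ae_linear0 (@gdT_linear _ _ _ _ D))) => x ->.
have [||u|C h] := vect_relation_bound hC (Q := fun v M => exists2 w, is_trace Omega w (gdT v) &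
   L2norm dx w + L2vnorm dx (wgrad Omega w) <= M).
- exists (fun=> 0); last by rewrite (trace_norm0 d0 Omega_open Omega_bd).
  exact: (is_trace_ae d0 (T2 0) T0 (is_trace0 d0 Omega_open Omega_bd)).
- move=> c u v M M' [w tw wM] [w' tw' wM'].
  exists (fun x => c * w x + w' x).
    apply: (is_trace_ae d0 (T2 _) _ (is_trace_lin d0 Omega_open Omega_bd c tw tw')).
    by apply: (ae_imp _ (gdT_linear c u v)) => x ->.
  apply: le_trans (trace_norm_lin d0 Omega_open Omega_bd c tw tw') _.
  by apply: lerD => //; apply: ler_wpM2l.
- have [w tw] := gdT_H12 u; exists (L2norm dx w + L2vnorm dx (wgrad Omega w)).
  by exists w; [exact: tw|exact: lexx].
exists C => v; have [M MN [w tw wM]] := h v.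
exact: le_trans (H12norm_le tw) (le_trans wM MN).
Qed.

Let gdC_term (v : gdX D) := L2norm dx (gdPi v) / N v + H12norm Omega (gdT v) / N v.

Let gdC_term_bound : exists C, forall v : gdX D, v != 0 -> gdC_term v <= C.
Proof.
have [C hC] := gdPi_bound; have [C' hC'] := gdT_bound.
exists (C + C') => v v0; have Nv := N_gt0 v0.
by apply: lerD; rewrite ler_pdivrMr.
Qed.

Lemma gdC_ge0 : 0 <= gdC D.
Proof.
have [C hC] := gdC_term_bound.
apply: (sup_image_ge0 hC) => v v0.
by rewrite addr_ge0// divr_ge0 ?L2norm_ge0 ?N_ge0 ?H12norm_ge0.
Qed.

Lemma gdPi_le_gdC (v : gdX D) : L2norm dx (gdPi v) <= gdC D * N v.
Proof.
have [->|v0] := eqVneq v 0.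
  rewrite (L2norm_linear0 (@gdPi_linear _ _ _ _ D) (@gdPi_L2 _ _ _ _ D)).
  by rewrite mulr_ge0 ?gdC_ge0 ?N_ge0.
rewrite -ler_pdivrMr ?N_gt0//.
have [C hC] := gdC_term_bound.
have h := le_sup_image (F := gdC_term) v0 hC; apply: le_trans h.
by rewrite lerDl divr_ge0 ?H12norm_ge0 ?N_ge0.
Qed.

Context (psi : E -> E).
Hypotheses (psi2 : L2v dx psi) (div2 : L2 dx (wdiv Omega psi)).
Hypothesis L_lin : forall (c : R) (u v : gdX D),
  normal_trace Omega psi (gdT (c *: u + v)) =
  c * normal_trace Omega psi (gdT u) + normal_trace Omega psi (gdT v).

Let num (v : gdX D) := \int[dx]_x (dotv (gdGrad v x) (psi x) + gdPi v x * wdiv Omega psi x)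
   - normal_trace Omega psi (gdT v).

Lemma Rint_gdW_term (v : gdX D) :
  \int[dx]_x (dotv (gdGrad v x) (psi x) + gdPi v x * wdiv Omega psi x) =
  \int[dx]_x dotv (psi x) (gdGrad v x) + \int[dx]_x (wdiv Omega psi x * gdPi v x).
Proof.
rewrite -(RintD (L1_dotv psi2 (gdGrad_L2 v)) (L2_mul div2 (gdPi_L2 v))).
by apply: eq_Rintegral => x _; rewrite dotvC mulrC.
Qed.

Let num_bound : exists C, forall v : gdX D, `|num v| <= C * N v.
Proof.
have [Cc Cc0 hC] := coord; apply: (vect_linear_bound hC) => c u v.
rewrite /num !Rint_gdW_term L_lin.
rewrite (Rint_linear_L2v (@gdGrad_L2 _ _ _ _ D) (@gdGrad_linear _ _ _ _ D) c u v psi2).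
rewrite (Rint_linear_L2 (@gdPi_linear _ _ _ _ D) (@gdPi_L2 _ _ _ _ D) c u v div2).
by rewrite lin_rearr mulrBr opprD addrACA.
Qed.

Let gdW_term_bound : exists C, forall v : gdX D, v != 0 -> (N v)^-1 * `|num v| <= C.
Proof.
have [C hC] := num_bound; exists C => v v0.
by rewrite mulrC ler_pdivrMr ?N_gt0.
Qed.

Lemma gdW_ge0 : 0 <= gdW D psi.
Proof.
have [C hC] := gdW_term_bound.
by apply: (sup_image_ge0 hC) => v v0; rewrite mulr_ge0// invr_ge0 N_ge0.
Qed.

Lemma le_gdW (v : gdX D) :
  `|\int[dx]_x dotv (psi x) (gdGrad v x) + \int[dx]_x (wdiv Omega psi x * gdPi v x)
    - normal_trace Omega psi (gdT v)| <= gdW D psi * N v.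
Proof.
rewrite -Rint_gdW_term -/(num v).
have [->|v0] := eqVneq v 0.
  (* The vector [0] is outside the supremum, but the linear bound already makes its numerator
     vanish. *)
  have [C hC] := num_bound; have := hC 0.
  by rewrite (L2vnorm_linear0 (gdGrad_norm D)) !mulr0.
rewrite -ler_pdivrMr ?N_gt0// mulrC.
have [C hC] := gdW_term_bound.
exact: (le_sup_image (F := fun v => (N v)^-1 * `|num v|) v0 hC).
Qed.

End discrete_problem.

(** The extra [lo] beside [hi] and [c * hi] is the consistency error [s] added by the triangle
    inequality, written as [lo^-1 * (lo * s)]. *)
Lemma error_estimates_arithmetic (R : realType) (lo hi n p q s w c g : R) :
  0 < lo -> 0 <= c -> n <= g + lo^-1 * (w + hi * s) ->
  p <= n + s -> q <= c * n + s ->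
  p <= g + lo^-1 * (w + (hi + lo) * s) /\
  q <= c * g + lo^-1 * (c * w + (c * hi + lo) * s).
Proof.
move=> lo0 c0 hn hp hq; have lon : lo != 0 by rewrite gt_eqF.
have -> : g + lo^-1 * (w + (hi + lo) * s) = g + lo^-1 * (w + hi * s) + s by field.
have -> : c * g + lo^-1 * (c * w + (c * hi + lo) * s) =
    c * (g + lo^-1 * (w + hi * s)) + s by field.
split; [apply: le_trans hp _|apply: le_trans hq _]; rewrite lerD2r//.
exact: ler_wpM2l.
Qed.

(** * Energy and error estimates *)

Section error_estimate.
Context (R : realType) (d : nat) (Omega : set 'rV[R]_d).
Local Notation E := 'rV[R]_d.
Local Notation dx := (dx Omega).
Local Notation dS := (dS Omega).
Hypotheses (d0 : (0 < d)%N) (Omega_open : open Omega) (Omega_bd : bounded_set Omega).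
Context (Lam : E -> 'M[R]_d) (lo hi : R) (G1 G3 : set E) (f a : E -> R) (ubar : E -> R).
Hypotheses (lo_gt0 : 0 < lo) (hi_gt0 : 0 < hi) (HLam : diffusion_tensor Omega Lam lo hi).
Hypothesis f2 : L2 dx f.
Context (D : gradient_discretisation Omega G1).
Local Notation N := (fun v : gdX D => L2vnorm dx (gdGrad v)).

Lemma scheme_exists_unique : gdK D G3 a !=set0 ->
  exists! u : gdX D, scheme_solution D Lam f G3 a u.
Proof.
exact: (abstract_scheme_exists_unique (@gdPi_L2 _ _ _ _ D) (@gdGrad_L2 _ _ _ _ D)
  (@gdPi_linear _ _ _ _ D) (@gdT_linear _ _ _ _ D) (@gdGrad_linear _ _ _ _ D)
  (gdGrad_norm D) lo_gt0 f2 HLam.1 HLam.2).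
Qed.

Hypothesis Hubar : signorini_solution Omega Lam f G1 G3 a ubar.
Let psi := fun x => mulmxv (Lam x) (wgrad Omega ubar x).
Local Notation L := (normal_trace Omega psi).

Let gdT_trace (v : gdX D) : exists w, is_trace Omega w (gdT v) := gdT_H12 v.

(** [gdT] is linear only almost everywhere whereas [L] acts on functions; two almost everywhere
    equal traces share a lifting, so Green's formula gives them the same value. *)
Lemma normal_trace_gdT_lin (c : R) (u v : gdX D) : L (gdT (c *: u + v)) = c * L (gdT u) + L (gdT v).
Proof.
have [w tw] := gdT_trace u; have [w' tw'] := gdT_trace v.
rewrite -(normal_trace_lin d0 Omega_open Omega_bd lo_gt0 HLam f2 Hubar c tw tw').
have [NT|->//] := normal_trace_cases Omega Lam ubar.
have t3 := is_trace_lin d0 Omega_open Omega_bd c tw tw'.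
have [w3 [_ T2 _]] := gdT_trace (c *: u + v).
rewrite (NT _ _ t3); apply: NT; apply: (is_trace_ae d0 T2 _ t3).
by apply: (ae_imp _ (gdT_linear c u v)) => x ->.
Qed.

Let div2 : L2 dx (wdiv Omega psi).
Proof.
have divP := flux_weak_div d0 Omega_open Omega_bd lo_gt0 HLam f2 Hubar.
by have [] := wdiv_ae d0 Omega_open Omega_bd divP.
Qed.

Let psi2 : L2v dx psi := flux_L2v lo_gt0 HLam Hubar.

Lemma scheme_energy_estimate (u v : gdX D) gubar : scheme_solution D Lam f G3 a u ->
  gdK D G3 a v -> is_trace Omega ubar gubar ->
  lo * N (u - v) ^+ 2 <=
  (gdW D psi + hi * L2vnorm dx (gdGrad v \- wgrad Omega ubar)) * N (u - v)
    + Num.max 0 (L (gdT v \- gubar)).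
Proof.
move=> [Ku hu] Kv tu; set e := u - v.
have [Hu _ _] := tu; have gu2 := wgrad_L2 Hu.
have G2 (w : gdX D) : L2v dx (gdGrad w) := gdGrad_L2 w.
have coer := diffusion_coercive lo_gt0 HLam.1 HLam.2 (G2 e).
have := diffusion_linearB (@gdGrad_L2 _ _ _ _ D) (@gdGrad_linear _ _ _ _ D)
  lo_gt0 HLam.1 HLam.2 u v (G2 e).
rewrite -/e => lin; rewrite lin in coer.
have bound := diffusion_Rint_bound lo_gt0 hi_gt0 HLam.1 HLam.2 gu2 (G2 v) (G2 e).
have hue := hu v Kv.
have W := le_gdW psi2 div2 normal_trace_gdT_lin e.
have div := Rint_flux_div d0 Omega_open Omega_bd lo_gt0 HLam f2 Hubar (gdPi_L2 e).
have Te : L (gdT e) = L (gdT u) - L (gdT v).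
  by rewrite /e -scaleN1r addrC normal_trace_gdT_lin mulN1r addrC.
have [w tw] := gdT_trace v; have [w' tw'] := gdT_trace u.
have Gle := normal_trace_signorini_le d0 Omega_open Omega_bd lo_gt0 HLam f2 Hubar tu tw tw'
  (gdT_eq0 u) Ku.
move: coer bound hue W div Te Gle; rewrite -/e.
have -> : \int[dx]_x dotv (gdGrad e x) (mulmxv (Lam x) (wgrad Omega ubar x)) =
    \int[dx]_x dotv (psi x) (gdGrad e x) by apply: eq_Rintegral => x _; rewrite dotvC.
move: (\int[dx]_x dotv (psi x) (gdGrad e x)) (\int[dx]_x (wdiv Omega psi x * gdPi e x))
 (\int[dx]_x (f x * gdPi e x)) (\int[dx]_x dotv (mulmxv (Lam x) (gdGrad u x)) (gdGrad e x))
 (\int[dx]_x dotv (mulmxv (Lam x) (gdGrad v x)) (gdGrad e x))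
 (L (gdT e)) (L (gdT u)) (L (gdT v)) (Num.max 0 _) (gdW D psi) (L2vnorm dx (gdGrad e))
 (L2vnorm dx (gdGrad v \- wgrad Omega ubar)).
(* The chain is [lo * n ^+ 2 <= I - J <= C - J], then [C = - B <= A - Te + W * n] and
   [A - J <= hi * s * n], and finally [- Te = Tv - Tu <= g]. The lower half of the absolute value is
   the one that serves. *)
move=> A B C I J Te Tu Tv g W n s coer bound hue hW dB dT Gle.
move: hW; rewrite ler_norml => /andP[hW _].
lra.
Qed.

Lemma signorini_error_estimate (u v : gdX D) gubar
    (g := Num.sqrt (2 / lo * Num.max 0 (L (gdT v \- gubar)))) :
  scheme_solution D Lam f G3 a u -> gdK D G3 a v -> is_trace Omega ubar gubar ->
  L2vnorm dx (gdGrad u \- wgrad Omega ubar)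
    <= g + lo^-1 * (gdW D psi + (hi + lo) * gdS ubar v) /\
  L2norm dx (gdPi u \- ubar)
    <= gdC D * g + lo^-1 * (gdC D * gdW D psi + (gdC D * hi + lo) * gdS ubar v).
Proof.
move=> su Kv tu; have [Hu _ _] := tu; have gu2 := wgrad_L2 Hu.
have n0 : 0 <= N (u - v) := L2vnorm_ge0 _ _.
have W0 : 0 <= gdW D psi := gdW_ge0 psi2 div2 normal_trace_gdT_lin.
have C0 : 0 <= gdC D := gdC_ge0 d0 Omega_open Omega_bd D.
have Cle := gdPi_le_gdC d0 Omega_open Omega_bd (u - v).
have est := scheme_energy_estimate su Kv tu.
have trG := L2vnorm_linear_triangle (@gdGrad_L2 _ _ _ _ D) (@gdGrad_linear _ _ _ _ D) u v gu2.
have trP := L2norm_linear_triangle (@gdPi_linear _ _ _ _ D) (@gdPi_L2 _ _ _ _ D) u v Hu.1.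
have a0 : 0 <= L2norm dx (gdPi v \- ubar) := L2norm_ge0 _ _.
have b0 : 0 <= L2vnorm dx (gdGrad v \- wgrad Omega ubar) := L2vnorm_ge0 _ _.
have s0 : 0 <= gdS ubar v := addr_ge0 a0 b0.
have as' : L2norm dx (gdPi v \- ubar) <= gdS ubar v by rewrite lerDl.
have bs : L2vnorm dx (gdGrad v \- wgrad Omega ubar) <= gdS ubar v by rewrite lerDr.
have m0 : 0 <= Num.max 0 (L (gdT v \- gubar)) by rewrite le_max lexx.
apply: (error_estimates_arithmetic (n := N (u - v)) lo_gt0 C0).
- apply: (quadratic_inequality lo_gt0 n0 _ m0).
    by rewrite addr_ge0// mulr_ge0// ltW.
  apply: le_trans est _; rewrite lerD2r; apply: ler_wpM2r => //.
  by rewrite lerD2l ler_pM2l.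
- by apply: le_trans trG _; rewrite lerD2l.
- by apply: le_trans trP _; apply: lerD.
Qed.

End error_estimate.

Theorem theorem2p7 (R : realType) (d : nat) (Omega : set 'rV[R]_d)
  (Lam : 'rV[R]_d -> 'M[R]_d) (lo hi : R)
  (G1 G2 G3 : set 'rV[R]_d) (f a : 'rV[R]_d -> R)
  (d_gt0 : (0 < d)%N)
  (Omega_open : open Omega) (Omega_bounded : bounded_set Omega)
  (Omega_connected : connected Omega)
  (Omega_lipschitz : lipschitz_boundary Omega)
  (lo_gt0 : 0 < lo) (hi_gt0 : 0 < hi)
  (HLam : diffusion_tensor Omega Lam lo hi)
  (HG : boundary_partition Omega G1 G2 G3)
  (G1_gt0 : (0 < dS Omega G1)%E)
  (Hf : L2 (dx Omega) f) (Ha : L2 (dS Omega) a)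
  (K_neq0 : signorini_set Omega G1 G3 a !=set0)
  (ubar : 'rV[R]_d -> R)
  (Hubar : signorini_solution Omega Lam f G1 G3 a ubar)
  (D : gradient_discretisation Omega G1)
  (KD_neq0 : gdK D G3 a !=set0) :
  (exists! u : gdX D, scheme_solution D Lam f G3 a u) /\
  forall u : gdX D, scheme_solution D Lam f G3 a u ->
  forall vD : gdX D, gdK D G3 a vD ->
  forall gubar : 'rV[R]_d -> R, is_trace Omega ubar gubar ->
  let psi := fun x => mulmxv (Lam x) (wgrad Omega ubar x) in
  let G := normal_trace Omega psi (gdT vD \- gubar) in
  L2vnorm (dx Omega) (gdGrad u \- wgrad Omega ubar)
    <= Num.sqrt (2 / lo * Num.max 0 G)
       + lo^-1 * (gdW D psi + (hi + lo) * gdS ubar vD)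
  /\
  L2norm (dx Omega) (gdPi u \- ubar)
    <= gdC D * Num.sqrt (2 / lo * Num.max 0 G)
       + lo^-1 * (gdC D * gdW D psi
                  + (gdC D * hi + lo) * gdS ubar vD).
Proof.
split=> [|u su v Kv gubar tu psi G];
  first exact: (scheme_exists_unique lo_gt0 HLam Hf KD_neq0).
exact: (signorini_error_estimate d_gt0 Omega_open Omega_bounded lo_gt0 hi_gt0
  HLam Hf Hubar su Kv tu).
Qed.
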